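(* Let $1\le p\le\infty$, $1/p+1/p'=1$, and let $t_0\in[a,b]$ be fixed. (1) Let matrices $\alpha_s\in\mathbb{C}^{rm\times m}$, $s=0,\ldots,n+r-1$, and a matrix-valued function $\Phi\in L_{p'}([a,b];\mathbb{C}^{rm\times m})$ be given. Then the operator $$By=\sum_{s=0}^{n+r-1}\alpha_s\,y^{(s)}(t_0)+\int_a^b\Phi(t)\,y^{(n+r)}(t)\,dt,\qquad y\in(W^{n+r}_p)^m,\qquad(\star)$$ acts continuously from $(W^{n+r}_p)^m$ into $\mathbb{C}^{rm}$ and its norm satisfies $$\|B\|\le\gamma\max_s|\alpha_s|+\|\Phi\|_{L_{p'}},$$ where $\gamma>0$ is a constant independent of the $\alpha_s$ and $\Phi$. (2) If $p\ne\infty$, then every bounded linear operator $B\colon(W^{n+r}_p)^m\to\mathbb{C}^{rm}$ admits a unique canonical representation of the form $(\star)$, with $\alpha_s\in\mathbb{C}^{rm\times m}$ and $\Phi\in L_{p'}([a,b];\mathbb{C}^{rm\times m})$.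
   Context: Let $(a,b)\subset\mathbb{R}$ be a finite interval, $n\in\mathbb{N}\cup\{0\}$, $m,r\in\mathbb{N}=\{1,2,\ldots\}$. $W^{k}_p=W^k_p([a,b];\mathbb{C})$ is the complex Sobolev space with norm $\|y\|_{k,p}=\sum_{s=0}^{k}\|y^{(s)}\|_{L_p}$. $(W^k_p)^m$ denotes the space of $\mathbb{C}^m$-valued (column) functions with all components in $W^k_p$. Norms of vectors, matrices, and vector- or matrix-valued functions are the sums of the norms of their entries; $|\alpha_s|$ is the norm of the matrix $\alpha_s$. The conjugate exponent $p'$ is $\infty$ for $p=1$ and $1$ for $p=\infty$. Uniqueness of $\Phi$ is as an element of $L_{p'}$ (i.e. up to equality almost everywhere). *)

(* Defs.v *)
From HB Require Import structures.
From mathcomp Require Import all_boot all_order all_algebra.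
From mathcomp Require Import complex.
From mathcomp Require Import all_classical all_reals all_analysis.

Set Implicit Arguments.
Unset Strict Implicit.
Unset Printing Implicit Defensive.

Import Order.TTheory GRing.Theory Num.Theory.
Import numFieldNormedType.Exports.

Local Open Scope classical_set_scope.
Local Open Scope ring_scope.
Local Open Scope complex_scope.

(* Functions on [a, b] are represented by total functions on R; every notion
   below depends only on their values on [a, b]. *)

Section ScalarFunctions.
Context {R : realType}.
Implicit Types (a b t : R) (p : \bar R) (g : R -> R) (f : R -> R[i]).

(* The real-valued modulus; [`|z|] itself lives in R[i]. *)
Definition cabs (z : R[i]) : R := ComplexField.Normc.normc z.

(* Derivatives on the closed interval: x tends to t inside [a, b], so that they
   are one-sided at the endpoints.  Where the limit does not exist [lim] returns
   an arbitrary value; for the top derivative of an element of the Sobolev space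
   this happens on a null set only. *)
Definition diff_quotient g t : R -> R := fun x => (g x - g t) / (x - t).

Definition derivable_on a b g t : Prop :=
  cvg (diff_quotient g t @ within `[a, b] t^').

Definition derive_on a b g t : R :=
  lim (diff_quotient g t @ within `[a, b] t^').

Definition cderivable_on a b f t : Prop :=
  derivable_on a b (fun x => complex.Re (f x)) t /\
  derivable_on a b (fun x => complex.Im (f x)) t.

Definition cderive_on a b f : R -> R[i] := fun t =>
  derive_on a b (fun x => complex.Re (f x)) t +i* derive_on a b (fun x => complex.Im (f x)) t.

Definition cderiven_on a b (s : nat) f : R -> R[i] :=
  iter s (cderive_on a b) f.

Definition abs_continuous_on a b f : Prop :=
  forall eps : R, 0 < eps -> exists2 delta : R, 0 < delta &
    forall (N : nat) (u v : 'I_N -> R),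
      (forall i, a <= u i /\ u i <= v i /\ v i <= b) ->
      (forall i j, i != j -> v i <= u j \/ v j <= u i) ->
      \sum_(i < N) (v i - u i) < delta ->
      \sum_(i < N) cabs (f (v i) - f (u i)) < eps.

(* [measurable_fun] on R refers to Borel sets; up to null sets this is Lebesgue
   measurability. *)
Definition Lebesgue_measurable_on a b f : Prop :=
  exists h : R -> R[i],
    [/\ measurable_fun `[a, b] (fun t => complex.Re (h t)),
        measurable_fun `[a, b] (fun t => complex.Im (h t)) &
        f = h %[ae @lebesgue_measure R in `[a, b]%classic]].

Definition Lp_norm a b p f : \bar R :=
  Lnorm (@lebesgue_measure R) p ((fun t => (cabs (f t))%:E) \_ `[a, b]).

Definition in_Lp a b p f : Prop :=
  Lebesgue_measurable_on a b f /\ (Lp_norm a b p f < +oo)%E.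

Definition cintegral a b f : R[i] :=
  (\int[@lebesgue_measure R]_(t in `[a, b]) complex.Re (f t)) +i*
  (\int[@lebesgue_measure R]_(t in `[a, b]) complex.Im (f t)).

(* For k >= 1: f in C^(k-1)[a, b], f^(k-1) absolutely continuous on [a, b] and
   f^(k) in L_p.  The continuity of f, ..., f^(k-1) follows from the first two
   conjuncts, and with it f^(s) in L_p for s < k. *)
Definition in_sobolev a b (k : nat) p f : Prop :=
  if k is k'.+1 then
    [/\ forall s, (s < k')%N -> forall t, t \in `[a, b] ->
          cderivable_on a b (cderiven_on a b s f) t,
        abs_continuous_on a b (cderiven_on a b k' f) &
        in_Lp a b p (cderiven_on a b k'.+1 f)]
  else in_Lp a b p f.

Definition sobolev_norm a b (k : nat) p f : \bar R :=
  (\sum_(s < k.+1) Lp_norm a b p (cderiven_on a b s f))%E.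

End ScalarFunctions.

Section VectorFunctions.
Context {R : realType}.
Implicit Types (a b t : R) (p : \bar R).

Definition mxnorm q m (A : 'M[R[i]]_(q, m)) : R :=
  \sum_(i < q) \sum_(j < m) cabs (A i j).

Definition in_Lp_mx q m a b p (Phi : R -> 'M[R[i]]_(q, m)) : Prop :=
  forall i j, in_Lp a b p (fun t => Phi t i j).

Definition Lp_norm_mx q m a b p (Phi : R -> 'M[R[i]]_(q, m)) : \bar R :=
  (\sum_(i < q) \sum_(j < m) Lp_norm a b p (fun t => Phi t i j))%E.

Definition mxintegral q m a b (F : R -> 'M[R[i]]_(q, m)) : 'M[R[i]]_(q, m) :=
  \matrix_(i, j) cintegral a b (fun t => F t i j).

Definition vderiven_on m a b (s : nat) (y : R -> 'cV[R[i]]_m) :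
    R -> 'cV[R[i]]_m :=
  fun t => \col_i cderiven_on a b s (fun x => y x i ord0) t.

Definition in_sobolev_vec m a b (k : nat) p (y : R -> 'cV[R[i]]_m) : Prop :=
  forall i, in_sobolev a b k p (fun t => y t i ord0).

Definition sobolev_norm_vec m a b (k : nat) p (y : R -> 'cV[R[i]]_m) : \bar R :=
  (\sum_(i < m) sobolev_norm a b k p (fun t => y t i ord0))%E.

End VectorFunctions.

(* Operators from (W^k_p)^m to C^q are total maps of which only the values on
   (W^k_p)^m matter.  By linearity and boundedness, B y = B z whenever y and z
   in (W^k_p)^m agree on [a, b]. *)
Section Operators.
Context {R : realType} (a b : R) (k : nat) (p : \bar R) (m q : nat).
Implicit Type B : (R -> 'cV[R[i]]_m) -> 'cV[R[i]]_q.

Let W := @in_sobolev_vec R m a b k p.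
Let W_norm := @sobolev_norm_vec R m a b k p.

Definition sobolev_linear B : Prop :=
  forall (c : R[i]) y z, W y -> W z -> B (c *: y + z) = c *: B y + B z.

Definition sobolev_continuous B : Prop :=
  forall y, W y -> forall eps : R, 0 < eps ->
    exists2 delta : R, 0 < delta &
      forall z, W z -> (W_norm (z - y)%R < delta%:E)%E ->
        mxnorm (B z - B y) < eps.

Definition sobolev_bounded B : Prop :=
  exists M : R, forall y, W y -> ((mxnorm (B y))%:E <= M%:E * W_norm y)%E.

Definition sobolev_opnorm B : \bar R :=
  ereal_sup [set (mxnorm (B y))%:E | y in [set y | W y /\ (W_norm y <= 1)%E]].

End Operators.

Definition canonical_operator {R : realType} (a b t0 : R) (k m q : nat)
    (alpha : 'I_k -> 'M[R[i]]_(q, m)) (Phi : R -> 'M[R[i]]_(q, m))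
    (y : R -> 'cV[R[i]]_m) : 'cV[R[i]]_q :=
  \sum_(s < k) alpha s *m vderiven_on a b s y t0
  + mxintegral a b (fun t => Phi t *m vderiven_on a b k y t).

(* Main.v *)
(* Let K = n + r.  For (1), each y^(s)(t0) with s < K is bounded by the Sobolev
   norm (average y^(s)(t) + (y^(s)(t0) - y^(s)(t)) over t in [a, b]), and
   Hoelder's inequality bounds the integral.

   For (2), y in W^K_p corresponds to its data (y(t0), ..., y^(K-1)(t0), y^(K))
   by K-fold integration from t0, and any data in C^K x L_p occur.  For zero
   initial data the Sobolev norm is bounded by a multiple of the L_p norm of
   y^(K), so B y is a function of the data: a linear one on C^K, which gives the
   alpha_s, plus a bounded functional on L_p, which gives Phi by Riesz's theorem.
   Testing on a single nonzero datum gives uniqueness.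

   Two classical facts underlie this.  An absolutely continuous f is the
   integral of its derivative: f is the difference of two monotone functions
   whose Stieltjes measures are absolutely continuous (through total variation),
   so Radon-Nikodym gives a density.  The dual of L_p for p < oo is L_p': the
   density of E |-> l(1_E) represents l on bounded functions, and testing on
   truncations of its powers shows that it lies in L_p'. *)

Require Import Defs.
From HB Require Import structures.
From mathcomp Require Import all_boot all_order all_algebra.
From mathcomp Require Import complex.
From mathcomp Require Import ring lra.
From mathcomp Require Import all_classical all_reals all_analysis.
From mathcomp Require Import measurable_realfun ess_sup_inf.
Import Order.TTheory GRing.Theory Num.Theory.
Import numFieldNormedType.Exports.
Local Open Scope classical_set_scope.
Local Open Scope ring_scope.
Set Implicit Arguments.
Unset Strict Implicit.
Unset Printing Implicit Defensive.

Import HBNNSimple.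

(** * Absolutely continuous real functions *)

Section AbsoluteContinuity.
Context {R : realType}.
Implicit Types (a b t x : R) (f g : R -> R) (s w : seq (R * R)).

(** Two features of the definitions shape the proof. Derivatives are values of [lim], arbitrary
    where no limit exists, and functions are total although only their values on [a, b] count. So
    differentiation is handled relationally ([is_deriv_on]), the top derivative is linear only
    almost everywhere, and functions with the same data need not be equal: that B does not separate
    them is drawn from its boundedness. Absolute continuity speaks of finite families of segments,
    Radon-Nikodym of null sets. The passage goes from finite families to open sets, then by outer
    regularity to null sets. The density that represents a functional on L_p is at first merely
    integrable, so it is paired with bounded functions only until it is known to lie in L_p'.
    Complex scalars are reduced to two real functionals, the real and imaginary parts of L on real
    functions. The coefficient 1 of the norm of Phi comes from the sharp estimate of the modulus of
    a complex integral by the integral of the modulus; the constants in the pointwise estimates may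
    be crude. *)

Definition in_segment a b (p : R * R) := [&& a <= p.1, p.1 <= p.2 & p.2 <= b].

Definition nonoverlap (p q : R * R) := (p.2 <= q.1) || (q.2 <= p.1).

(** Families are lists here, not functions on ['I_N]: lists can be concatenated and refined by
    induction, as the passage to total variations requires. *)
Definition abs_continuous a b f := forall eps : R, 0 < eps ->
  exists2 delta : R, 0 < delta &
    forall s, all (in_segment a b) s -> pairwise nonoverlap s ->
      \sum_(p <- s) (p.2 - p.1) < delta ->
      \sum_(p <- s) `|f p.2 - f p.1| < eps.

(** Lets a partition from the definition of total variation be fed to the definition of absolute
    continuity. *)
Lemma zip_partition (u v : R) (l : seq R) : itv_partition u v l ->
  [/\ all (in_segment u v) (zip (u :: l) l),
      pairwise nonoverlap (zip (u :: l) l) &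
      \sum_(p <- zip (u :: l) l) (p.2 - p.1) = v - u].
Proof.
elim: l u => [|h l ih] u.
  by move=> /itv_partition_nil ->; rewrite /= big_nil subrr.
move=> /[dup] uv [/= /andP[uh hl] lv].
have hv : itv_partition h v l by split.
have [ih1 ih2 ih3] := ih _ hv.
have hlev := itv_partition_le hv.
split.
- rewrite /= {1}/in_segment /= lexx (ltW uh) hlev /=.
  apply: sub_all ih1 => p /and3P[hp pp pv]; apply/and3P; split => //.
  exact: le_trans (ltW uh) hp.
- rewrite /= ih2 andbT; apply: sub_all ih1 => p /and3P[hp pp pv].
  by rewrite /nonoverlap /= hp.
- by rewrite /= big_cons /= ih3; ring.
Qed.

Lemma nonoverlap_in_segment (p q r : R * R) :
  nonoverlap p q -> in_segment p.1 p.2 r -> nonoverlap r q.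
Proof.
move=> /orP[pq|qp] /and3P[pr rr rp]; apply/orP; [left|right].
- exact: le_trans rp pq.
- exact: le_trans qp pr.
Qed.

Lemma nonoverlapC (p q : R * R) : nonoverlap p q = nonoverlap q p.
Proof. by rewrite /nonoverlap orbC. Qed.

(** Refining each segment by a partition of it changes neither the total length nor the absence of
    overlaps, so the same [delta] bounds the sum of variations over all partitions. The supremum
    makes the bound non-strict. *)
Lemma abs_continuous_total_variation a b f : abs_continuous a b f ->
  forall eps : R, 0 < eps -> exists2 delta : R, 0 < delta &
    forall s, all (in_segment a b) s -> pairwise nonoverlap s ->
      \sum_(p <- s) (p.2 - p.1) < delta ->
      (\sum_(p <- s) total_variation p.1 p.2 f <= eps%:E)%E.
Proof.
move=> acf eps eps0; have [delta delta0 fdelta] := acf _ eps0.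
exists delta => // w.
(* The list s holds segments already refined, counted by increments; w holds those still counted by
   total variation. The induction moves segments from w to s. *)
suff H s : all (in_segment a b) (s ++ w) -> pairwise nonoverlap (s ++ w) ->
    \sum_(p <- s ++ w) (p.2 - p.1) < delta ->
    ((\sum_(p <- s) `|f p.2 - f p.1|)%:E
      + \sum_(p <- w) total_variation p.1 p.2 f <= eps%:E)%E.
  by move=> h1 h2 h3; have := H [::] h1 h2 h3; rewrite big_nil add0e.
elim: w s => [|p w ih] s sab sd ssum.
  by rewrite big_nil adde0 lee_fin ltW// fdelta// -[s]cats0.
have sub : subseq (s ++ w) (s ++ p :: w).
  by rewrite cat_subseq// subseq_cons.
have /and3P[ap pp pb] : in_segment a b p.
  by move: sab; rewrite all_cat /= => /and3P[].
have sabw : all (in_segment a b) (s ++ w).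
  by apply/allP => q /(mem_subseq sub)/(allP sab).
have lsub : \sum_(q <- s ++ w) (q.2 - q.1) < delta.
  apply: le_lt_trans ssum; rewrite !big_cat/= big_cons lerD2l lerDr.
  by rewrite subr_ge0.
have TVw0 : (0 <= \sum_(q <- w) total_variation q.1 q.2 f)%E.
  rewrite big_seq; apply: sume_ge0 => q qw; apply: total_variation_ge0.
  move/allP: sab => /(_ q); rewrite mem_cat inE qw !orbT => /(_ isT).
  by case/and3P.
(* A real number plus this sum is at most [eps] by induction, so the sum is finite and can be moved
   across the inequality. *)
have TVwfin : (\sum_(q <- w) total_variation q.1 q.2 f)%E \is a fin_num.
  have := ih s sabw (subseq_pairwise sub sd) lsub.
  by case: (\sum_(q <- w) _)%E TVw0.
rewrite big_cons addeCA -leeBrDr ?fin_numD//.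
apply: ge_ereal_sup => _ [_ [l pl <-] <-]; rewrite leeBrDr ?fin_numD//.
have [zl1 zl2 zl3] := zip_partition pl.
have sd' := sd; rewrite pairwise_cat /= in sd'.
case/and3P: sd' => spw ss /andP[pw ww].
rewrite addeA -EFinD.
have -> : variation p.1 p.2 f l + \sum_(q <- s) `|f q.2 - f q.1| =
    \sum_(q <- s ++ zip (p.1 :: l) l) `|f q.2 - f q.1|.
  rewrite big_cat /= addrC; congr +%R; rewrite variation_zip//.
  by elim: l {pl zl1 zl2 zl3} p.1 => [|h l ihl] u; rewrite /= ?big_nil// !big_cons ihl.
apply: ih.
- rewrite -catA all_cat; move: sab; rewrite all_cat /= => /and3P[-> _ ww'] /=.
  rewrite all_cat ww' andbT; apply: sub_all zl1 => q /and3P[h1 h2 h3].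
  by apply/and3P; split=> //; [exact: le_trans h1|exact: le_trans pb].
- rewrite -catA !pairwise_cat ss zl2 ww /= andbT.
  rewrite allrel_catr.
  move: spw; rewrite allrel_consr => /andP[sp ->]; rewrite andbT /=.
  apply/andP; split; apply/allrelP => q r.
    move=> /(allP sp) qp /(allP zl1) rp; rewrite nonoverlapC.
    by apply: nonoverlap_in_segment rp; rewrite nonoverlapC.
  by move=> /(allP zl1) qp /(allP pw) pr; exact: nonoverlap_in_segment qp.
- rewrite -catA !big_cat/= zl3.
  by move: ssum; rewrite big_cat /= big_cons.
Qed.

End AbsoluteContinuity.

(** * Radon-Nikodym density of a monotone absolutely continuous function *)

Section AbsolutelyContinuousDensity.
Context {R : realType}.
Implicit Types (a b t x : R) (f g : R -> R) (s w : seq (R * R)).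
Local Notation mu := (@lebesgue_measure R).

(** Composition with [clamp a b] extends a function from [a, b] to the line by constants. Being
    nondecreasing and 1-Lipschitz, it preserves monotonicity and absolute continuity. *)
Definition clamp a b x := Num.max a (Num.min b x).

Lemma clamp_in a b x : a <= b -> a <= clamp a b x <= b.
Proof. by move=> ab; rewrite /clamp le_max lexx /= ge_max ab /= ge_min lexx. Qed.

Lemma clamp_id a b x : a <= x <= b -> clamp a b x = x.
Proof.
by move=> /andP[ax xb]; rewrite /clamp (min_idPr xb) (max_idPr ax).
Qed.

Lemma clamp_nondecreasing a b : {homo clamp a b : x y / x <= y}.
Proof.
move=> x y xy; rewrite /clamp ge_max le_max lexx /= le_max.
by apply/orP; right; rewrite le_min ge_min lexx /= ge_min xy orbT.
Qed.

Lemma clamp_dist a b x y : x <= y -> clamp a b y - clamp a b x <= y - x.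
Proof.
move=> xy; rewrite /clamp /Num.max /Num.min.
by repeat case: ifPn; rewrite -?leNgt; move=> *; lra.
Qed.

Lemma abs_continuous_clamp a b g (eps : R) : a <= b ->
  abs_continuous a b g -> 0 < eps -> exists2 delta : R, 0 < delta &
  forall x y, `|x - y| < delta ->
    `|g (clamp a b x) - g (clamp a b y)| < eps.
Proof.
move=> ab acg eps0; have [delta delta0 dg] := acg _ eps0.
exists delta => // x y.
wlog yx : x y / y <= x => [H|].
  have [yx|xy] := leP y x; first exact: H.
  by rewrite distrC [X in _ -> X < _]distrC; apply: H; exact: ltW.
move=> xyd; have := dg [:: (clamp a b y, clamp a b x)].
rewrite !big_seq1 /= andbT; apply => //.
  rewrite /in_segment /= (clamp_nondecreasing a b yx).
  by case/andP: (clamp_in y ab) => -> _; case/andP: (clamp_in x ab) => _ ->.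
apply: le_lt_trans (clamp_dist a b yx) _.
by apply: le_lt_trans xyd; exact: ler_norm.
Qed.

Lemma abs_continuous_continuous_clamp a b g : a <= b -> abs_continuous a b g ->
  continuous (g \o clamp a b).
Proof.
move=> ab acg x; apply/cvgrPdist_lt => eps eps0.
have [delta delta0 H] := abs_continuous_clamp ab acg eps0.
near=> y; apply: H; near: y.
by apply/nbhs_ballP; exists delta.
Unshelve. all: by end_near. Qed.

Section NondecreasingDensity.
Variables (a b : R) (g : R -> R).
Hypotheses (ab : a < b) (ndg : {in `[a, b] &, nondecreasing_fun g}).
Hypothesis acg : abs_continuous a b g.

Let G := g \o clamp a b.

Let G_nd : nondecreasing G.
Proof.
move=> x y xy; apply: ndg; rewrite ?in_itv /= ?clamp_in ?(ltW ab)//.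
exact: clamp_nondecreasing.
Qed.

Let G_rc : right_continuous G.
Proof.
by apply: right_continuousW; exact: abs_continuous_continuous_clamp (ltW ab) acg.
Qed.

HB.instance Definition _ := isCumulative.Build R _ R G G_nd G_rc.

Let nu : {measure set (measurableTypeR R) -> \bar R} :=
  lebesgue_stieltjes_measure G.

Let nu_oc u v : u <= v -> nu `]u, v]%classic = (G v - G u)%:E.
Proof.
move=> uv; rewrite /nu/= /lebesgue_stieltjes_measure /measure_extension.
by rewrite measurable_mu_extE/= ?wlength_itv_bnd//; exact: is_ocitv.
Qed.

(** An infinite endpoint would give infinite length, and openness removes the endpoints from A. The
    mass of the open interval is at most that of its half-open version, which is an increment of
    [G]. *)
Let nu_interval (A : set R) : open A -> is_interval A ->
  (mu A < +oo)%E -> A !=set0 ->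
  exists p : R * R, [/\ p.1 < p.2, A = `]p.1, p.2[%classic,
    mu A = (p.2 - p.1)%:E &
    (nu A <= (g (clamp a b p.2) - g (clamp a b p.1))%:E)%E].
Proof.
move=> oA iA muA [z Az].
have AE : [set` Rhull A] = A by apply: RhullK; rewrite inE.
move: muA oA Az; rewrite -AE lebesgue_measure_itv.
case: (Rhull A) => [[bl l|[]] [br u|[]]] //=; rewrite ?ltNyr ?ltry ?ltNyy//=;
  try by rewrite in_itv /= ?andbF.
move=> _ /interior_id oA Az; exists (l, u).
have : [set` Interval (BSide bl l) (BSide br u)]%classic z by [].
rewrite -oA interior_itv /= in_itv /= => /andP[lz zu].
have lu : l < u := lt_trans lz zu.
rewrite lte_fin lu; split => //=.
rewrite -[leRHS]/((G u - G l)%:E) -nu_oc ?(ltW lu)//.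
by apply: le_measure; rewrite ?inE//= ?interior_itv; exact: subset_itv_oo_oc.
Qed.

(* An open set is a countable disjoint union of open intervals, and the absolute
   continuity of g applies to each finite subfamily. *)
Let nu_open (eps : R) : 0 < eps -> exists2 delta : R, 0 < delta &
  forall U : set R, open U -> (mu U < delta%:E)%E -> (nu U <= eps%:E)%E.
Proof.
move=> eps0; have [delta delta0 gdelta] := acg eps0.
exists delta => // U oU Udelta.
pose I := open_disjoint_itv oU.
have oI i : open (I i) by exact: open_disjoint_itv_open.
have mI i : measurable (I i) by exact: open_measurable.
have tI : trivIset setT I by exact: open_disjoint_itv_trivIset.
have UI : U = \bigcup_i I i by exact: open_disjoint_itv_bigcup.
have muI i : (mu (I i) < +oo)%E.
  apply: (@le_lt_trans _ _ (mu U)); last exact: lt_trans Udelta (ltry _).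
  apply: le_measure; rewrite ?inE; [exact: mI|exact: open_measurable|].
  by move=> x Ix; rewrite UI; exists i.
have /choice[p pI] : forall i, exists p : R * R, I i !=set0 ->
    [/\ p.1 < p.2, I i = `]p.1, p.2[%classic, mu (I i) = (p.2 - p.1)%:E &
    (nu (I i) <= (g (clamp a b p.2) - g (clamp a b p.1))%:E)%E].
  move=> i; have [->|/set0P I0] := eqVneq (I i) set0.
    by exists (0, 0) => -[].
  have [p pI] := nu_interval (oI i) (@open_disjoint_itv_is_interval _ _ oU i) (muI i) I0.
  by exists p.
rewrite UI measure_semi_bigcup//; last by rewrite -UI; exact: open_measurable.
apply: lime_le; first exact: is_cvg_ereal_nneg_natsum.
apply: nearW => N.
(* Empty intervals are dropped because they have no endpoints. Clamping the endpoints of the others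
   shortens the intervals and creates no overlap. *)
pose s := [seq i <- index_iota 0 N | I i != set0].
pose q i := (clamp a b (p i).1, clamp a b (p i).2).
have sI i : i \in s -> I i !=set0 by rewrite mem_filter => /andP[/set0P].
have nuE (m : {measure set (measurableTypeR R) -> \bar R}) :
    (\sum_(0 <= i < N) m (I i) = \sum_(i <- s) m (I i))%E.
  rewrite big_filter [RHS]big_mkcond; apply: eq_bigr => i _.
  by case: eqVneq => // ->; rewrite measure0.
rewrite nuE.
have len : \sum_(i <- s) ((q i).2 - (q i).1) < delta.
  rewrite -lte_fin; apply: le_lt_trans Udelta.
  apply: (@le_trans _ _ (\sum_(i <- s) mu (I i))%E).
    rewrite -sumEFin !big_seq; apply: lee_sum => i /sI /pI[lu _ -> _].
    by rewrite lee_fin clamp_dist// ltW.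
  rewrite -nuE UI measure_semi_bigcup//; last by rewrite -UI; exact: open_measurable.
  by apply: nneseries_lim_ge => n _ _; exact: measure_ge0.
apply: (@le_trans _ _ (\sum_(i <- s) `|g (q i).2 - g (q i).1|)%:E).
  rewrite -sumEFin !big_seq; apply: lee_sum => i /sI /pI[_ _ _ nuI].
  by rewrite (le_trans nuI)// lee_fin ler_norm.
have := gdelta (map q s); rewrite !big_map => gq; apply/ltW; apply: gq => //.
- rewrite all_map; apply/allP => i /sI /pI[lu _ _ _] /=.
  rewrite /in_segment /= (clamp_nondecreasing a b (ltW lu)).
  by case/andP: (clamp_in (p i).1 (ltW ab)) => -> _;
     case/andP: (clamp_in (p i).2 (ltW ab)) => _ ->.
- rewrite pairwise_map.
  have : pairwise (fun i j => i != j) s.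
    by rewrite -uniq_pairwise; apply: filter_uniq; exact: iota_uniq.
  move=> us; apply: (sub_in_pairwise (P := mem s)) us; last exact/allP.
  move=> i j /sI /pI[lui Ii _ _] /sI /pI[luj Ij _ _] ij; rewrite /= /nonoverlap/=.
  suff /orP[h|h] : ((p i).2 <= (p j).1) || ((p j).2 <= (p i).1).
  + by rewrite (@clamp_nondecreasing a b _ _ h).
  + by rewrite (@clamp_nondecreasing a b _ _ h) orbT.
  rewrite -[_ || _]negbK negb_or -!ltNge; apply/negP => /andP[h1 h2].
  move/trivIsetP : tI => /(_ i j Logic.I Logic.I ij).
  apply/eqP/set0P; rewrite Ii Ij.
  pose l := Num.max (p i).1 (p j).1; pose u := Num.min (p i).2 (p j).2.
  have lu : l < u by rewrite /l /u gt_max !lt_min lui luj h1 h2.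
  have [x /andP[lx xu]] : exists x, l < x < u.
    by exists ((l + u) / 2); rewrite !(midf_lt lu).
  move: lx xu; rewrite /l /u gt_max lt_min => /andP[l1 l2] /andP[u1 u2].
  by exists x; split; rewrite /= in_itv /= ?l1 ?l2 ?u1 ?u2.
Qed.

Let nu_ab : (nu `]a, b]%classic < +oo)%E.
Proof. by rewrite nu_oc ?ltW// ltry. Qed.

Let mab : measurable (`]a, b]%classic : set (measurableTypeR R)).
Proof. exact: measurable_itv. Qed.

(** Radon-Nikodym is applied to a finite measure, hence the restriction to []a, b]], the only place
    where the clamped function grows. *)
Let nuf : {finite_measure set (measurableTypeR R) -> \bar R} :=
  mfrestr mab nu_ab.

(** Outer regularity encloses a null set in open sets of arbitrarily small length, and [nu_open]
    makes their mass small. *)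
Let nuf_dominated : charge_of_finite_measure nuf `<< mu.
Proof.
apply/null_content_dominatesP => A mA A0.
rewrite /charge_of_finite_measure /nuf /mfrestr /mrestr.
apply/eqP; rewrite eq_le measure_ge0 andbT.
apply/lee_addgt0Pr => eps eps0; rewrite add0e.
have [delta delta0 nudelta] := nu_open eps0.
have [|U [oU AU Udelta]] := @lebesgue_regularity_outer R A delta mA _ delta0.
  by rewrite [X in (X < _)%E]A0.
have mU : measurable U by exact: open_measurable.
apply: (@le_trans _ _ (nu U)).
  by apply: le_measure; rewrite ?inE//; [exact: measurableI|move=> x [/AU]].
apply: nudelta => //; apply: le_lt_trans Udelta.
rewrite -[in leLHS](setDUK AU) (le_trans (measureU2 _ _ _))//; first exact: measurableD.
by rewrite [X in (X + _)%E]A0 add0e.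
Qed.

Lemma nondecreasing_abs_continuous_density :
  exists phi : R -> R, mu.-integrable `[a, b] (EFin \o phi) /\
    forall x, x \in `[a, b] -> g x - g a = \int[mu]_(t in `[a, x]) phi t.
Proof.
pose D := Radon_Nikodym (charge_of_finite_measure nuf) mu.
have Dfin x : D x \is a fin_num by exact: Radon_Nikodym_fin_num.
have DE : EFin \o (fine \o D) = D by apply/funext => x /=; rewrite fineK.
have intD : mu.-integrable setT D by exact: Radon_Nikodym_integrable.
exists (fine \o D); split.
  by rewrite DE; apply: integrableS intD.
move=> x; rewrite in_itv /= => /andP[ax xb].
have : nu (`]a, x] `&` `]a, b])%classic = (\int[mu]_(t in `]a, x]) D t)%E.
  exact: (Radon_Nikodym_integral nuf_dominated (measurable_itv `]a, x])).
rewrite setIidl; last by apply: subset_itvl; rewrite bnd_simp.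
rewrite nu_oc// /G /= !clamp_id ?lexx ?ax ?xb ?ltW// => e.
apply: EFin_inj; rewrite e /Rintegral.
have -> : (\int[mu]_(t in `[a, x]) (fine (D t))%:E = \int[mu]_(t in `]a, x]) D t)%E.
  rewrite -[LHS]integral_itv_obnd_cbnd.
    by apply: eq_integral => t _; rewrite fineK.
  rewrite -/(EFin \o (fine \o D)) DE; apply: measurable_funTS.
  exact: measurable_int intD.
rewrite fineK//; apply: integrable_fin_num => //.
exact: integrableS intD.
Qed.

End NondecreasingDensity.
End AbsolutelyContinuousDensity.

(** * Derivatives of indefinite integrals on a closed interval *)

Section PrimitiveDerivative.
Context {R : realType}.
Implicit Types (a b t x : R) (f g phi : R -> R).
Local Notation mu := (@lebesgue_measure R).

(** Relational form of [derive_on]: naming the limit keeps the default value of [lim] out of the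
    calculus. *)
Definition is_deriv_on a b f t (l : R) :=
  diff_quotient f t @ within `[a, b] t^' --> l.

Lemma is_deriv_on_eq a b f g t l : {in `[a, b], f =1 g} -> t \in `[a, b] ->
  is_deriv_on a b f t l -> is_deriv_on a b g t l.
Proof.
move=> fg tab; apply: cvg_trans; apply: near_eq_cvg.
rewrite near_withinE; near=> x => xab; rewrite /diff_quotient !fg//.
Unshelve. all: by end_near. Qed.

(** Caratheodory's factor h is continuous at t and equals the difference quotient elsewhere, so its
    limit can be taken inside [a, b]. *)
Lemma derivable_is_deriv_on a b f t : derivable f t 1 ->
  is_deriv_on a b f t (derive1 f t).
Proof.
move=> df; have /is_derive1_caratheodory[h [fh hc ht]] :
  is_derive t 1 f (derive1 f t) by split => //; rewrite derive1E.
rewrite -ht /is_deriv_on.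
have : h @ within `[a, b] t^' --> h t.
  apply: cvg_trans hc; apply: cvg_app.
  by apply: cvg_trans (@cvg_within _ _ _ _); exact: cvg_within.
apply: cvg_trans; apply: near_eq_cvg; rewrite near_withinE.
near=> x => _; rewrite /diff_quotient fh mulfK// subr_eq0.
by near: x; exact: nbhs_dnbhs_neq.
Unshelve. all: by end_near. Qed.

Lemma Rintegral_segmentB a b phi x y : mu.-integrable `[a, b] (EFin \o phi) ->
  a <= x -> x <= y -> y <= b ->
  \int[mu]_(t in `[a, y]) phi t - \int[mu]_(t in `[a, x]) phi t =
  \int[mu]_(t in `]x, y]) phi t.
Proof.
move=> iphi ax xy yb; apply: Rintegral_itvB; rewrite ?bnd_simp//.
by apply: integrableS iphi => //; apply: subset_itvl; rewrite bnd_simp.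
Qed.

Lemma primitive_is_deriv_on_ae a b phi : mu.-integrable `[a, b] (EFin \o phi) ->
  {ae mu, forall t, t \in `[a, b] ->
    is_deriv_on a b (fun x => \int[mu]_(u in `[a, x]) phi u) t (phi t)}.
Proof.
move=> iphi; pose psi := phi \_ `[a, b].
have ipsi : mu.-integrable setT (EFin \o psi).
  have -> : EFin \o psi = (EFin \o phi) \_ `[a, b] by rewrite /psi restrict_EFin.
  exact: (integrable_mkcond _ _).1.
have := @FTC1Ny _ psi.
have ipsiy y : mu.-integrable `]-oo, y] (EFin \o psi) by exact: integrableS ipsi.
move=> /(_ ipsiy (open_integrable_locally openT ipsi)).
apply: (@filterS _ _ (ae_filter_ringOfSetsType mu)) => t + tab => -[df dfE].
have <- : psi t = phi t by rewrite /psi patchE ifT// inE.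
rewrite -dfE; move: (derivable_is_deriv_on a b df); apply: is_deriv_on_eq => //.
move=> x; rewrite in_itv /= => /andP[ax xb].
rewrite /psi -Rintegral_mkcondr; congr Rintegral.
apply/seteqP; split=> z /=; rewrite !in_itv/=.
  by move=> [zx /andP[->]].
by move=> /andP[-> zx]; rewrite zx (le_trans zx).
Qed.

Lemma clamp_continuous a b : continuous (clamp a b).
Proof.
move=> x; apply: continuous_max; first exact: cst_continuous.
by apply: continuous_min; [exact: cst_continuous|exact: id].
Qed.

Lemma continuous_clamp a b phi : a <= b -> {within `[a, b], continuous phi} ->
  continuous (phi \o clamp a b).
Proof.
move=> ab cphi x.
have cl y : `[a, b]%classic (clamp a b y) by rewrite /= in_itv /= clamp_in.
have h := (@subspace_continuousP _ _ _ _).1 cphi _ (cl x).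
apply: (@cvg_comp _ _ _ (clamp a b) phi _ _ _ _ h) => A.
rewrite /within /= => /(@clamp_continuous a b x); rewrite !nbhs_filterE /fmap /=.
by apply: filterS => y /(_ (cl y)).
Qed.

Lemma primitive_is_deriv_on a b phi t : a < b ->
  {within `[a, b], continuous phi} -> t \in `[a, b] ->
  is_deriv_on a b (fun x => \int[mu]_(u in `[a, x]) phi u) t (phi t).
Proof.
move=> ab cphi tab; pose psi := phi \o clamp a b.
have cpsi : continuous psi by exact: continuous_clamp (ltW ab) cphi.
have ipsi u v : mu.-integrable `[u, v] (EFin \o psi).
  apply: continuous_compact_integrable; first exact: segment_compact.
  exact: continuous_subspaceT.
have /andP[ta tb] : a <= t <= b by move: tab; rewrite in_itv.
(* The interval of integration is widened to [a - 1, t + 1], so that t is interior even when it is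
   an endpoint of [a, b]. *)
have t1 : t < t + 1 by rewrite ltrDl.
have a1 : a - 1 < t by rewrite ltrBlDr (le_lt_trans ta)// ltrDl.
have [df dfE] := continuous_FTC1_closed t1 (ipsi _ _) a1 (cpsi t).
have <- : psi t = phi t by rewrite /psi /= clamp_id ?ta.
rewrite -dfE; set F := (fun x => _) in df dfE *.
have : is_deriv_on a b (fun x => F x - F a) t (derive1 F t).
  move: (derivable_is_deriv_on a b df); rewrite /is_deriv_on.
  by apply: cvg_trans; apply: near_eq_cvg; apply: nearW => x;
    rewrite /diff_quotient opprB addrA subrK.
apply: is_deriv_on_eq => // x; rewrite in_itv /= => /andP[ax xb].
rewrite /F (Rintegral_segmentB (ipsi (a - 1) b))//; last by rewrite gerBl.
rewrite Rintegral_itv_obnd_cbnd; last first.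
  by apply: integrableS (ipsi a x) => //; exact: subset_itv_oc_cc.
apply: eq_Rintegral => z; rewrite inE /= in_itv /= => /andP[az zx].
by rewrite /psi /= clamp_id // az (le_trans zx).
Qed.

(** Absolute continuity of the integral, applied to the union of the segments. These are taken
    half-open on the left, so that segments sharing an endpoint become disjoint sets. *)
Lemma abs_continuous_primitive a b phi : mu.-integrable `[a, b] (EFin \o phi) ->
  abs_continuous a b (fun x => \int[mu]_(u in `[a, x]) phi u).
Proof.
move=> iphi eps eps0; pose psi := phi \_ `[a, b].
have ipsi : mu.-integrable setT (EFin \o psi).
  have -> : EFin \o psi = (EFin \o phi) \_ `[a, b] by rewrite /psi restrict_EFin.
  exact: (integrable_mkcond _ _).1.
have [delta [delta0 psidelta]] := integral_normr_continuous ipsi eps0.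
exists delta => // s sab sd slen.
pose S s := \big[setU/set0]_(p <- s : seq (R * R)) `]p.1, p.2]%classic.
have mS s' : measurable (S s') by apply: bigsetU_measurable.
have inS s' z : S s' z -> exists2 p, p \in s' & p.1 < z <= p.2.
  rewrite /S; elim: s' => [|p s' ih]; first by rewrite big_nil.
  rewrite big_cons => -[|/ih[q qs' zq]]; last first.
    by exists q => //; rewrite inE qs' orbT.
  by rewrite /= in_itv /= => zp; exists p => //; rewrite inE eqxx.
have ipsiA A : measurable A -> mu.-integrable A (EFin \o (fun u => `|psi u|)).
  move=> mA; apply: (@integrableS _ _ _ _ setT) => //.
  exact: (integrable_norm ipsi).
have Slen : (mu (S s) <= (\sum_(p <- s) (p.2 - p.1))%:E)%E.
  rewrite /S; elim: s sab {sd slen} => [_|p s ih /= /andP[/and3P[_ pp _] /ih{}ih]].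
    by rewrite !big_nil measure0.
  have h : (mu `]p.1, p.2]%classic <= (p.2 - p.1)%:E)%E.
    rewrite lebesgue_measure_itv /= lte_fin.
    by case: ifPn => // _; rewrite lee_fin subr_ge0.
  rewrite !big_cons EFinD; apply: le_trans (leeD h ih).
  by apply: measureU2 => //; exact: mS.
have -> : \sum_(p <- s) `|\int[mu]_(u in `[a, p.2]) phi u -
    \int[mu]_(u in `[a, p.1]) phi u| = \sum_(p <- s) `|\int[mu]_(u in `]p.1, p.2]) psi u|.
  rewrite !big_seq; apply: eq_bigr => p /(allP sab)/and3P[ap pp pb].
  rewrite (Rintegral_segmentB iphi)//; congr `|_|; apply: eq_Rintegral => z.
  rewrite inE /= in_itv /= => /andP[pz zp]; rewrite /psi patchE ifT// inE /=.
  by rewrite in_itv /= (le_trans ap (ltW pz)) (le_trans zp).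
apply: (@le_lt_trans _ _ (\int[mu]_(u in S s) `|psi u|)); last first.
  by apply: psidelta; [exact: mS|apply: le_lt_trans Slen _].
move: sd; rewrite /S; elim: s {sab slen Slen} => [_|p s ih /= /andP[ps /ih{}ih]].
  by rewrite !big_nil Rintegral_set0.
rewrite !big_cons Rintegral_setU//.
- by rewrite lerD// le_normr_Rintegral//; exact: integrableS ipsi.
- exact: mS.
- by apply: ipsiA; apply: measurableU => //; exact: mS.
- apply/disj_setPS => z [/= zp /inS[q /(allP ps)]]; rewrite in_itv /= in zp.
  move/andP: zp => [pz zp] + /andP[qz zq] => /orP[|] h.
    by move: (lt_le_trans qz zp); rewrite ltNge h.
  by move: (lt_le_trans pz zq); rewrite ltNge h.
Qed.

End PrimitiveDerivative.

(** * Absolutely continuous functions as integrals of their derivatives *)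

Section AbsolutelyContinuousPrimitive.
Context {R : realType}.
Implicit Types (a b t x : R) (f g phi : R -> R).
Local Notation mu := (@lebesgue_measure R).

(** Cut [a, b] into N equal pieces shorter than the [delta] that belongs to 1; each has variation at
    most 1, so the whole has at most N. *)
Lemma abs_continuous_bounded_variation a b f : a <= b ->
  abs_continuous a b f -> total_variation a b f \is a fin_num.
Proof.
move=> ab acf; have [delta delta0 fdelta] := abs_continuous_total_variation acf ltr01.
pose N := (Num.truncn ((b - a) / delta)).+1.
pose h := (b - a) / N%:R.
have N0 : (0 : R) < N%:R by rewrite ltr0n.
have h0 : 0 <= h by rewrite divr_ge0// subr_ge0.
have hdelta : h < delta.
  by rewrite /h ltr_pdivrMr// mulrC -ltr_pdivrMr// truncnS_gt.
have hb k : (k <= N)%N -> a + h *+ k <= b.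
  move=> kN; rewrite -lerBrDl -mulr_natr /h mulrAC ler_pdivrMr//.
  by rewrite ler_wpM2l ?subr_ge0// ler_nat.
have step k : (k <= N)%N -> (total_variation a (a + h *+ k) f <= (k%:R)%:E)%E.
  elim: k => [_|k ih kN]; first by rewrite mulr0n addr0 total_variationxx.
  have akk : a + h *+ k <= a + h *+ k.+1 by rewrite mulrSr addrA lerDl.
  have ak : a <= a + h *+ k by rewrite lerDl mulrn_wge0.
  rewrite (total_variationD f ak akk) -natr1 EFinD leeD ?ih 1?ltnW//.
  have := fdelta [:: (a + h *+ k, a + h *+ k.+1)].
  rewrite !big_seq1 /=; apply => //.
    by rewrite /in_segment /= ak akk hb.
  by rewrite mulrSr addrA [_ - _]addrC addKr.
have := step N (leqnn N); rewrite -[h *+ N]mulr_natr /h divfK ?gt_eqF// addrC subrK => TVN.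
by rewrite ge0_fin_numE ?total_variation_ge0// (le_lt_trans TVN)// ltry.
Qed.

(** Jordan decomposition f = V - (V - f), with V the variation from a. Over a family of segments the
    increments of V are total variations of f, so [abs_continuous_total_variation] is exactly the
    absolute continuity of V. *)
Lemma abs_continuous_density a b f : a < b -> abs_continuous a b f ->
  exists phi : R -> R, mu.-integrable `[a, b] (EFin \o phi) /\
    forall x, x \in `[a, b] -> f x - f a = \int[mu]_(t in `[a, x]) phi t.
Proof.
move=> ab acf; pose V x := fine (total_variation a x f).
have TVfin x y : a <= x -> x <= y -> y <= b -> total_variation x y f \is a fin_num.
  move=> ax xy yb; have := abs_continuous_bounded_variation (ltW ab) acf.
  by rewrite (total_variationD f ax (le_trans xy yb)) (total_variationD f xy yb)
     !fin_numD => /and3P[].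
have VB x y : a <= x -> x <= y -> y <= b ->
    V y - V x = fine (total_variation x y f).
  move=> ax xy yb; rewrite /V (total_variationD f ax xy) fineD ?TVfin//.
    by rewrite addrC addKr.
  exact: le_trans yb.
have fV x y : a <= x -> x <= y -> y <= b -> `|f y - f x| <= V y - V x.
  move=> ax xy yb; rewrite VB// -lee_fin fineK ?TVfin//.
  exact: total_variation_ge.
have ndV : {in `[a, b] &, nondecreasing_fun V}.
  move=> x y; rewrite !in_itv /= => /andP[ax _] /andP[_ yb] xy.
  by rewrite -subr_ge0 (le_trans _ (fV _ _ ax xy yb)).
have ndVf : {in `[a, b] &, nondecreasing_fun (V \- f)}.
  move=> x y; rewrite !in_itv /= => /andP[ax _] /andP[_ yb] xy /=.
  have := le_trans (ler_norm _) (fV _ _ ax xy yb); lra.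
have acV : abs_continuous a b V.
  move=> eps eps0; have eps2 : 0 < eps / 2 by rewrite divr_gt0.
  have [delta delta0 fdelta] := abs_continuous_total_variation acf eps2.
  exists delta => // s sab sd slen.
  apply: (@le_lt_trans _ _ (eps / 2)); last by rewrite ltr_pdivrMr// ltr_pMr// ltr1n.
  rewrite -lee_fin; apply: le_trans (fdelta s sab sd slen).
  rewrite -sumEFin !big_seq; apply: lee_sum => p /(allP sab)/and3P[ap pp pb].
  rewrite ger0_norm; first by rewrite VB// fineK// TVfin.
  by rewrite (le_trans _ (fV _ _ ap pp pb)).
have acVf : abs_continuous a b (V \- f).
  move=> eps eps0; have eps2 : 0 < eps / 2 by rewrite divr_gt0.
  have [d1 d10 V1] := acV _ eps2; have [d2 d20 f2] := acf _ eps2.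
  exists (Num.min d1 d2); first by rewrite lt_min d10.
  move=> s sab sd; rewrite lt_min => /andP[s1 s2].
  rewrite [eps]splitr; apply: le_lt_trans (ltrD (V1 s sab sd s1) (f2 s sab sd s2)).
  rewrite -big_split /=; apply: ler_sum => p _.
  have -> : (V \- f) p.2 - (V \- f) p.1 = (V p.2 - V p.1) - (f p.2 - f p.1).
    by rewrite /=; ring.
  exact: ler_normB.
have [phi [iphi phiE]] := nondecreasing_abs_continuous_density ab ndV acV.
have [psi [ipsi psiE]] := nondecreasing_abs_continuous_density ab ndVf acVf.
exists (phi \- psi); split; first exact: (integrableB _ iphi ipsi).
move=> x xab; have := phiE x xab; have := psiE x xab => /= e1 e2.
have sub : `[a, x]%classic `<=` `[a, b]%classic.
  by move: xab; rewrite in_itv => /andP[ax xb]; apply: subset_itvl; rewrite bnd_simp.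
rewrite RintegralB//; [|exact: integrableS iphi|exact: integrableS ipsi].
by rewrite -e1 -e2; ring.
Qed.

Lemma abs_continuous_is_deriv_on a b f : a < b -> abs_continuous a b f ->
  exists phi : R -> R, [/\ mu.-integrable `[a, b] (EFin \o phi),
    forall x, x \in `[a, b] -> f x - f a = \int[mu]_(t in `[a, x]) phi t &
    {ae mu, forall t, t \in `[a, b] -> is_deriv_on a b f t (phi t)}].
Proof.
move=> ab /(abs_continuous_density ab)[phi [iphi phiE]]; exists phi; split => //.
apply: (@filterS _ _ (ae_filter_ringOfSetsType mu)) (primitive_is_deriv_on_ae iphi).
move=> t + tab => /(_ tab) h.
have : is_deriv_on a b (fun x => f x - f a) t (phi t).
  by apply: is_deriv_on_eq h => // x /phiE.
rewrite /is_deriv_on.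
by apply: cvg_trans; apply: near_eq_cvg; apply: nearW => x;
    rewrite /diff_quotient opprB addrA subrK.
Qed.

End AbsolutelyContinuousPrimitive.

(** * The dual of real Lp over a finite measure *)

Section ExtendedHoelder.
Context d (T : measurableType d) (R : realType).
Variable mu : {measure set T -> \bar R}.
Implicit Types (f g : T -> R) (p : \bar R).

Lemma hoelder_conjugate_EFin (p : R) : 1 < p ->
  hoelder_conjugate p%:E = (p / (p - 1))%:E.
Proof.
move=> p1; have p0 : 0 < p by exact: lt_trans p1.
have pB : p - 1 != 0 by rewrite subr_eq0 gt_eqF.
apply/esym/hoelder_conjugateP; rewrite ?ltNyr// ?eqe ?gt_eqF//.
rewrite !inver !gt_eqF//; last by rewrite divr_gt0// subr_gt0.
by rewrite -EFinD invf_div -[X in X + _]mul1r -mulrDl addrC subrK divff// gt_eqF.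
Qed.

Lemma Lnorm_y_ae f : (0 < mu setT)%E ->
  {ae mu, forall x, (`|f x|%:E <= Lnorm mu +oo (EFin \o f))%E}.
Proof. by move=> mu0; rewrite unlock mu0; exact: ess_sup_ge. Qed.

Lemma hoelder1y f g : measurable_fun setT f -> measurable_fun setT g ->
  (Lnorm mu 1 (EFin \o (f \* g)%R) <=
   Lnorm mu 1 (EFin \o f) * Lnorm mu +oo (EFin \o g))%E.
Proof.
move=> mf mg; rewrite !Lnorm1.
(* The pointwise bound by the norm at +oo is stated for a space of positive measure; on a null space
   the left side is 0. *)
have [mu0|] := eqVneq (mu setT) 0%E.
  rewrite integral_abs_eq0//; first by rewrite mule_ge0 ?integral_ge0 ?Lnorm_ge0.
  by apply/measurable_EFinP; exact: measurable_funM.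
rewrite -measure_gt0 => mu0.
rewrite -ge0_integralZr//; last exact: Lnorm_ge0.
  apply: ae_ge0_le_integral => //.
  - by apply: measurableT_comp => //; apply/measurable_EFinP; exact: measurable_funM.
  - by move=> x _; rewrite mule_ge0// Lnorm_ge0.
  - by apply: emeasurable_funM => //; apply: measurableT_comp => //; exact/measurable_EFinP.
  - apply: (@filterS _ _ (ae_filter_ringOfSetsType mu)) (Lnorm_y_ae g mu0) => x gx _.
    by rewrite /= normrM EFinM lee_wpmul2l.
by apply: measurableT_comp => //; exact/measurable_EFinP.
Qed.

Lemma ehoelder f g p : (1 <= p)%E ->
  measurable_fun setT f -> measurable_fun setT g ->
  (Lnorm mu 1 (EFin \o (f \* g)%R) <=
   Lnorm mu p (EFin \o f) * Lnorm mu (hoelder_conjugate p) (EFin \o g))%E.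
Proof.
move=> p1 mf mg; case: p p1 => [p||//] p1; last first.
  rewrite hoelder_conjugatey muleC.
  have -> : f \* g = g \* f by apply/funext => x /=; rewrite mulrC.
  exact: hoelder1y.
move: p1; rewrite lee_fin le_eqVlt => /predU1P[<-|p1].
  by rewrite hoelder_conjugate1; exact: hoelder1y.
rewrite hoelder_conjugate_EFin//; apply: hoelder => //.
- exact: lt_trans p1.
- by rewrite divr_gt0 ?subr_gt0// (lt_trans _ p1).
- rewrite invf_div -[X in X + _]mul1r -mulrDl addrC subrK divff// gt_eqF//.
  exact: lt_trans p1.
Qed.

Lemma Lfun_conjugate_integrable f g p : (1 <= p)%E -> f \in Lfun mu p ->
  g \in Lfun mu (hoelder_conjugate p) ->
  mu.-integrable setT (EFin \o (f \* g)%R).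
Proof.
move=> p1 /andP[]; rewrite !inE /= => mf Nf /andP[]; rewrite !inE /= => mg Ng.
apply/Lfun1_integrable; rewrite inE; apply/andP; split; rewrite inE /=.
  exact: measurable_funM.
rewrite /finite_norm (le_lt_trans (ehoelder p1 mf mg))//.
by rewrite lte_mul_pinfty ?Lnorm_ge0// ge0_fin_numE ?Lnorm_ge0.
Qed.

End ExtendedHoelder.

(** * Riesz representation for functions supported in a set of finite measure *)

Section DualOfLp.
Context d (T : measurableType d) (R : realType).
Variables (mu : {sigma_finite_measure set T -> \bar R}) (D : set T) (p : R).
Hypotheses (mD : measurable D) (muD : (mu D < +oo)%E) (p1 : 1 <= p).
Implicit Types (f g phi : T -> R).

Let p0 : 0 < p. Proof. exact: lt_le_trans p1. Qed.

(** Models L_p(D) by functions on the whole space vanishing off D, so that norms and integrals carry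
    no domain. *)
Definition Lp_supported f := f \in Lfun mu p%:E /\ forall x, ~ D x -> f x = 0.

Local Notation S := Lp_supported.

Let p1E : (1 <= p%:E)%E. Proof. by rewrite lee_fin. Qed.

Lemma Lp_supported_lin c f g : S f -> S g -> S (fun x => c * f x + g x).
Proof.
move=> [Lf f0] [Lg g0]; split.
  exact: (Lfun_submod_closed mu p1E).2 c f g Lf Lg.
by move=> x Dx; rewrite f0// g0// mulr0 addr0.
Qed.

Lemma Lp_supported0 : S (cst 0).
Proof. by split => //; exact: (Lfun_submod_closed mu p1E).1. Qed.

Lemma Lp_supported_measurable f : S f -> measurable_fun setT f.
Proof. by move=> [/andP[]]; rewrite inE. Qed.

Lemma Lp_supported_integrable f :
  S f -> mu.-integrable setT (fun x => (`|f x| `^ p)%:E).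
Proof. by move=> [Lf _]; exact: Lfun_integrable. Qed.

Lemma integrable_Lp_supported f : measurable_fun setT f ->
  (forall x, ~ D x -> f x = 0) ->
  mu.-integrable setT (fun x => (`|f x| `^ p)%:E) -> S f.
Proof.
move=> mf f0 /integrableP[_ fp]; split => //.
rewrite inE; apply/andP; split; rewrite inE//= /finite_norm.
rewrite unlock; apply: poweR_lty; apply: le_lt_trans fp.
by under [leRHS]eq_integral => x _ do rewrite gee0_abs ?lee_fin ?powR_ge0//.
Qed.

Lemma measurable_norm_powR f : measurable_fun setT f ->
  measurable_fun setT (fun x => (`|f x| `^ p)%:E).
Proof.
move=> mf; apply: measurableT_comp => //.
apply: (measurableT_comp (measurable_powR _)) => //.
exact: measurableT_comp.
Qed.

Lemma Lp_supported_le f g : measurable_fun setT f -> S g ->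
  (forall x, `|f x| <= `|g x|) -> S f.
Proof.
move=> mf Sg fg; apply: integrable_Lp_supported => //.
  by move=> x Dx; apply/eqP; rewrite -normr_le0 (le_trans (fg x))// Sg.2// normr0.
apply: le_integrable (Lp_supported_integrable Sg) => //.
  exact: measurable_norm_powR.
move=> x _ /=; rewrite lee_fin !(@ger0_norm _ (_ `^ _)) ?powR_ge0//.
by rewrite ge0_ler_powR ?nnegrE ?(ltW p0).
Qed.

Lemma integrable_cst_indic (c : R) :
  mu.-integrable setT (fun x => (c * \1_D x)%:E).
Proof.
under eq_fun do rewrite EFinM; apply: integrableZl => //.
apply/integrableP; split; first exact/measurable_EFinP.
rewrite (_ : integral _ _ _ = mu D)//.
under eq_integral => x _ do rewrite gee0_abs ?lee_fin//.
by rewrite integral_indic// setIT.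
Qed.

Lemma bounded_Lp_supported f (c : R) : measurable_fun setT f ->
  (forall x, ~ D x -> f x = 0) -> (forall x, `|f x| <= c) -> S f.
Proof.
move=> mf f0 fc; apply: integrable_Lp_supported => //.
apply: le_integrable (integrable_cst_indic (c `^ p)) => //.
  exact: measurable_norm_powR.
move=> x _ /=; rewrite lee_fin !(@ger0_norm _ (_ `^ _)) ?powR_ge0// normrM.
have [Dx|Dx] := pselect (D x).
  rewrite indicE mem_set// normr1 mulr1 (@ger0_norm _ (_ `^ _)) ?powR_ge0//.
  rewrite ge0_ler_powR ?nnegrE// ?(ltW p0)//.
  exact: le_trans (fc x).
by rewrite f0// normr0 powR0 ?gt_eqF// mulr_ge0.
Qed.

Lemma indic_Lp_supported (A : set T) : measurable A -> S (\1_(A `&` D)).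
Proof.
move=> mA; apply: (@bounded_Lp_supported _ 1).
- by apply: measurable_indic; exact: measurableI.
- by move=> x Dx; rewrite indicE memNset// => -[].
- by move=> x; rewrite indicE; case: (_ \in _); rewrite ?normr1 ?normr0.
Qed.

Variables (l : (T -> R) -> R) (M : R).
Hypothesis llin : forall c f g, S f -> S g ->
  l (fun x => c * f x + g x) = c * l f + l g.
Hypothesis M0 : 0 <= M.
(** Boundedness with constant M, raised to the power p so that it compares with the integral
    directly, without p-th roots. *)
Hypothesis lM : forall f, S f ->
  `|l f| `^ p <= M `^ p * \int[mu]_x (`|f x| `^ p).

Lemma Lp_functionalB f g : S f -> S g -> l (fun x => f x - g x) = l f - l g.
Proof.
move=> Sf Sg; have := llin (-1) Sg Sf; rewrite mulN1r addrC => <-.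
by congr l; apply/funext => x; rewrite mulN1r addrC.
Qed.

Lemma Lp_functional0 : l (cst 0) = 0.
Proof.
have := Lp_functionalB Lp_supported0 Lp_supported0.
rewrite subrr => e; rewrite -[RHS]e; congr l.
by apply/funext => x; rewrite subr0.
Qed.

Lemma Lp_functional_sum (I : Type) (s : seq I) (F : I -> T -> R) (c : I -> R) :
  (forall i, S (F i)) ->
  S (fun x => \sum_(i <- s) c i * F i x) /\
  l (fun x => \sum_(i <- s) c i * F i x) = \sum_(i <- s) c i * l (F i).
Proof.
move=> SF; elim: s => [|i s [ihS ihl]].
  rewrite big_nil -{3}Lp_functional0.
  have -> : (fun x => \sum_(i <- [::]) c i * F i x) = cst 0.
    by apply/funext => x; rewrite big_nil.
  by split => //; exact: Lp_supported0.
have -> : (fun x => \sum_(j <- i :: s) c j * F j x) =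
    (fun x => c i * F i x + (fun x => \sum_(j <- s) c j * F j x) x).
  by apply/funext => x; rewrite big_cons.
split; first exact: Lp_supported_lin.
by rewrite llin// big_cons ihl.
Qed.

Lemma cvg_norm_powR0 (u : R^nat) :
  u @ \oo --> 0 -> `|u n| `^ p @[n --> \oo] --> 0.
Proof.
move=> /cvgrPdist_lt u0; apply/cvgrPdist_lt => e e0.
have e1 : 0 < e `^ p^-1 by rewrite powR_gt0.
have := u0 _ e1; apply: filterS => n; rewrite !sub0r !normrN => un.
rewrite ger0_norm ?powR_ge0//.
have -> : e = (e `^ p^-1) `^ p by rewrite -powRrM mulVf ?gt_eqF// powRr1// ltW.
by rewrite gt0_ltr_powR ?nnegrE// ltW.
Qed.

(** The p-th powers of [f_ n - f] are dominated by (2|g|)^p, so they converge to 0 in mean, and [lM]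
    transfers this to l. This gives both countable additivity and the passage from simple functions
    to general ones. *)
Lemma Lp_functional_dominated_cvg (f_ : (T -> R)^nat) f g :
  (forall n, measurable_fun setT (f_ n)) -> measurable_fun setT f -> S g ->
  (forall n x, `|f_ n x| <= `|g x|) -> (forall x, f_ ^~ x @ \oo --> f x) ->
  l (f_ n) @[n --> \oo] --> l f.
Proof.
move=> mf_ mf Sg fg f_f.
have fg' x : `|f x| <= `|g x|.
  have h : (fun n => `|f_ n x|) @ \oo --> `|f x| by exact: cvg_norm (f_f x).
  by apply: (cvgr_to_le h); apply: nearW => n; exact: fg.
have Sf_ n : S (f_ n) by exact: Lp_supported_le (fg n).
have Sf : S f by exact: Lp_supported_le fg'.
have S2g : S (fun x => 1 * `|g x| + `|g x|).
  have Sng : S (fun x => `|g x|).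
    apply: (Lp_supported_le _ Sg); last by move=> x; rewrite normr_id.
    by apply: measurableT_comp => //; exact: Lp_supported_measurable.
  exact: Lp_supported_lin.
have le2g n x : `|f_ n x - f x| <= `|1 * `|g x| + `|g x| |.
  rewrite mul1r [leRHS]ger0_norm ?addr_ge0//.
  by rewrite (le_trans (ler_normB _ _))// lerD.
have Sfn n : S (fun x => f_ n x - f x).
  by apply: (Lp_supported_le _ S2g) => //; exact: measurable_funB.
have [_ _ /=] : [/\ mu.-integrable setT (cst 0%:E),
    [sequence (\int[mu]_x `|(`|f_ n x - f x| `^ p)%:E - 0%:E|)%E]_n @ \oo --> 0%E &
    [sequence (\int[mu]_x (`|f_ n x - f x| `^ p)%:E)%E]_n @ \oo -->
     (\int[mu]_x 0%:E)%E].
  apply: (@dominated_convergence _ _ _ mu setT measurableT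
    (fun n x => (`|f_ n x - f x| `^ p)%:E) (cst 0%:E)
    (fun x => (`|1 * `|g x| + `|g x| | `^ p)%:E)).
  - by move=> n; apply: measurable_norm_powR; exact: measurable_funB.
  - exact: measurable_cst.
  - apply: aeW => x _; apply: cvg_EFin; first by apply: nearW.
    have : (fun n => f_ n x - f x) @ \oo --> 0.
      by rewrite -(subrr (f x)); apply: cvgB => //; exact: cvg_cst.
    exact: cvg_norm_powR0.
  - exact: Lp_supported_integrable.
  - apply: aeW => x n _; rewrite gee0_abs ?lee_fin ?powR_ge0//.
    by rewrite ge0_ler_powR ?nnegrE// ltW.
rewrite integral0 => /fine_cvgP[_ cvg0].
apply/cvgrPdist_lt => e e0.
(* Adding 1 keeps the denominator positive when M = 0. *)
have ep : 0 < e `^ p / (M `^ p + 1) by rewrite divr_gt0 ?powR_gt0// ltr_wpDl ?powR_ge0.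
move/cvgrPdist_lt: cvg0 => /(_ _ ep); apply: filterS => n; rewrite sub0r normrN /=.
move=> lt1; have := lM (Sfn n); rewrite Lp_functionalB// distrC => le1.
have I0 : 0 <= \int[mu]_x `|f_ n x - f x| `^ p.
  by apply: Rintegral_ge0 => x _; exact: powR_ge0.
have : `|l f - l (f_ n)| `^ p < e `^ p.
  apply: (le_lt_trans le1); rewrite ger0_norm in lt1; last exact: I0.
  rewrite ltr_pdivlMr ?ltr_wpDl ?powR_ge0// in lt1; apply: le_lt_trans lt1.
  by rewrite mulrC ler_wpM2l// lerDl.
rewrite !ltNge; apply: contra => le2.
by rewrite ge0_ler_powR ?nnegrE ?(ltW p0)//; exact: ltW.
Qed.

Let nu (E : set T) : \bar R := (l (\1_(E `&` D)))%:E.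

Let nu0 : nu set0 = 0%E.
Proof.
rewrite /nu set0I indic0; congr EFin; exact: Lp_functional0.
Qed.

Let nu_fin E : measurable E -> nu E \is a fin_num.
Proof. by []. Qed.

(** The partial sums are l applied to the indicators of finite unions within D; these converge to
    the indicator of the full union and are dominated by that of D. *)
Let nu_sigma_additive : semi_sigma_additive nu.
Proof.
move=> F mF tF mUF.
have SF i : S (\1_(F i `&` D)) by exact: indic_Lp_supported.
pose f n : T -> R := fun x => \sum_(0 <= i < n) 1 * \1_(F i `&` D) x.
have -> : (fun n => \sum_(0 <= i < n) nu (F i))%E = fun n => (l (f n))%:E.
  apply/funext => n; rewrite /nu sumEFin; congr EFin.
  rewrite (Lp_functional_sum _ (fun=> 1) SF).2.
  by apply: eq_bigr => i _; rewrite mul1r.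
(* By disjointness only the k-th term is nonzero at a point of [F k], and it is present once k <
   n. *)
have fE x k : D x -> F k x -> forall n, f n x = (k < n)%:R.
  move=> Dx Fkx n; rewrite /f (eq_bigr (fun i => (i == k)%:R)); last first.
    move=> i _; rewrite mul1r; have [->|ik] := eqVneq i k.
      by rewrite indicE mem_set.
    rewrite indicE memNset// => -[Fix _].
    move/trivIsetP: tF => /(_ i k Logic.I Logic.I ik).
    by apply/eqP/set0P; exists x.
  elim: n => [|n ih]; first by rewrite big_nil.
  by rewrite big_nat_recr//= ih ltnS -natrD; case: ltngtP.
have f0 x : (D x -> forall k, ~ F k x) -> forall n, f n x = 0.
  move=> H n; rewrite /f big1// => i _.
  by rewrite indicE memNset ?mulr0// => -[Fix /H/(_ i)].
apply: cvg_EFin; first exact: nearW.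
apply: (Lp_functional_dominated_cvg (g := \1_(setT `&` D))).
- move=> n; apply: measurable_sum => i; apply: measurable_funM => //.
  by apply: measurable_indic; exact: measurableI.
- by apply: measurable_indic; exact: measurableI.
- exact: indic_Lp_supported.
- move=> n x; have [[Dx [k Fkx]]|H] := pselect (D x /\ exists k, F k x).
    rewrite (fE x k)// setTI indicE mem_set// normr1.
    by case: (_ < _)%N; rewrite ?normr1 ?normr0.
  by rewrite f0 ?normr0// => Dx k Fkx; apply: H; split => //; exists k.
- move=> x; have [[Dx [k Fkx]]|H] := pselect (D x /\ exists k, F k x).
    have -> : \1_(\bigcup_n F n `&` D) x = 1 :> R.
      by rewrite indicE mem_set//; split => //; exists k.
    apply: cvg_near_cst; near=> n; rewrite (fE x k)//.
    have -> // : (k < n)%N.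
    by near: n; exact: nbhs_infty_gt.
  have -> : \1_(\bigcup_n F n `&` D) x = 0 :> R.
    by rewrite indicE memNset// => -[[k _ Fkx] Dx]; apply: H; split => //; exists k.
  apply: cvg_near_cst; apply: nearW => n; rewrite f0// => Dx k Fkx.
  by apply: H; split => //; exists k.
Unshelve. all: by end_near. Qed.

HB.instance Definition _ := isCharge.Build _ T R nu nu0 nu_fin nu_sigma_additive.

Let nu_dominated : nu `<< mu.
Proof.
apply/null_content_dominatesP => A mA A0; rewrite /nu; congr EFin.
have lA := lM (indic_Lp_supported mA).
suff e : \int[mu]_x (`|\1_(A `&` D) x| `^ p) = 0 :> R.
  move: lA; rewrite e mulr0 => lA; apply/eqP; rewrite -normr_eq0.
  have /powR_eq0_eq0 -> // : `|l \1_(A `&` D)| `^ p = 0.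
  by apply/eqP; rewrite eq_le lA powR_ge0.
rewrite /Rintegral (_ : integral _ _ _ = 0%E)//.
transitivity (\int[mu]_x (\1_(A `&` D) x)%:E)%E.
  apply: eq_integral => x _; congr EFin; rewrite indicE.
  by case: (_ \in _); rewrite ?normr1 ?powR1 ?normr0 ?powR0 ?gt_eqF.
rewrite integral_indic ?setIT//; last exact: measurableI.
by apply: subset_measure0 A0 => //; exact: measurableI.
Qed.

Let phi : T -> R := (fine \o Radon_Nikodym nu mu) \_ D.

Let RNE : EFin \o (fine \o Radon_Nikodym nu mu) = Radon_Nikodym nu mu.
Proof. by apply/funext => x /=; rewrite fineK// Radon_Nikodym_fin_num. Qed.

Let phi_supp x : ~ D x -> phi x = 0.
Proof. by move=> Dx; rewrite /phi patchE memNset. Qed.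

Let phi_int : mu.-integrable setT (EFin \o phi).
Proof.
rewrite /phi -restrict_EFin RNE; apply/(integrable_mkcond _ mD).
exact: (integrableS measurableT mD (@subsetT _ D)
  (Radon_Nikodym_integrable nu_dominated)).
Qed.

Let phi_meas : measurable_fun setT phi.
Proof. by apply/measurable_EFinP; exact: measurable_int phi_int. Qed.

(** Until phi is known to lie in L_p', integrability of products is available for bounded factors;
    the test functions below are chosen bounded for this reason. *)
Let phi_bounded_int f (c : R) : measurable_fun setT f ->
  (forall x, `|f x| <= c) -> mu.-integrable setT (fun x => (phi x * f x)%:E).
Proof.
move=> mf fc; under eq_fun do rewrite EFinM.
apply: (@integrableMl _ _ _ _ _ measurableT _ f) => //.
exists c; split; first exact: num_real.
by move=> z cz x _ /=; rewrite (le_trans (fc x))// ltW.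
Qed.

Let repr_indic E : measurable E ->
  l (\1_(E `&` D)) = \int[mu]_x (phi x * \1_(E `&` D) x).
Proof.
move=> mE; apply: EFin_inj.
have mED : measurable (E `&` D) by exact: measurableI.
have -> : (l (\1_(E `&` D)))%:E = nu (E `&` D) by rewrite /nu -setIA setIid.
rewrite (Radon_Nikodym_integral nu_dominated mED) /Rintegral fineK; last first.
  apply: integrable_fin_num => //; apply: (@phi_bounded_int _ 1).
    exact: measurable_indic.
  by move=> x; rewrite indicE; case: (_ \in _); rewrite ?normr1 ?normr0.
rewrite [LHS]integral_mkcond; apply: eq_integral => x _; rewrite patchE indicE /phi patchE.
case: ifPn => [|xED]; last by rewrite mulr0.
rewrite inE => -[Ex Dx]; rewrite (mem_set Dx) mulr1 /= fineK//.
exact: Radon_Nikodym_fin_num.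
Qed.

Let repr_nnsfun (g : {nnsfun T >-> R}) : (forall x, ~ D x -> g x = 0) ->
  l g = \int[mu]_x (phi x * g x).
Proof.
move=> g0; pose s : seq R := finmap.enum_fset (fset_set (range g)).
have gE : (g : T -> R) = (fun x => \sum_(y <- s) y * \1_(g @^-1` [set y] `&` D) x).
  apply/funext => x; rewrite [LHS]fimfunE fsbig_finite//=.
  rewrite -/s; apply: eq_bigr => y _.
  have [Dx|Dx] := pselect (D x).
    by congr (_ * _); rewrite !indicE in_setI (mem_set Dx) andbT.
  rewrite [in RHS]indicE (memNset (A := _ `&` D)); last by case.
  rewrite indicE; have [gxy|gxy] := pselect (g x = y).
    by rewrite -gxy g0// !mul0r.
  by rewrite memNset.
have mg y : measurable (g @^-1` [set y]) by exact: measurable_sfunP.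
have SE y : S (\1_(g @^-1` [set y] `&` D)) by exact: indic_Lp_supported.
have iE y : mu.-integrable setT
    (fun x => (phi x * \1_(g @^-1` [set y] `&` D) x)%:E).
  apply: (@phi_bounded_int _ 1).
    by apply: measurable_indic; exact: measurableI.
  by move=> x; rewrite indicE; case: (_ \in _); rewrite ?normr1 ?normr0.
transitivity (\sum_(y <- s) y * \int[mu]_x (phi x * \1_(g @^-1` [set y] `&` D) x)).
  rewrite {1}gE (Lp_functional_sum _ id SE).2.
  by apply: eq_bigr => y _; rewrite repr_indic.
transitivity (\int[mu]_x (phi x * \sum_(y <- s) y * \1_(g @^-1` [set y] `&` D) x)); last first.
  by apply: eq_Rintegral => x _; rewrite {2}gE.
elim: s {gE} => [|y s ih].
  rewrite big_nil; under eq_Rintegral do rewrite big_nil mulr0.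
  by rewrite Rintegral_cst// mul0r.
pose h x := y * (phi x * \1_(g @^-1` [set y] `&` D) x).
pose k x := phi x * \sum_(z <- s) z * \1_(g @^-1` [set z] `&` D) x.
transitivity (\int[mu]_x (h x + k x)); last first.
  by apply: eq_Rintegral => x _; rewrite /h /k big_cons mulrDr [in RHS]mulrCA.
rewrite big_cons ih.
have ih' : mu.-integrable setT (EFin \o h).
  by rewrite /h /comp; under eq_fun do rewrite EFinM; exact: integrableZl.
suff ik : mu.-integrable setT (EFin \o k).
  by rewrite RintegralD//; congr +%R; rewrite /h [RHS](RintegralZl _ measurableT (iE y)).
rewrite /k; elim: s {ih k} => [|z s ih].
  rewrite /comp; under eq_fun do rewrite big_nil mulr0; exact: integrable0.
have -> : (EFin \o (fun x => phi x * \sum_(j <- z :: s) j * \1_(g @^-1` [set j] `&` D) x)) =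
  (fun x => z%:E * (phi x * \1_(g @^-1` [set z] `&` D) x)%:E +
    (phi x * \sum_(j <- s) j * \1_(g @^-1` [set j] `&` D) x)%:E)%E.
  by apply/funext => x; rewrite /= big_cons mulrDr mulrCA EFinD EFinM.
by apply: integrableD => //; exact: integrableZl.
Qed.

(** Both sides are limits along simple approximations from below: the left by
    [Lp_functional_dominated_cvg], the right by dominated convergence with the assumed integrable
    product as majorant. *)
Let repr_ge0 f : S f -> (forall x, 0 <= f x) ->
  mu.-integrable setT (fun x => (phi x * f x)%:E) ->
  l f = \int[mu]_x (phi x * f x).
Proof.
move=> Sf f0 iphif; have mf := Lp_supported_measurable Sf.
have mfE : measurable_fun setT (EFin \o f) by exact/measurable_EFinP.
pose g := nnsfun_approx measurableT mfE.
have f0E x : setT x -> (0 <= (EFin \o f) x)%E by rewrite /= lee_fin.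
have gf n x : g n x <= f x.
  by rewrite -lee_fin /g nnsfun_approxE; exact: (le_approx n f0E).
have gcvg x : g ^~ x @ \oo --> f x.
  by have /fine_cvgP[_] := cvg_nnsfun_approx measurableT mfE f0E (x := x) Logic.I.
have g0 n x : ~ D x -> g n x = 0.
  by move=> Dx; apply/eqP; rewrite eq_le fun_ge0 andbT -(Sf.2 _ Dx) gf.
have c1 : l (g n) @[n --> \oo] --> l f.
  apply: (Lp_functional_dominated_cvg (g := f)) => //.
  by move=> n x; rewrite !ger0_norm.
have c2 : \int[mu]_x (phi x * g n x) @[n --> \oo] --> \int[mu]_x (phi x * f x).
  have mphif h : measurable_fun setT h ->
      measurable_fun setT (fun x => (phi x * h x)%:E).
    by move=> mh; apply/measurable_EFinP; exact: measurable_funM.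
  have ccvg x : (fun n => (phi x * g n x)%:E) @ \oo --> (phi x * f x)%:E.
    apply: cvg_EFin; first exact: nearW.
    by apply: cvgM (gcvg x); exact: cvg_cst.
  have dom x n : (`|(phi x * g n x)%:E| <= `|(phi x * f x)%:E|)%E.
    by rewrite lee_fin !normrM ler_wpM2l// !ger0_norm.
  have mg n : measurable_fun setT (g n) by [].
  have [_ _] := dominated_convergence measurableT
    (fun n => mphif _ (mg n)) (mphif _ mf)
    (aeW _ (fun x _ => ccvg x)) (integrable_abse iphif)
    (aeW _ (fun x n _ => dom x n)).
  rewrite -(fineK (integrable_fin_num measurableT iphif)) => /fine_cvgP[_].
  exact.
have e : (fun n => \int[mu]_x (phi x * g n x)) = (fun n => l (g n)).
  by apply/funext => n; rewrite repr_nnsfun// => x; exact: g0.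
by rewrite e in c2; exact: cvg_unique c1 c2.
Qed.

Let repr f : S f -> mu.-integrable setT (fun x => (phi x * f x)%:E) ->
  l f = \int[mu]_x (phi x * f x).
Proof.
move=> Sf iphif; have mf := Lp_supported_measurable Sf.
pose fp x : R := Num.max (f x) 0; pose fn x : R := Num.max (- f x) 0.
have fE x : f x = fp x - fn x.
  by rewrite /fp /fn /Num.max; case: ifPn; case: ifPn; rewrite -?leNgt; lra.
have fp0 x : 0 <= fp x by rewrite /fp le_max lexx orbT.
have fn0 x : 0 <= fn x by rewrite /fn le_max lexx orbT.
have fpf x : `|fp x| <= `|f x|.
  by rewrite ger0_norm// /fp ge_max ler_norm normr_ge0.
have fnf x : `|fn x| <= `|f x|.
  by rewrite ger0_norm// /fn ge_max -normrN ler_norm normr_ge0.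
have mfp : measurable_fun setT fp by exact: measurable_maxr.
have mfn : measurable_fun setT fn.
  by apply: measurable_maxr => //; exact: measurableT_comp.
have Sfp : S fp by exact: Lp_supported_le fpf.
have Sfn : S fn by exact: Lp_supported_le fnf.
have iphi (h : T -> R) : measurable_fun setT h -> (forall x, `|h x| <= `|f x|) ->
    mu.-integrable setT (fun x => (phi x * h x)%:E).
  move=> mh hf; apply: le_integrable iphif => //.
    by apply/measurable_EFinP; exact: measurable_funM.
  by move=> x _; rewrite /= lee_fin !normrM ler_wpM2l.
have -> : f = (fun x => fp x - fn x) by apply/funext => x; rewrite fE.
rewrite Lp_functionalB// !repr_ge0//; [|exact: iphi..].
under [RHS]eq_Rintegral => x _ do rewrite mulrBr.
rewrite RintegralB//; first exact: iphi.
exact: iphi.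
Qed.

Let phi_powR_meas (e : R) A : measurable A ->
  measurable_fun setT (fun x => phi x * `|phi x| `^ e * \1_A x).
Proof.
move=> mA; apply: measurable_funM; last exact: measurable_indic.
apply: measurable_funM => //.
apply: (measurableT_comp (measurable_powR _)) => //.
exact: measurableT_comp.
Qed.

Let phi_le_meas (c : R) : measurable [set x | `|phi x| <= c].
Proof.
have mphi : measurable_fun setT (fun x => `|phi x|) by exact: measurableT_comp.
rewrite -[X in measurable X]setTI.
have -> : [set x | `|phi x| <= c] = (fun x => `|phi x|) @^-1` `]-oo, c].
  by apply/seteqP; split => x /=; rewrite in_itv.
exact: mphi.
Qed.

(* Test l on the sign of phi, restricted to the set where |phi| > M. *)
Let phi_Ly : p = 1 -> {ae mu, forall x, `|phi x| <= M}.
Proof.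
move=> pe1; pose E := ~` [set x | `|phi x| <= M].
have mE : measurable E by apply: measurableC.
have Ephi x : E x -> M < `|phi x| by rewrite /E /= => /negP; rewrite -ltNge.
pose f x := phi x * `|phi x| `^ (-1) * \1_E x.
have mf : measurable_fun setT f by exact: phi_powR_meas.
have phiV x : E x -> `|phi x| != 0.
  by move=> /Ephi h; rewrite gt_eqF// (le_lt_trans M0).
have fE x : `|f x| = \1_E x.
  rewrite /f normrM; have [Ex|Ex] := pselect (E x).
    rewrite indicE mem_set// normr1 mulr1 powR_inv1// normrM normfV normr_id.
    by rewrite divff// phiV.
  by rewrite indicE memNset// normr0 mulr0.
have phifE x : phi x * f x = `|phi x| * \1_E x.
  rewrite /f; have [Ex|Ex] := pselect (E x).
    rewrite indicE mem_set// !mulr1 powR_inv1// mulrA -expr2 -real_normK ?num_real//.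
    by rewrite expr2 mulfK// phiV.
  by rewrite indicE memNset// !mulr0.
have f1 x : `|f x| <= 1 by rewrite fE indicE; case: (_ \in _).
have Sf : S f.
  by apply: bounded_Lp_supported f1 => // x Dx; rewrite /f phi_supp// !mul0r.
have iphif := phi_bounded_int mf f1.
have ED : E `<=` D.
  move=> x /Ephi; apply: contraPP => Dx.
  by rewrite phi_supp// normr0 => /lt_geF; rewrite M0.
have iE : mu.-integrable setT (fun x => (M * \1_E x)%:E).
  apply: le_integrable (integrable_cst_indic M) => //.
    by apply/measurable_EFinP; apply: measurable_funM.
  move=> x _; rewrite /= lee_fin !normrM ler_wpM2l//.
  have [Ex|Ex] := pselect (E x).
    by rewrite !indicE !mem_set//; exact: ED.
  by rewrite indicE memNset// normr0.
have iphiE : mu.-integrable setT (fun x => (`|phi x| * \1_E x)%:E).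
  by move: iphif; under eq_fun do rewrite phifE.
have : \int[mu]_x (`|phi x| * \1_E x) <= \int[mu]_x (M * \1_E x).
  have := lM Sf; rewrite repr// pe1 !powRr1//.
  under eq_Rintegral do rewrite phifE.
  under [X in _ <= _ * X]eq_Rintegral do rewrite powRr1// fE.
  move=> /(le_trans (ler_norm _)) /le_trans; apply.
  rewrite RintegralZl//.
  apply: le_integrable (integrable_cst_indic 1) => //.
    by apply/measurable_EFinP.
  move=> x _; rewrite /= lee_fin mul1r.
  have [Ex|Ex] := pselect (E x).
    by rewrite !indicE !mem_set//; exact: ED.
  by rewrite indicE memNset// normr0.
(* The integrand (|phi| - M) 1_E is nonnegative and positive on E, so a nonpositive integral forces
   E to be null. *)
rewrite -subr_le0 -RintegralB// => le0.
have I0 : (\int[mu]_x `|((`|phi x| - M) * \1_E x)%:E| = 0)%E.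
  have ge0 x : 0 <= (`|phi x| - M) * \1_E x.
    have [Ex|Ex] := pselect (E x); last by rewrite indicE memNset// mulr0.
    by rewrite mulr_ge0// subr_ge0 ltW// Ephi.
  have iB : mu.-integrable setT (fun x => ((`|phi x| - M) * \1_E x)%:E).
    under eq_fun do rewrite mulrBl EFinB; exact: integrableB.
  under eq_integral do rewrite gee0_abs ?lee_fin//.
  rewrite -(fineK (integrable_fin_num measurableT iB)); congr EFin.
  apply/eqP; rewrite eq_le; apply/andP; split; last first.
    by apply: fine_ge0; apply: integral_ge0 => x _; rewrite lee_fin.
  apply: le_trans le0; rewrite le_eqVlt; apply/orP; left; apply/eqP.
  by rewrite /Rintegral; congr fine; apply: eq_integral => x _; rewrite mulrBl.
have /ae_eq_integral_abs : measurable_fun setT (fun x => ((`|phi x| - M) * \1_E x)%:E).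
  apply/measurable_EFinP; apply: measurable_funM => //.
  by apply: measurable_funB => //; exact: measurableT_comp.
move=> /(_ mu measurableT)[/(_ I0) + _].
apply: (@filterS _ _ (ae_filter_ringOfSetsType mu)) => x /(_ Logic.I)[] h.
rewrite leNgt; apply/negP => Mphi.
have Ex : E x by rewrite /E /= => /(lt_le_trans Mphi); rewrite ltxx.
move: h; rewrite indicE mem_set// mulr1 => /eqP.
by rewrite subr_eq0 gt_eqF.
Qed.

(* For f = sgn(phi) |phi|^(q - 1) on {|phi| <= n} one has
   phi f = |f|^p = |phi|^q there, so X := \int phi f satisfies X^p <= M^p X. *)
Let phi_Lq : 1 < p ->
  mu.-integrable setT (fun x => (`|phi x| `^ (p / (p - 1)))%:E).
Proof.
move=> p1'; pose q := p / (p - 1).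
have pB0 : 0 < p - 1 by rewrite subr_gt0.
have q0 : 0 < q by rewrite divr_gt0.
have qB : q - 1 = (p - 1)^-1.
  rewrite /q -[X in _ - X](@divff _ (p - 1)) ?gt_eqF// -mulrBl.
  by rewrite opprB addrCA subrr addr0 mul1r.
have qB0 : 0 < q - 1 by rewrite qB invr_gt0.
pose E n : set T := [set x | `|phi x| <= n%:R].
have mE n : measurable (E n) by exact: phi_le_meas.
(* The factor phi supplies the sign and one power of |phi|, which leaves the exponent q - 2; it is
   negative for p > 2, and at zeros of phi the factor phi makes the product 0. *)
pose f n x := phi x * `|phi x| `^ (q - 1 - 1) * \1_(E n) x.
have mf n : measurable_fun setT (f n) by exact: phi_powR_meas.
have fE n x : `|f n x| = `|phi x| `^ (q - 1) * \1_(E n) x.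
  rewrite /f !normrM (@ger0_norm _ (_ `^ _)) ?powR_ge0// mulr_powRB1//.
  by rewrite (@ger0_norm _ (\1_ _ _)).
have phifE n x : phi x * f n x = `|phi x| `^ q * \1_(E n) x.
  rewrite /f !mulrA -expr2 -real_normK ?num_real// expr2 -!mulrA.
  by rewrite [X in _ * X]mulrA mulr_powRB1// mulrA mulr_powRB1.
have fpE n x : `|f n x| `^ p = `|phi x| `^ q * \1_(E n) x.
  rewrite fE powRM ?powR_ge0// -powRrM qB mulrC [(p-1)^-1 * p]mulrC -/q mulrC.
  congr (_ * _); rewrite indicE; case: (_ \in _); rewrite ?powR1 ?powR0// gt_eqF//.
have fb n x : `|f n x| <= n%:R `^ (q - 1).
  rewrite fE; have [Ex|Ex] := pselect (E n x).
    by rewrite indicE mem_set// mulr1 ge0_ler_powR ?nnegrE// ltW.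
  by rewrite indicE memNset// mulr0 powR_ge0.
have Sf n : S (f n).
  apply: bounded_Lp_supported (fb n) => // x Dx.
  by rewrite /f phi_supp// !mul0r.
have iphif n := phi_bounded_int (mf n) (fb n).
pose X n := \int[mu]_x (`|phi x| `^ q * \1_(E n) x).
have X0 n : 0 <= X n by apply: Rintegral_ge0 => x _; rewrite mulr_ge0 ?powR_ge0.
have XM n : X n `^ p <= M `^ p * X n.
  have := lM (Sf n); rewrite repr//.
  have -> : \int[mu]_x (phi x * f n x) = X n.
    by apply: eq_Rintegral => x _; rewrite phifE.
  have -> : \int[mu]_x `|f n x| `^ p = X n.
    by apply: eq_Rintegral => x _; rewrite fpE.
  by rewrite ger0_norm.
(* Dividing [XM] by X n > 0 gives X^(p - 1) <= M^p, a bound free of n, which survives the limit over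
   the increasing sets [E n]. *)
have XK n : X n <= (M `^ p) `^ (p - 1)^-1.
  have [->|Xn0] := eqVneq (X n) 0; first exact: powR_ge0.
  have Xn : 0 < X n by rewrite lt_neqAle eq_sym Xn0 X0.
  have XM' : X n `^ (p - 1) <= M `^ p.
    rewrite -(ler_pM2l Xn) mulr_powRB1// ?(lt_trans _ p1')// mulrC; exact: XM.
  have -> : X n = (X n `^ (p - 1)) `^ (p - 1)^-1.
    by rewrite -powRrM divff ?gt_eqF// powRr1.
  by rewrite ge0_ler_powR ?nnegrE ?powR_ge0// invr_ge0 ltW.
have mq : measurable_fun setT (fun x => (`|phi x| `^ q)%:E).
  apply: measurableT_comp => //.
  apply: (measurableT_comp (measurable_powR _)) => //.
  exact: measurableT_comp.
apply/integrableP; split => //.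
under eq_integral => x _ do rewrite gee0_abs ?lee_fin ?powR_ge0//.
have ET : \bigcup_n E n = setT.
  apply/seteqP; split => // x _; exists (Num.truncn `|phi x|).+1 => //=.
  exact/ltW/truncnS_gt.
apply: (@le_lt_trans _ _ ((M `^ p) `^ (p - 1)^-1)%:E); last exact: ltry.
rewrite -ET.
have cvgI : (\int[mu]_(x in E n) (`|phi x| `^ q)%:E)%E @[n --> \oo] -->
    (\int[mu]_(x in \bigcup_n E n) (`|phi x| `^ q)%:E)%E.
  apply: ge0_nondecreasing_set_cvg_integral => //.
  - move=> m n mn; apply/subsetPset => x /= /le_trans; apply.
    by rewrite ler_nat.
  - by move=> n; exact: measurable_funTS.
rewrite -(cvg_lim _ cvgI)//; apply: lime_le; first by apply/cvg_ex; eexists; exact: cvgI.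
apply: nearW => n; rewrite integral_mkcond.
have iphiE : mu.-integrable setT (fun x => (`|phi x| `^ q * \1_(E n) x)%:E).
  by move: (iphif n); under eq_fun do rewrite phifE.
rewrite (_ : integral _ _ _ = (X n)%:E) ?lee_fin//.
rewrite /X /Rintegral fineK; last exact: integrable_fin_num.
apply: eq_integral => x _; rewrite patchE indicE.
by case: ifPn => _; rewrite ?mulr1 ?mulr0.
Qed.

Lemma Lp_functional_representation : exists phi : T -> R,
  [/\ phi \in Lfun mu (hoelder_conjugate p%:E), forall x, ~ D x -> phi x = 0 &
      forall f, S f -> l f = \int[mu]_x (phi x * f x)].
Proof.
have Lphi : phi \in Lfun mu (hoelder_conjugate p%:E).
  rewrite inE; apply/andP; split; rewrite inE//= /finite_norm.
  move: p1; rewrite le_eqVlt => /predU1P[pe1|p1'].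
    rewrite -pe1 hoelder_conjugate1 unlock; case: ifPn => // _.
    apply: (@le_lt_trans _ _ M%:E); last exact: ltry.
    apply/ess_supP.
    apply: (@filterS _ _ (ae_filter_ringOfSetsType mu)) (phi_Ly (esym pe1)) => x.
    by rewrite /= lee_fin.
  rewrite hoelder_conjugate_EFin// unlock; apply: poweR_lty.
  have /integrableP[_] := phi_Lq p1'; apply: le_lt_trans.
  by under [leRHS]eq_integral => x _ do rewrite gee0_abs ?lee_fin ?powR_ge0//.
(* Membership in L_p' now yields, by Hoelder, the integrability that [repr] asks for. *)
exists phi; split => // f Sf; apply: repr => //.
have := Lfun_conjugate_integrable p1E Sf.1 Lphi.
by apply: eq_integrable => // x _; rewrite /= mulrC.
Qed.

End DualOfLp.

(** * Complex-valued functions *)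

Section AlmostEverywhereEqual.
Context d (T : measurableType d) (R : realType).
Variable mu : {measure set T -> \bar R}.
Implicit Types (f g : T -> \bar R) (D : set T).

Local Open Scope ereal_scope.

(* Unlike [ae_eq_integral], no measurability is needed: a nonnegative simple
   function below f can be cut down to 0 on the null set where f and g differ. *)
Lemma ge0_le_integral_ae f g : (forall x, 0 <= f x) -> (forall x, 0 <= g x) ->
  {ae mu, forall x, f x = g x} -> \int[mu]_x f x <= \int[mu]_x g x.
Proof.
move=> f0 g0 [N [mN N0 fgN]].
rewrite !ge0_integralTE//; apply: ge_ereal_sup => _ [h /= hf <-].
have mNc : measurable (~` N) by exact: measurableC.
pose h' := mul_nnsfun h (indic_nnsfun R mNc).
have h'E x : h' x = (h x * \1_(~` N) x)%R by [].
apply: ereal_sup_ubound; exists h'.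
  move=> x; have [Nx|Nx] := pselect (N x).
    by rewrite h'E indicE memNset ?mulr0//=; apply.
  rewrite h'E indicE mem_set// mulr1 -(_ : f x = g x)//.
  by apply: contrapT => fgx; apply: Nx; apply: fgN.
rewrite -!integralT_nnsfun; apply: ge0_ae_eq_integral => //.
- by apply/measurable_EFinP.
- by apply/measurable_EFinP.
- by move=> x _; rewrite lee_fin.
- by move=> x _; rewrite lee_fin.
- exists N; split => // x hh'; apply: contrapT => Nx; apply: hh' => _.
  by rewrite h'E indicE mem_set// mulr1.
Qed.

Lemma ge0_integral_ae f g : (forall x, 0 <= f x) -> (forall x, 0 <= g x) ->
  {ae mu, forall x, f x = g x} -> \int[mu]_x f x = \int[mu]_x g x.
Proof.
move=> f0 g0 fg; apply/eqP; rewrite eq_le !ge0_le_integral_ae//.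
by apply: (@filterS _ _ (ae_filter_ringOfSetsType mu)) fg => x ->.
Qed.

(** Elements of L_p are given as functions almost everywhere equal to Borel ones; this is what
    allows top derivatives to be replaced inside integrals. *)
Lemma integral_ae D f g : {ae mu, forall x, D x -> f x = g x} ->
  \int[mu]_(x in D) f x = \int[mu]_(x in D) g x.
Proof.
move=> fg; rewrite !(integral_mkcond D).
have {}fg : {ae mu, forall x, (f \_ D) x = (g \_ D) x}.
  apply: (@filterS _ _ (ae_filter_ringOfSetsType mu)) fg => x fgx.
  by rewrite !patchE; case: ifPn => //; rewrite inE.
rewrite [LHS]integralE [RHS]integralE; congr (_ - _); apply: ge0_integral_ae => //.
  apply: (@filterS _ _ (ae_filter_ringOfSetsType mu)) fg => x fgx.
  by rewrite !funeposE fgx.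
apply: (@filterS _ _ (ae_filter_ringOfSetsType mu)) fg => x fgx.
by rewrite !funenegE fgx.
Qed.

Lemma Lnorm_ae (p : \bar R) f g : {ae mu, forall x, f x = g x} ->
  Lnorm mu p f = Lnorm mu p g.
Proof.
move=> fg; rewrite unlock; case: p => [p| |].
- congr (_ `^ _); apply: integral_ae.
  by apply: (@filterS _ _ (ae_filter_ringOfSetsType mu)) fg => x -> _.
- case: ifPn => // _; apply: eq_ess_sup.
  by apply: (@filterS _ _ (ae_filter_ringOfSetsType mu)) fg => x /= ->.
- case: ifPn => // _; apply: eq_ess_inf.
  by apply: (@filterS _ _ (ae_filter_ringOfSetsType mu)) fg => x /= ->.
Qed.

Lemma le_Lnorm (p : \bar R) (f g : T -> R) : 1 <= p ->
  measurable_fun setT f -> measurable_fun setT g ->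
  (forall x, (`|f x| <= `|g x|)%R) ->
  Lnorm mu p (EFin \o f) <= Lnorm mu p (EFin \o g).
Proof.
move=> p1 mf mg fg; rewrite unlock; case: p p1 => [p| |]//.
- rewrite lee_fin => p1; have p0 : (0 < p)%R by exact: lt_le_trans p1.
  have mp (h : T -> R) : measurable_fun setT h ->
      measurable_fun setT (fun x => (`|h x| `^ p)%:E).
    move=> mh; apply: measurableT_comp => //.
    apply: (measurableT_comp (measurable_powR _)) => //.
    exact: measurableT_comp.
  apply: gt0_ler_poweR; rewrite ?invr_ge0 ?(ltW p0)//;
    rewrite ?in_itv/= ?andbT ?leey ?integral_ge0//.
  apply: ge0_le_integral => //; [exact: mp|exact: mp|].
  by move=> x _; rewrite lee_fin ge0_ler_powR ?nnegrE// ltW.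
- move=> _; case: ifPn => // _; apply: le_ess_sup.
  by apply: aeW => x /=; rewrite lee_fin.
Qed.

End AlmostEverywhereEqual.

(** * The modulus of a complex number *)

Section ComplexModulus.
Context {R : realType}.
Implicit Types (z w : R[i]).

Lemma cReD z w : complex.Re (z + w) = complex.Re z + complex.Re w.
Proof. by case: z; case: w. Qed.

Lemma cImD z w : complex.Im (z + w) = complex.Im z + complex.Im w.
Proof. by case: z; case: w. Qed.

Lemma cReM z w : complex.Re (z * w) =
  complex.Re z * complex.Re w - complex.Im z * complex.Im w.
Proof. by case: z; case: w. Qed.

Lemma cImM z w : complex.Im (z * w) =
  complex.Re z * complex.Im w + complex.Im z * complex.Re w.
Proof. by case: z; case: w. Qed.

Lemma complex_eq z w : complex.Re z = complex.Re w ->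
  complex.Im z = complex.Im w -> z = w.
Proof. by case: z; case: w => /= ? ? ? ? -> ->. Qed.

Lemma cabsE z : cabs z = Num.sqrt (complex.Re z ^+ 2 + complex.Im z ^+ 2).
Proof. by case: z. Qed.

Lemma cabs_ge0 z : 0 <= cabs z.
Proof. by rewrite cabsE sqrtr_ge0. Qed.

Lemma cabs0 : cabs (0 : R[i]) = 0.
Proof. exact: ComplexField.Normc.normc0. Qed.

Lemma cabs0_eq z : cabs z = 0 -> z = 0.
Proof. exact: ComplexField.Normc.eq0_normc. Qed.

Lemma cabsM z w : cabs (z * w) = cabs z * cabs w.
Proof. exact: ComplexField.Normc.normcM. Qed.

Lemma cabsD z w : cabs (z + w) <= cabs z + cabs w.
Proof. exact: le_normcD. Qed.

Lemma cabsN z : cabs (- z) = cabs z.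
Proof. exact: normcN. Qed.

Lemma cabsB z w : cabs (z - w) = cabs (w - z).
Proof. by rewrite -cabsN opprB. Qed.

Lemma Re_le_cabs z : `|complex.Re z| <= cabs z.
Proof. by rewrite cabsE -sqrtr_sqr ler_wsqrtr// lerDl sqr_ge0. Qed.

Lemma Im_le_cabs z : `|complex.Im z| <= cabs z.
Proof. by rewrite cabsE -sqrtr_sqr ler_wsqrtr// lerDr sqr_ge0. Qed.

Lemma cabs_le z : cabs z <= `|complex.Re z| + `|complex.Im z|.
Proof.
rewrite cabsE -[leRHS]ger0_norm ?addr_ge0// -sqrtr_sqr ler_wsqrtr//.
rewrite sqrrD !real_normK ?num_real// -addrA [X in _ <= _ + X]addrC addrA lerDl.
by rewrite mulrn_wge0// mulr_ge0.
Qed.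

Lemma cabs_sum (I : Type) (s : seq I) (F : I -> R[i]) :
  cabs (\sum_(i <- s) F i) <= \sum_(i <- s) cabs (F i).
Proof.
elim: s => [|i s ih]; first by rewrite !big_nil cabs0.
by rewrite !big_cons (le_trans (cabsD _ _))// lerD2l.
Qed.

(** Cauchy-Schwarz in the plane: the difference of the squares is itself a square, by Lagrange's
    identity. The left side is the real part of conj(z) w. *)
Lemma cabs_dot z w :
  complex.Re z * complex.Re w + complex.Im z * complex.Im w <= cabs z * cabs w.
Proof.
rewrite !cabsE -sqrtrM ?addr_ge0 ?sqr_ge0// (le_trans (ler_norm _))//.
rewrite -sqrtr_sqr ler_wsqrtr// -subr_ge0.
rewrite (_ : _ - _ = (complex.Re z * complex.Im w - complex.Im z * complex.Re w) ^+ 2).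
  exact: sqr_ge0.
by ring.
Qed.

End ComplexModulus.

(** * Complex Lebesgue spaces on a segment *)

Section LebesgueSpaces.
Context {R : realType}.
Variables (a b : R).
Implicit Types (f g : R -> R[i]) (u v : R -> R) (p : \bar R) (c : R[i]).
Local Notation mu := (@lebesgue_measure R).

(** Replaces f by measurable real and imaginary parts that vanish off [a, b], so that real
    integration over the whole line applies to u and v. *)
Definition Lp_rep p f u v :=
  [/\ u \in Lfun mu p, v \in Lfun mu p,
      forall x, ~ `[a, b]%classic x -> u x = 0 /\ v x = 0 &
      {ae mu, forall x, x \in `[a, b] -> f x = (u x +i* v x)%C}].

Lemma ae_apply2 (P Q S : R -> Prop) :
  (forall x, P x -> Q x -> S x) -> {ae mu, forall x, P x} ->
  {ae mu, forall x, Q x} -> {ae mu, forall x, S x}.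
Proof.
move=> PQS; exact: (@filterS2 _ _ (ae_filter_ringOfSetsType mu)).
Qed.

Lemma ae_apply (P Q : R -> Prop) :
  (forall x, P x -> Q x) -> {ae mu, forall x, P x} -> {ae mu, forall x, Q x}.
Proof.
move=> PQ; exact: (@filterS _ _ (ae_filter_ringOfSetsType mu)).
Qed.

Lemma Lfun_measurable p u : u \in Lfun mu p -> measurable_fun setT u.
Proof. by move=> /andP[]; rewrite inE. Qed.

Lemma le_Lfun p u v : (1 <= p)%E -> measurable_fun setT u ->
  v \in Lfun mu p -> (forall x, `|u x| <= `|v x|) -> u \in Lfun mu p.
Proof.
move=> p1 mu_ Lv uv; rewrite inE; apply/andP; split; rewrite inE//= /finite_norm.
apply: (@le_lt_trans _ _ (Lnorm mu p (EFin \o v))).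
  by apply: le_Lnorm => //; exact: Lfun_measurable Lv.
by move: Lv => /andP[_]; rewrite inE.
Qed.

Lemma Lfun_lin p (c : R) u v : (1 <= p)%E -> u \in Lfun mu p ->
  v \in Lfun mu p -> (fun x => c * u x + v x) \in Lfun mu p.
Proof. by move=> p1; exact: (Lfun_submod_closed mu p1).2. Qed.

Lemma measurable_cabs u v : measurable_fun setT u -> measurable_fun setT v ->
  measurable_fun setT (fun x => cabs (u x +i* v x)%C).
Proof.
move=> mu_ mv; under eq_fun do rewrite cabsE /=.
apply: (@measurableT_comp _ _ _ _ _ _ (@Num.sqrt R)).
  exact: continuous_measurable_fun (@sqrt_continuous R).
by apply: measurable_funD; exact: measurable_funX.
Qed.

Lemma cabs_Lfun p u v : (1 <= p)%E -> u \in Lfun mu p -> v \in Lfun mu p ->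
  (fun x => cabs (u x +i* v x)%C) \in Lfun mu p.
Proof.
move=> p1 Lu Lv; have [mu_ mv] := (Lfun_measurable Lu, Lfun_measurable Lv).
have abs w : w \in Lfun mu p -> (fun x => `|w x|) \in Lfun mu p.
  move=> Lw; apply: (le_Lfun p1 _ Lw); last by move=> x; rewrite normr_id.
  by apply: measurableT_comp => //; exact: Lfun_measurable Lw.
apply: (le_Lfun p1 _ (Lfun_lin 1 p1 (abs _ Lu) (abs _ Lv))).
  exact: measurable_cabs.
move=> x; rewrite mul1r ger0_norm ?cabs_ge0// [leRHS]ger0_norm ?addr_ge0//.
exact: cabs_le.
Qed.

Lemma Lp_norm_rep p f u v : Lp_rep p f u v ->
  Lp_norm a b p f = Lnorm mu p (fun x => (cabs (u x +i* v x)%C)%:E).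
Proof.
move=> [_ _ uv0 fuv]; apply: Lnorm_ae; apply: ae_apply fuv => x fx.
rewrite patchE; case: ifPn => [|xI]; first by rewrite inE => /fx ->.
have [|-> ->] := uv0 x; first by move=> xI'; rewrite mem_set in xI.
by rewrite -[(0 +i* 0)%C]/(0 : R[i]) cabs0.
Qed.

Lemma in_Lp_rep p f : (1 <= p)%E -> in_Lp a b p f -> exists u v, Lp_rep p f u v.
Proof.
move=> p1 [[h [mRe mIm fh]] Nf].
pose u := (fun x => complex.Re (h x)) \_ `[a, b].
pose v := (fun x => complex.Im (h x)) \_ `[a, b].
have mu_ : measurable_fun setT u by apply/(measurable_restrictT _ _).1.
have mv : measurable_fun setT v by apply/(measurable_restrictT _ _).1.
have uv0 x : ~ `[a, b]%classic x -> u x = 0 /\ v x = 0.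
  by move=> xI; rewrite /u /v !patchE memNset.
have fuv : {ae mu, forall x, x \in `[a, b] -> f x = (u x +i* v x)%C}.
  apply: ae_apply fh => x + xI => /(_ xI) ->.
  rewrite /u /v !patchE mem_set//; by case: (h x).
have Nuv : (Lnorm mu p (EFin \o (fun x => cabs (u x +i* v x)%C)) < +oo)%E.
  move: Nf; congr (_ < _)%E; apply: Lnorm_ae; apply: ae_apply fuv => x fx.
  rewrite patchE /=; case: ifPn => [|xI]; first by rewrite inE => /fx ->.
  have [|-> ->] := uv0 x; first by move=> xI'; rewrite mem_set in xI.
  by rewrite -[RHS]/((cabs (0 : R[i]))%:E) cabs0.
exists u, v; split => //; rewrite inE; apply/andP; split; rewrite inE//= /finite_norm.
  apply: le_lt_trans Nuv; apply: le_Lnorm => //; first exact: measurable_cabs.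
  move=> x; rewrite [leRHS]ger0_norm ?cabs_ge0//.
  exact: (Re_le_cabs (u x +i* v x)%C).
apply: le_lt_trans Nuv; apply: le_Lnorm => //; first exact: measurable_cabs.
move=> x; rewrite [leRHS]ger0_norm ?cabs_ge0//.
exact: (Im_le_cabs (u x +i* v x)%C).
Qed.

Lemma rep_in_Lp p f u v : (1 <= p)%E -> Lp_rep p f u v -> in_Lp a b p f.
Proof.
move=> p1 fuv; have [Lu Lv uv0 fuvE] := fuv; split.
  exists (fun x => (u x +i* v x)%C); split.
  - exact: measurable_funTS (Lfun_measurable Lu).
  - exact: measurable_funTS (Lfun_measurable Lv).
  - by apply: ae_apply fuvE => x fx xI; exact: fx.
rewrite (Lp_norm_rep fuv).
by have /andP[_] := cabs_Lfun p1 Lu Lv; rewrite inE.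
Qed.

Lemma Lp_rep_ae p f g u v : {ae mu, forall x, x \in `[a, b] -> f x = g x} ->
  Lp_rep p f u v -> Lp_rep p g u v.
Proof.
move=> fg [Lu Lv uv0 fuv]; split => //.
by apply: ae_apply2 fg fuv => x fgx fx xI; rewrite -fgx// fx.
Qed.

Lemma in_Lp_ae p f g : (1 <= p)%E ->
  {ae mu, forall x, x \in `[a, b] -> f x = g x} ->
  in_Lp a b p f -> in_Lp a b p g.
Proof.
move=> p1 fg /(in_Lp_rep p1)[u [v /(Lp_rep_ae fg)]]; exact: rep_in_Lp.
Qed.

Lemma Lp_norm_ae p f g : {ae mu, forall x, x \in `[a, b] -> f x = g x} ->
  Lp_norm a b p f = Lp_norm a b p g.
Proof.
move=> fg; apply: Lnorm_ae; apply: ae_apply fg => x fx.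
by rewrite !patchE; case: ifPn => //; rewrite inE => /fx ->.
Qed.

Lemma cintegral_ae f g : {ae mu, forall x, x \in `[a, b] -> f x = g x} ->
  cintegral a b f = cintegral a b g.
Proof.
move=> fg; rewrite /cintegral /Rintegral; congr (fine _ +i* fine _)%C;
  by apply: integral_ae; apply: ae_apply fg => x fx xI; rewrite fx.
Qed.

Lemma cintegral_rep p f u v : Lp_rep p f u v ->
  cintegral a b f = ((\int[mu]_x u x) +i* (\int[mu]_x v x))%C.
Proof.
move=> [_ _ uv0 fuv]; rewrite (cintegral_ae fuv) /cintegral /=.
have E w : (forall x, ~ `[a, b]%classic x -> w x = 0) ->
    \int[mu]_(x in `[a, b]) w x = \int[mu]_x w x.
  move=> w0; rewrite Rintegral_mkcond; congr Rintegral; apply/funext => x.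
  rewrite patchE; case: ifPn => // xI; rewrite w0// => xI'.
  by rewrite mem_set in xI.
by rewrite !E// => x /uv0[].
Qed.

Lemma Lp_rep_lin p c f g u v u' v' : (1 <= p)%E -> Lp_rep p f u v ->
  Lp_rep p g u' v' ->
  Lp_rep p (fun x => c * f x + g x)
    (fun x => complex.Re c * u x + (- complex.Im c * v x + u' x))
    (fun x => complex.Re c * v x + (complex.Im c * u x + v' x)).
Proof.
move=> p1 [Lu Lv uv0 fuv] [Lu' Lv' uv0' guv]; split.
- by do 2 apply: Lfun_lin => //.
- by do 2 apply: Lfun_lin => //.
- by move=> x xI; have [-> ->] := uv0 x xI; have [-> ->] := uv0' x xI;
    rewrite !mulr0 !addr0.
- apply: ae_apply2 fuv guv => x fx gx xI; rewrite fx// gx//.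
  by apply: complex_eq; rewrite ?cReD ?cImD ?cReM ?cImM /=; ring.
Qed.

Lemma in_Lp_lin p c f g : (1 <= p)%E -> in_Lp a b p f -> in_Lp a b p g ->
  in_Lp a b p (fun x => c * f x + g x).
Proof.
move=> p1 /(in_Lp_rep p1)[u [v fuv]] /(in_Lp_rep p1)[u' [v' guv]].
exact: rep_in_Lp (Lp_rep_lin c p1 fuv guv).
Qed.

Let p11 : (1 <= 1 :> \bar R)%E := lexx _.

Lemma cintegral_lin c f g : in_Lp a b 1 f -> in_Lp a b 1 g ->
  cintegral a b (fun x => c * f x + g x) = c * cintegral a b f + cintegral a b g.
Proof.
move=> /(in_Lp_rep p11)[u [v fuv]] /(in_Lp_rep p11)[u' [v' guv]].
rewrite (cintegral_rep (Lp_rep_lin c p11 fuv guv)).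
rewrite (cintegral_rep fuv) (cintegral_rep guv).
have [/Lfun1_integrable iu /Lfun1_integrable iv _ _] := fuv.
have [/Lfun1_integrable iu' /Lfun1_integrable iv' _ _] := guv.
have lin (k l : R) (w1 w2 w3 : R -> R) : mu.-integrable setT (EFin \o w1) ->
    mu.-integrable setT (EFin \o w2) -> mu.-integrable setT (EFin \o w3) ->
    \int[mu]_x (k * w1 x + (l * w2 x + w3 x)) =
    k * \int[mu]_x w1 x + (l * \int[mu]_x w2 x + \int[mu]_x w3 x).
  move=> i1 i2 i3.
  have iZ (m : R) w : mu.-integrable setT (EFin \o w) ->
      mu.-integrable setT (EFin \o (fun x => m * w x)).
    by move=> iw; rewrite /comp; under eq_fun do rewrite EFinM; exact: integrableZl.
  rewrite RintegralD//; [|exact: iZ|].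
    by rewrite RintegralD//; [rewrite !RintegralZl|exact: iZ].
  rewrite /comp; under eq_fun do rewrite EFinD.
  by apply: integrableD => //; exact: iZ.
rewrite !lin//; apply: complex_eq; rewrite ?cReD ?cImD ?cReM ?cImM /=; ring.
Qed.

(** With z the integral, |z|^2 is the integral of the real scalar product of z with f, which
    [cabs_dot] bounds by |z| |f|; then divide by |z|. Treating real and imaginary parts separately
    would lose the constant 1. *)
Lemma cabs_cintegral f : in_Lp a b 1 f ->
  ((cabs (cintegral a b f))%:E <= Lp_norm a b 1 f)%E.
Proof.
move=> /(in_Lp_rep p11)[u [v fuv]].
rewrite (cintegral_rep fuv) (Lp_norm_rep fuv) Lnorm1.
have [Lu Lv _ _] := fuv.
have /Lfun1_integrable iuv := cabs_Lfun p11 Lu Lv.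
move: Lu Lv => /Lfun1_integrable iu /Lfun1_integrable iv.
under eq_integral do rewrite abse_EFin ger0_norm ?cabs_ge0//.
rewrite -(fineK (integrable_fin_num measurableT iuv)) lee_fin -/(Rintegral _ _ _).
set z := (X in cabs X); set N := Rintegral _ _ _.
have N0 : 0 <= N by apply: Rintegral_ge0 => x _; exact: cabs_ge0.
have [->|z0] := eqVneq (cabs z) 0; first exact: N0.
have {}z0 : 0 < cabs z by rewrite lt_neqAle eq_sym z0 cabs_ge0.
rewrite -(ler_pM2l z0) -expr2 {1}cabsE sqr_sqrtr ?addr_ge0 ?sqr_ge0//.
have iZ (m : R) w : mu.-integrable setT (EFin \o w) ->
    mu.-integrable setT (EFin \o (fun x => m * w x)).
  by move=> iw; rewrite /comp; under eq_fun do rewrite EFinM; exact: integrableZl.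
rewrite !expr2 {2 4}/z /= -!RintegralZl//.
rewrite -RintegralD//; [|exact: iZ|exact: iZ].
apply: le_Rintegral => //.
- rewrite /comp; under eq_fun do rewrite EFinD.
  by apply: integrableD => //; exact: iZ.
- exact: iZ.
- by move=> x _; exact: (cabs_dot z (u x +i* v x)%C).
Qed.

Lemma in_LpM p f g : (1 <= p)%E -> in_Lp a b p f ->
  in_Lp a b (hoelder_conjugate p) g ->
  in_Lp a b 1 (fun x => g x * f x) /\
  (Lp_norm a b 1 (fun x => g x * f x)%R <=
   Lp_norm a b (hoelder_conjugate p) g * Lp_norm a b p f)%E.
Proof.
move=> p1 fp gp; have q1 := hoelder_conj_ge1 p1.
have [u [v fuv]] := in_Lp_rep p1 fp; have [u' [v' guv]] := in_Lp_rep q1 gp.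
have [Lu Lv uv0 fE] := fuv; have [Lu' Lv' uv0' gE] := guv.
have prod w w' : w \in Lfun mu p -> w' \in Lfun mu (hoelder_conjugate p) ->
    w' \* w \in Lfun mu 1.
  move=> Lw Lw'; apply/Lfun1_integrable.
  have -> : w' \* w = w \* w' by apply/funext => x /=; rewrite mulrC.
  exact: Lfun_conjugate_integrable Lw Lw'.
have rep : Lp_rep 1 (fun x => g x * f x)
    (fun x => -1 * (v' \* v) x + (u' \* u) x)
    (fun x => 1 * (v' \* u) x + (u' \* v) x).
  split.
  - by apply: Lfun_lin => //; exact: prod.
  - by apply: Lfun_lin => //; exact: prod.
  - by move=> x xI /=; have [-> ->] := uv0 x xI; rewrite !mulr0 !addr0.
  - apply: ae_apply2 fE gE => x fx gx xI; rewrite fx// gx//.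
    by apply: complex_eq; rewrite ?cReM ?cImM /=; ring.
split; first exact: rep_in_Lp rep.
rewrite (Lp_norm_rep rep) (Lp_norm_rep fuv) (Lp_norm_rep guv) muleC.
have -> : (fun x => (cabs ((-1 * (v' \* v) x + (u' \* u) x) +i*
      (1 * (v' \* u) x + (u' \* v) x))%C)%:E) =
    EFin \o ((fun x => cabs (u x +i* v x)%C) \* (fun x => cabs (u' x +i* v' x)%C))%R.
  apply/funext => x.
  transitivity ((cabs (u x +i* v x)%C * cabs (u' x +i* v' x)%C)%:E); last by [].
  rewrite -cabsM; congr (cabs _)%:E.
  by apply: complex_eq; rewrite ?cReM ?cImM /=; ring.
apply: ehoelder => //; apply: measurable_cabs;
  [exact: Lfun_measurable Lu|exact: Lfun_measurable Lv
  |exact: Lfun_measurable Lu'|exact: Lfun_measurable Lv'].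
Qed.

Lemma Lfun_indic_segment p : (1 <= p)%E -> \1_(`[a, b]%classic) \in Lfun mu p.
Proof.
move=> p1; have muI : (mu `[a, b]%classic < +oo)%E.
  by rewrite lebesgue_measure_itv /=; case: ifPn => // _; rewrite -EFinB ltry.
rewrite inE; apply/andP; split; rewrite inE//= /finite_norm.
rewrite unlock; case: p p1 => [p p1|_|//].
  have p0 : p != 0 by rewrite gt_eqF// (lt_le_trans ltr01).
  apply: poweR_lty; rewrite (_ : integral _ _ _ = mu `[a, b]%classic)//.
  transitivity (\int[mu]_x (\1_(`[a, b]%classic) x)%:E)%E.
    apply: eq_integral => x _; rewrite /= indicE.
    by case: (_ \in _); rewrite ?normr1 ?powR1 ?normr0 ?powR0.
  by rewrite integral_indic// setIT.
case: ifPn => // _; apply: (@le_lt_trans _ _ 1%E); last exact: ltry.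
apply/ess_supP; apply: aeW => x /=; rewrite lee_fin indicE.
by case: (_ \in _); rewrite ?normr1 ?normr0.
Qed.

(** For a < b this is (b - a)^(1/p), or 1 for p = +oo; kept as a norm, it serves all exponents at
    once. *)
Definition segment_norm p : R := fine (Lnorm mu p (EFin \o \1_(`[a, b]%classic))).

Lemma segment_norm_ge0 p : 0 <= segment_norm p.
Proof. by rewrite fine_ge0// Lnorm_ge0. Qed.

Lemma bounded_in_Lp p f (M : R) : (1 <= p)%E -> 0 <= M ->
  measurable_fun `[a, b] (fun x => complex.Re (f x)) ->
  measurable_fun `[a, b] (fun x => complex.Im (f x)) ->
  (forall x, x \in `[a, b] -> cabs (f x) <= M) ->
  in_Lp a b p f /\ (Lp_norm a b p f <= (M * segment_norm p)%:E)%E.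
Proof.
move=> p1 M0 mRe mIm fM; have LI := Lfun_indic_segment p1.
pose MI : R -> R := fun x => M * \1_(`[a, b]%classic) x + 0.
have LMI : MI \in Lfun mu p.
  by apply: Lfun_lin => //; exact: (Lfun_submod_closed mu p1).1.
pose u := (fun x => complex.Re (f x)) \_ `[a, b].
pose v := (fun x => complex.Im (f x)) \_ `[a, b].
have mu_ : measurable_fun setT u by apply/(measurable_restrictT _ _).1.
have mv : measurable_fun setT v by apply/(measurable_restrictT _ _).1.
have uvE x : (u x +i* v x)%C = if x \in `[a, b]%classic then f x else 0.
  by rewrite /u /v !patchE; case: ifPn => // _; case: (f x).
have uvM x : `|cabs (u x +i* v x)%C| <= `|MI x|.
  rewrite uvE /MI addr0 indicE ger0_norm ?cabs_ge0//.
  case: ifPn => [|_]; last by rewrite cabs0.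
  by rewrite inE mulr1 ger0_norm// => /fM.
have rep : Lp_rep p f u v.
  split.
  - apply: (le_Lfun p1 mu_ LMI) => x; apply: le_trans (uvM x).
    by rewrite [leRHS]ger0_norm ?cabs_ge0//; exact: (Re_le_cabs (u x +i* v x)%C).
  - apply: (le_Lfun p1 mv LMI) => x; apply: le_trans (uvM x).
    by rewrite [leRHS]ger0_norm ?cabs_ge0//; exact: (Im_le_cabs (u x +i* v x)%C).
  - by move=> x xI; rewrite /u /v !patchE memNset.
  - by apply: aeW => x xI; rewrite uvE mem_set.
split; first exact: rep_in_Lp rep.
rewrite (Lp_norm_rep rep).
apply: (@le_trans _ _ (Lnorm mu p (EFin \o MI))).
  by apply: le_Lnorm => //; [exact: measurable_cabs|exact: Lfun_measurable LMI].
have := LnormZ (Lfun_Sub p1 LI) M; rewrite Lfun_valP ger0_norm// => NM.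
have -> : EFin \o MI = EFin \o (M \*: \1_(`[a, b]%classic : set R)).
  by apply/funext => x; rewrite /MI /= addr0.
rewrite NM /segment_norm EFinM fineK// ge0_fin_numE ?Lnorm_ge0//.
by move: LI => /andP[_]; rewrite inE.
Qed.

Lemma Lp_norm_ge0 p f : (0 <= Lp_norm a b p f)%E.
Proof. exact: Lnorm_ge0. Qed.

Lemma Lp_norm_fin p f : in_Lp a b p f -> Lp_norm a b p f \is a fin_num.
Proof. by move=> [_ ?]; rewrite ge0_fin_numE ?Lp_norm_ge0. Qed.

(** Hoelder's inequality against the constant function 1. *)
Lemma in_Lp_in_L1 p f : (1 <= p)%E -> in_Lp a b p f -> in_Lp a b 1 f /\
  (Lp_norm a b 1 f <= (segment_norm (hoelder_conjugate p))%:E * Lp_norm a b p f)%E.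
Proof.
move=> p1 fp; have q1 := hoelder_conj_ge1 p1.
have c1 x : x \in `[a, b] -> cabs (1 : R[i]) <= 1.
  by rewrite [cabs _]ComplexField.Normc.normc1.
have [L1 N1] := @bounded_in_Lp _ (fun=> 1) 1 q1 ler01 (measurable_cst _)
  (measurable_cst _) c1.
have [f1 Nf1] := in_LpM p1 fp L1.
have e : (fun x => 1 * f x) = f by apply/funext => x; rewrite mul1r.
rewrite e in f1 Nf1; split => //; apply: (le_trans Nf1).
by rewrite lee_wpmul2r ?Lp_norm_ge0// -[X in (_ <= X%:E)%E]mul1r.
Qed.

End LebesgueSpaces.

(** * Differentiation and absolute continuity of complex functions *)

Section ComplexCalculus.
Context {R : realType}.
Variables (a b : R).
Hypothesis ab : a < b.
Implicit Types (f g : R -> R[i]) (u v : R -> R) (c : R[i]).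
Local Notation mu := (@lebesgue_measure R).
Local Notation dsegment t := (within `[a, b] t^').

(** Makes limits inside [a, b] unique, so that [lim] returns the derivative. Points t + h with small
    h > 0 witness it when t < b, points t - h when t = b. *)
Lemma within_dnbhs_segment_proper (t : R) : t \in `[a, b] -> ProperFilter (dsegment t).
Proof.
rewrite in_itv /= => /andP[at_ tb].
apply: Build_ProperFilter_ex => A.
rewrite /within /= => /nbhs_ballP[e /= e0 eA].
have e20 : 0 < e / 2 by rewrite divr_gt0.
have e2e : e / 2 < e by rewrite ltr_pdivrMr// ltr_pMr// ltr1n.
have [tb'|bt] := ltP t b.
  pose h := Num.min (e / 2) (b - t).
  have h0 : 0 < h by rewrite lt_min e20 subr_gt0.
  have hb : h <= b - t by rewrite ge_min lexx orbT.
  have he : h < e by rewrite gt_min e2e.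
  exists (t + h); apply: eA.
  - by rewrite /ball /= opprD addNKr normrN gtr0_norm.
  - by rewrite gt_eqF// ltrDl.
  - by rewrite in_itv /= (le_trans at_) ?lerDl ?(ltW h0)//= -lerBrDl.
pose h := Num.min (e / 2) (t - a).
have ta : a < t by apply: lt_le_trans bt.
have h0 : 0 < h by rewrite lt_min e20 subr_gt0.
have hb : h <= t - a by rewrite ge_min lexx orbT.
have he : h < e by rewrite gt_min e2e.
exists (t - h); apply: eA.
- by rewrite /ball /= opprB addrC subrK gtr0_norm.
- by rewrite lt_eqF// ltrBlDr ltrDl.
- by rewrite in_itv /= lerBrDr -lerBrDl hb (le_trans _ tb)// gerBl ltW.
Qed.

Lemma is_deriv_on_derive u (t l : R) : t \in `[a, b] -> is_deriv_on a b u t l ->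
  derivable_on a b u t /\ derive_on a b u t = l.
Proof.
move=> tab ul; have FF := within_dnbhs_segment_proper tab; split.
  by apply/cvg_ex; exists l.
by apply/cvg_lim.
Qed.

Lemma is_deriv_on_lin u v (k l t du dv : R) : is_deriv_on a b u t du ->
  is_deriv_on a b v t dv ->
  is_deriv_on a b (fun x => k * u x + l * v x) t (k * du + l * dv).
Proof.
move=> hu hv; rewrite /is_deriv_on.
have -> : diff_quotient (fun x => k * u x + l * v x) t =
    (fun x => k * diff_quotient u t x + l * diff_quotient v t x).
  by apply/funext => x; rewrite /diff_quotient !mulrA -mulrDl; congr (_ * _); ring.
by apply: cvgD; apply: cvgM => //; exact: cvg_cst.
Qed.

Definition cis_deriv_on f (t : R) (l : R[i]) :=
  is_deriv_on a b (fun x => complex.Re (f x)) t (complex.Re l) /\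
  is_deriv_on a b (fun x => complex.Im (f x)) t (complex.Im l).

Lemma cis_deriv_onE f t l : t \in `[a, b] -> cis_deriv_on f t l ->
  cderivable_on a b f t /\ cderive_on a b f t = l.
Proof.
move=> tab [/(is_deriv_on_derive tab)[d1 e1] /(is_deriv_on_derive tab)[d2 e2]].
by split => //; rewrite /cderive_on e1 e2; case: (l).
Qed.

Lemma cis_deriv_on_lin c f g t df dg : cis_deriv_on f t df ->
  cis_deriv_on g t dg ->
  cis_deriv_on (fun x => c * f x + g x) t (c * df + dg).
Proof.
move=> [f1 f2] [g1 g2]; split.
- have := @is_deriv_on_lin _ _ 1 1 _ _ _
    (@is_deriv_on_lin _ _ (complex.Re c) (- complex.Im c) _ _ _ f1 f2) g1.
  rewrite cReD cReM !mul1r mulNr; congr is_deriv_on; apply/funext => x.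
  by rewrite cReD cReM !mul1r mulNr.
- have := @is_deriv_on_lin _ _ 1 1 _ _ _
    (@is_deriv_on_lin _ _ (complex.Re c) (complex.Im c) _ _ _ f2 f1) g2.
  rewrite cImD cImM !mul1r; congr is_deriv_on; apply/funext => x.
  by rewrite cImD cImM !mul1r.
Qed.

Lemma abs_continuous_on_Re_Im f : abs_continuous_on a b f ->
  abs_continuous a b (fun x => complex.Re (f x)) /\
  abs_continuous a b (fun x => complex.Im (f x)).
Proof.
move=> acf.
(* P stands for the real or the imaginary part; the list s is turned back into a family indexed by
   ['I_N]. *)
have H (P : R[i] -> R) : (forall z w, P (z - w) = P z - P w) ->
    (forall z, `|P z| <= cabs z) -> abs_continuous a b (fun x => P (f x)).
  move=> PB Pc eps eps0; have [delta delta0 fdelta] := acf _ eps0.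
  exists delta => // s sab sd slen.
  pose N := size s; pose u (i : 'I_N) := (nth (0, 0) s i).1.
  pose v (i : 'I_N) := (nth (0, 0) s i).2.
  have E (F : R * R -> R) : \sum_(p <- s) F p = \sum_(i < N) F (u i, v i).
    rewrite (big_nth (0, 0)) big_mkord; apply: eq_bigr => i _.
    by rewrite /u /v -surjective_pairing.
  rewrite (E (fun p => `|P (f p.2) - P (f p.1)|)).
  apply: (@le_lt_trans _ _ (\sum_(i < N) cabs (f (v i) - f (u i)))).
    by apply: ler_sum => i _; rewrite -PB.
  apply: fdelta.
  - move=> i; have /and3P[h1 h2 h3] := allP sab _ (mem_nth (0, 0) (ltn_ord i)).
    by split => //; split.
  - move=> i j; move/(pairwiseP (0, 0)): sd => sd.
    rewrite neq_ltn => /orP[] ij.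
      have /orP[] := sd i j (ltn_ord i) (ltn_ord j) ij; first by left.
      by right.
    have /orP[] := sd j i (ltn_ord j) (ltn_ord i) ij; first by right.
    by left.
  - by rewrite -(E (fun p => p.2 - p.1)).
split; apply: H => //.
- by case=> ? ? [].
- exact: Re_le_cabs.
- by case=> ? ? [].
- exact: Im_le_cabs.
Qed.

Lemma abs_continuous_Re_Im f :
  abs_continuous a b (fun x => complex.Re (f x)) ->
  abs_continuous a b (fun x => complex.Im (f x)) -> abs_continuous_on a b f.
Proof.
move=> acRe acIm eps eps0; have eps2 : 0 < eps / 2 by rewrite divr_gt0.
have [d1 d10 H1] := acRe _ eps2; have [d2 d20 H2] := acIm _ eps2.
exists (Num.min d1 d2); first by rewrite lt_min d10.
move=> N u v uv disj; rewrite lt_min => /andP[l1 l2].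
pose s := [seq (u i, v i) | i <- enum 'I_N].
have E (F : R * R -> R) : \sum_(p <- s) F p = \sum_(i < N) F (u i, v i).
  by rewrite /s big_map big_enum.
have sab : all (in_segment a b) s.
  apply/allP => _ /mapP[i _ ->]; have [h1 [h2 h3]] := uv i.
  by rewrite /in_segment /= h1 h2.
have sd : pairwise nonoverlap s.
  rewrite pairwise_map.
  have : pairwise (fun i j : 'I_N => i != j) (enum 'I_N).
    by rewrite -uniq_pairwise enum_uniq.
  apply: sub_pairwise => i j /disj; rewrite /nonoverlap /=.
  by case=> ->; rewrite ?orbT.
have {}H1 := H1 s sab sd; have {}H2 := H2 s sab sd.
rewrite !E /= in H1 H2.
rewrite [eps]splitr; apply: le_lt_trans (ltrD (H1 l1) (H2 l2)).
rewrite -big_split /=; apply: ler_sum => i _.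
apply: le_trans (cabs_le _) _.
by case: (f (v i)) => ? ?; case: (f (u i)).
Qed.

Lemma abs_continuous_within u : abs_continuous a b u ->
  {within `[a, b], continuous u}.
Proof.
move=> acu; have cu := abs_continuous_continuous_clamp (ltW ab) acu.
apply: (@subspace_eq_continuous _ _ _ (u \o clamp a b)).
  by move=> x; rewrite inE /= in_itv /= => xab; rewrite clamp_id.
exact: continuous_subspaceT.
Qed.

Lemma continuous_segment_bounded u : {within `[a, b], continuous u} ->
  exists2 M : R, 0 <= M & forall x, x \in `[a, b] -> `|u x| <= M.
Proof.
move=> cu.
have cnu : {within `[a, b], continuous (fun x => `|u x|)}.
  by move=> x; exact: (cvg_norm (cu x)).
have [c cab uc] := EVT_max (ltW ab) cnu.
by exists `|u c|.
Qed.

Lemma lipschitz_abs_continuous u (L : R) : 0 <= L ->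
  (forall x y, x \in `[a, b] -> y \in `[a, b] -> x <= y ->
    `|u y - u x| <= L * (y - x)) -> abs_continuous a b u.
Proof.
move=> L0 Lu eps eps0; exists (eps / (L + 1)).
  by rewrite divr_gt0// ltr_wpDl.
move=> s sab _; rewrite ltr_pdivlMr ?ltr_wpDl// => slen; apply: le_lt_trans slen.
rewrite mulr_suml !big_seq; apply: ler_sum => p /(allP sab)/and3P[ap pp pb].
rewrite (le_trans (Lu _ _ _ _ pp)) ?in_itv /= ?ap ?pb ?andbT ?(le_trans ap)//;
  rewrite ?(le_trans pp)//.
by rewrite mulrC ler_wpM2l ?subr_ge0// lerDl.
Qed.

Lemma is_deriv_on_is_derive u (t l : R) : t \in `]a, b[ ->
  is_deriv_on a b u t l -> is_derive t (1 : R) u l.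
Proof.
move=> tab ul; apply/is_derive1_caratheodory.
exists (fun x => if x == t then l else diff_quotient u t x); split.
- move=> x; have [->|xt] := eqVneq x t; first by rewrite !subrr mulr0.
  by rewrite /diff_quotient divfK// subr_eq0.
- apply/continuous_withinNx; rewrite eqxx.
  have : diff_quotient u t @ t^' --> l.
    move=> A /ul; rewrite /= !nbhs_filterE /fmap /= /dnbhs /within /= => h.
    have h2 := near_in_itvoo tab.
    near=> x => xt; have hx : x \in `]a, b[ by near: x.
    have : x != t -> `[a, b]%classic x -> A (diff_quotient u t x) by near: x.
    by apply => //; exact: subset_itv_oo_cc.
  apply: cvg_trans; apply: near_eq_cvg; near=> x.
  rewrite ifF//; apply/negbTE; near: x; exact: nbhs_dnbhs_neq.
- by rewrite eqxx.
Unshelve. all: by end_near. Qed.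

End ComplexCalculus.

(** * Complex primitives and the fundamental theorem of calculus *)

Section ComplexPrimitive.
Context {R : realType}.
Variables (a b : R).
Hypothesis ab : a < b.
Implicit Types (f g : R -> R[i]) (u v : R -> R) (c : R[i]).
Local Notation mu := (@lebesgue_measure R).
Local Notation cis_deriv := (cis_deriv_on a b).

Lemma is_deriv_on_continuous u u' :
  (forall t, t \in `[a, b] -> is_deriv_on a b u t (u' t)) ->
  {within `[a, b], continuous u}.
Proof.
move=> du; apply/subspace_continuousP => t tab.
have ct : u @ within `[a, b] t^' --> u t.
  have -> : u t = u t + u' t * (t - t) by rewrite subrr mulr0 addr0.
  have h : (fun x => u t + diff_quotient u t x * (x - t)) @ within `[a, b] t^' -->
      u t + u' t * (t - t).
    apply: cvgD; first exact: cvg_cst.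
    apply: cvgM; first exact: du.
    apply: cvgB; last exact: cvg_cst.
    by apply: cvg_trans (@cvg_within _ _ _ _); exact: cvg_within.
  apply: cvg_trans h; apply: near_eq_cvg; rewrite near_withinE.
  near=> x => _; rewrite /diff_quotient divfK.
    by rewrite addrC subrK.
  by rewrite subr_eq0; near: x; exact: nbhs_dnbhs_neq.
move=> A /[dup] /nbhs_singleton At /ct.
rewrite /= !nbhs_filterE /fmap /within /dnbhs /within /= => h.
near=> x => xab; have [->//|xt] := eqVneq x t.
have : x != t -> `[a, b]%classic x -> A (u x) by near: x.
exact.
Unshelve. all: by end_near. Qed.

(** The mean value theorem makes u Lipschitz with constant M. *)
Lemma is_deriv_on_abs_continuous u u' (M : R) :
  (forall t, t \in `[a, b] -> is_deriv_on a b u t (u' t)) ->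
  (forall t, t \in `[a, b] -> `|u' t| <= M) -> abs_continuous a b u.
Proof.
move=> du u'M; have cu := is_deriv_on_continuous du.
have M0 : 0 <= M by rewrite (le_trans _ (u'M a _))// in_itv /= lexx ltW.
apply: (lipschitz_abs_continuous M0) => x y.
rewrite !in_itv /= => /andP[ax xb] /andP[ay yb].
rewrite le_eqVlt => /predU1P[->|xy]; first by rewrite !subrr normr0 mulr0.
have sub : `[x, y]%classic `<=` `[a, b]%classic.
  by apply: subset_itv; rewrite bnd_simp.
have [|c cxy ->] := @MVT R u u' x y xy _ (continuous_subspaceW sub cu).
  move=> z zxy; apply: (@is_deriv_on_is_derive _ a b).
    by move: zxy; rewrite !in_itv /= => /andP[/(le_lt_trans ax)-> /lt_le_trans->].
  by apply: du; apply: sub; exact: subset_itv_oo_cc.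
rewrite normrM [X in _ * X]ger0_norm ?subr_ge0 ?(ltW xy)//.
rewrite ler_wpM2r ?subr_ge0 ?(ltW xy)// u'M//.
by apply: sub; exact: subset_itv_oo_cc.
Qed.

Lemma Lfun1_integrable_segment u : u \in Lfun mu 1 ->
  mu.-integrable `[a, b] (EFin \o u).
Proof. by move=> /Lfun1_integrable; exact: integrableS. Qed.

Lemma cintegral_sub_rep g u v x : Lp_rep a b 1 g u v -> x \in `[a, b] ->
  cintegral a x g = ((\int[mu]_(t in `[a, x]) u t) +i* (\int[mu]_(t in `[a, x]) v t))%C.
Proof.
move=> [_ _ _ guv] xab.
rewrite (@cintegral_ae _ _ _ _ (fun t => (u t +i* v t)%C))//.
apply: ae_apply guv => t gt tax; apply: gt.
move: tax xab; rewrite !in_itv /= => /andP[-> tx] /andP[_ xb].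
exact: le_trans xb.
Qed.

(** The integral from t0 to x is written as a difference of integrals from a, which covers both
    sides of t0 without a sign convention. *)
Definition cprimitive (t0 : R) c g (x : R) : R[i] :=
  c + (cintegral a x g - cintegral a t0 g).

Lemma cprimitive_rep t0 c g u v x : Lp_rep a b 1 g u v -> t0 \in `[a, b] ->
  x \in `[a, b] -> cprimitive t0 c g x =
  ((complex.Re c + (\int[mu]_(t in `[a, x]) u t - \int[mu]_(t in `[a, t0]) u t)) +i*
   (complex.Im c + (\int[mu]_(t in `[a, x]) v t - \int[mu]_(t in `[a, t0]) v t)))%C.
Proof.
move=> guv tab xab; rewrite /cprimitive (cintegral_sub_rep guv xab).
by rewrite (cintegral_sub_rep guv tab); case: c.
Qed.

Lemma cprimitive_id t0 c g : cprimitive t0 c g t0 = c.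
Proof. by rewrite /cprimitive subrr addr0. Qed.

Lemma abs_continuous_eq u v : {in `[a, b], u =1 v} ->
  abs_continuous a b u -> abs_continuous a b v.
Proof.
move=> uv acu eps eps0; have [delta delta0 H] := acu _ eps0.
exists delta => // s sab sd slen; have := H s sab sd slen.
congr (_ < _); rewrite !big_seq; apply: eq_bigr => p /(allP sab)/and3P[ap pp pb].
by rewrite !uv ?in_itv /= ?ap ?pb ?andbT ?(le_trans ap)// (le_trans pp).
Qed.

Lemma abs_continuous_shift u (k : R) : abs_continuous a b u ->
  abs_continuous a b (fun x => u x + k).
Proof.
move=> acu eps eps0; have [delta delta0 H] := acu _ eps0.
exists delta => // s sab sd slen; have := H s sab sd slen.
by congr (_ < _); apply: eq_bigr => p _; rewrite opprD addrACA subrr addr0.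
Qed.

Lemma is_deriv_on_shift u (k t l : R) : is_deriv_on a b u t l ->
  is_deriv_on a b (fun x => u x + k) t l.
Proof.
rewrite /is_deriv_on; suff -> : diff_quotient (fun x => u x + k) t = diff_quotient u t by [].
by apply/funext => x; rewrite /diff_quotient opprD addrACA subrr addr0.
Qed.

Section Primitive.
Variables (t0 : R) (c : R[i]) (g : R -> R[i]).
Hypotheses (t0ab : t0 \in `[a, b]) (g1 : in_Lp a b 1 g).

Let p11 : (1 <= 1 :> \bar R)%E := lexx _.

Lemma cprimitive_abs_continuous : abs_continuous_on a b (cprimitive t0 c g).
Proof.
have [u [v guv]] := in_Lp_rep p11 g1; have [Lu Lv _ _] := guv.
apply: abs_continuous_Re_Im.
  apply: (@abs_continuous_eq (fun x => \int[mu]_(t in `[a, x]) u t +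
      (complex.Re c - \int[mu]_(t in `[a, t0]) u t))).
    by move=> x xab; rewrite (cprimitive_rep c guv t0ab xab) /=; ring.
  apply: abs_continuous_shift; apply: abs_continuous_primitive.
  exact: Lfun1_integrable_segment Lu.
apply: (@abs_continuous_eq (fun x => \int[mu]_(t in `[a, x]) v t +
    (complex.Im c - \int[mu]_(t in `[a, t0]) v t))).
  by move=> x xab; rewrite (cprimitive_rep c guv t0ab xab) /=; ring.
apply: abs_continuous_shift; apply: abs_continuous_primitive.
exact: Lfun1_integrable_segment Lv.
Qed.

Lemma cprimitive_is_deriv_ae :
  {ae mu, forall t, t \in `[a, b] -> cis_deriv (cprimitive t0 c g) t (g t)}.
Proof.
have [u [v guv]] := in_Lp_rep p11 g1; have [Lu Lv _ gE] := guv.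
have hu := primitive_is_deriv_on_ae (Lfun1_integrable_segment Lu).
have hv := primitive_is_deriv_on_ae (Lfun1_integrable_segment Lv).
apply: (ae_apply2 _ (ae_apply2 (fun x => @conj _ _) hu hv) gE).
move=> t [dut dvt] gt tab; rewrite gt//; split => /=.
  move: (is_deriv_on_shift (complex.Re c - \int[mu]_(t in `[a, t0]) u t) (dut tab)).
  apply: is_deriv_on_eq => // x xab.
  by rewrite (cprimitive_rep c guv t0ab xab) /=; ring.
move: (is_deriv_on_shift (complex.Im c - \int[mu]_(t in `[a, t0]) v t) (dvt tab)).
apply: is_deriv_on_eq => // x xab.
by rewrite (cprimitive_rep c guv t0ab xab) /=; ring.
Qed.

Lemma cprimitive_is_deriv t :
  {within `[a, b], continuous (fun x => complex.Re (g x))} ->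
  {within `[a, b], continuous (fun x => complex.Im (g x))} ->
  t \in `[a, b] -> cis_deriv (cprimitive t0 c g) t (g t).
Proof.
move=> cRe cIm tab; split.
  move: (is_deriv_on_shift (complex.Re c - complex.Re (cintegral a t0 g))
     (primitive_is_deriv_on ab cRe tab)).
  apply: is_deriv_on_eq => // x xab.
  by rewrite /cprimitive /cintegral; case: c => ? ? /=; ring.
move: (is_deriv_on_shift (complex.Im c - complex.Im (cintegral a t0 g))
   (primitive_is_deriv_on ab cIm tab)).
apply: is_deriv_on_eq => // x xab.
by rewrite /cprimitive /cintegral; case: c => ? ? /=; ring.
Qed.

End Primitive.

Lemma abs_continuous_on_is_deriv f : abs_continuous_on a b f ->
  exists g, [/\ in_Lp a b 1 g,
    forall x, x \in `[a, b] -> f x - f a = cintegral a x g &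
    {ae mu, forall t, t \in `[a, b] -> cis_deriv f t (g t)}].
Proof.
move=> /abs_continuous_on_Re_Im[acRe acIm].
have [u [iu uE du]] := abs_continuous_is_deriv_on ab acRe.
have [v [iv vE dv]] := abs_continuous_is_deriv_on ab acIm.
exists (fun x => (u x +i* v x)%C); split.
- have L w : mu.-integrable `[a, b] (EFin \o w) -> (w \_ `[a, b]) \in Lfun mu 1.
    move=> iw; apply/Lfun1_integrable.
    have -> : EFin \o (w \_ `[a, b]) = (EFin \o w) \_ `[a, b] by rewrite restrict_EFin.
    exact: (integrable_mkcond _ _).1.
  apply: (@rep_in_Lp _ a b 1 _ (u \_ `[a, b]) (v \_ `[a, b]) (lexx _)); split.
  + exact: L.
  + exact: L.
  + by move=> x xI; rewrite !patchE memNset.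
  + by apply: aeW => x xI; rewrite !patchE mem_set.
- move=> x xab; rewrite /cintegral /= -uE// -vE//.
  by case: (f x) => ? ?; case: (f a).
- by apply: ae_apply2 du dv => t ut vt tab; split; [exact: ut|exact: vt].
Qed.

(** The Radon-Nikodym density is almost everywhere a limit of difference quotients, hence equal to
    [cderive_on]; the default values of [lim] are confined to a null set. *)
Lemma abs_continuous_on_cderive f : abs_continuous_on a b f ->
  [/\ in_Lp a b 1 (cderive_on a b f),
    forall x, x \in `[a, b] -> f x - f a = cintegral a x (cderive_on a b f) &
    {ae mu, forall t, t \in `[a, b] -> cis_deriv f t (cderive_on a b f t)}].
Proof.
move=> /abs_continuous_on_is_deriv[g [g1 gE dg]].
have fg : {ae mu, forall t, t \in `[a, b] -> g t = cderive_on a b f t}.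
  by apply: ae_apply dg => t dt tab; have [_ ->] := cis_deriv_onE ab tab (dt tab).
split.
- exact: in_Lp_ae (lexx _) fg g1.
- move=> x xab; rewrite gE//; apply: cintegral_ae; apply: ae_apply fg => t gt tax.
  apply: gt; move: tax xab; rewrite !in_itv /= => /andP[-> tx] /andP[_ xb].
  exact: le_trans xb.
- by apply: ae_apply2 fg dg => t gt dt tab; rewrite -gt//; exact: dt.
Qed.

(** The factor 2 comes from estimating real and imaginary parts separately; here any constant
    serves. *)
Lemma abs_continuous_on_variation f x y : abs_continuous_on a b f ->
  x \in `[a, b] -> y \in `[a, b] ->
  cabs (f x - f y) <= 2 * fine (Lp_norm a b 1 (cderive_on a b f)).
Proof.
move=> acf xab yab; have [g1 gE _] := abs_continuous_on_cderive acf.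
have [u [v guv]] := in_Lp_rep (lexx _) g1; have [Lu Lv _ _] := guv.
wlog xy : x y xab yab / x <= y => [H|].
  by have [/H|/ltW/H] := leP x y; [|rewrite cabsB]; apply.
have -> : f x - f y = - ((\int[mu]_(t in `]x, y]) u t) +i* (\int[mu]_(t in `]x, y]) v t))%C.
  move: (xab) (yab); rewrite !in_itv /= => /andP[ax xb] /andP[ay yb].
  rewrite -(Rintegral_segmentB (Lfun1_integrable_segment Lu) ax xy yb).
  rewrite -(Rintegral_segmentB (Lfun1_integrable_segment Lv) ax xy yb).
  have := gE _ xab; have := gE _ yab.
  rewrite (cintegral_sub_rep guv xab) (cintegral_sub_rep guv yab).
  move=> /(canRL (subrK _))-> /(canRL (subrK _))->.
  by apply: complex_eq; case: (f a) => ? ? /=; ring.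
rewrite cabsN (le_trans (cabs_le _))//= mulr2n mulrDl !mul1r.
have bnd w : w \in Lfun mu 1 -> (forall t, `|w t| <= cabs (u t +i* v t)%C) ->
    `|\int[mu]_(t in `]x, y]) w t| <= fine (Lp_norm a b 1 (cderive_on a b f)).
  move=> Lw wuv; have iw := (Lfun1_integrable _ _).1 Lw.
  have iw' : mu.-integrable setT (EFin \o (fun t => `|w t|)) by exact: integrable_norm.
  rewrite (le_trans (le_normr_Rintegral _ _))//; first exact: integrableS iw.
  rewrite (Lp_norm_rep guv) Lnorm1.
  under [X in fine X]eq_integral do rewrite abse_EFin ger0_norm ?cabs_ge0//.
  have iuv := (Lfun1_integrable _ _).1 (cabs_Lfun (lexx _) Lu Lv).
  rewrite -/(Rintegral _ _ _).
  apply: (@le_trans _ _ (\int[mu]_t `|w t|)); last exact: le_Rintegral.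
  apply: fine_le.
  - by apply: integrable_fin_num => //; exact: integrableS iw'.
  - exact: integrable_fin_num.
  - by apply: ge0_subset_integral => //; exact: measurable_int iw'.
by apply: lerD; apply: bnd => // t;
  [exact: (Re_le_cabs (u t +i* v t)%C)|exact: (Im_le_cabs (u t +i* v t)%C)].
Qed.

End ComplexPrimitive.

(** * Sobolev functions of one variable *)

Section ScalarSobolev.
Context {R : realType}.
Variables (a b t0 : R) (p : \bar R).
Hypotheses (ab : a < b) (t0ab : t0 \in `[a, b]) (p1 : (1 <= p)%E).
Implicit Types (f g h : R -> R[i]) (c : R[i]) (k s : nat).
Local Notation mu := (@lebesgue_measure R).
Local Notation cis_deriv := (cis_deriv_on a b).
Local Notation D := (cderiven_on a b).
Local Notation W k := (in_sobolev a b k p).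
Local Notation N := (Lp_norm a b).

Lemma cis_deriv_on_eq f g t l : {in `[a, b], f =1 g} -> t \in `[a, b] ->
  cis_deriv f t l -> cis_deriv g t l.
Proof.
move=> fg tab [f1 f2]; split.
  by apply: is_deriv_on_eq f1 => // x xab; rewrite fg.
by apply: is_deriv_on_eq f2 => // x xab; rewrite fg.
Qed.

Lemma abs_continuous_on_eq f g : {in `[a, b], f =1 g} ->
  abs_continuous_on a b f -> abs_continuous_on a b g.
Proof.
move=> fg acf eps eps0; have [delta delta0 H] := acf _ eps0.
exists delta => // n u v uv disj len; have := H n u v uv disj len.
congr (_ < _); apply: eq_bigr => i _; have [h1 [h2 h3]] := uv i.
by rewrite !fg ?in_itv /= ?h1 ?h3 ?andbT ?(le_trans h1)// (le_trans h2).
Qed.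

Lemma abs_continuous_on_lin c f g : abs_continuous_on a b f ->
  abs_continuous_on a b g -> abs_continuous_on a b (fun x => c * f x + g x).
Proof.
move=> acf acg eps eps0; have c1 : 0 < cabs c + 1 by rewrite ltr_wpDl ?cabs_ge0.
have e1 : 0 < eps / 2 / (cabs c + 1) by rewrite !divr_gt0.
have e2 : 0 < eps / 2 by rewrite divr_gt0.
have [d1 d10 H1] := acf _ e1; have [d2 d20 H2] := acg _ e2.
exists (Num.min d1 d2); first by rewrite lt_min d10.
move=> n u v uv disj; rewrite lt_min => /andP[l1 l2].
have := H1 n u v uv disj l1; rewrite ltr_pdivlMr// => lt1.
rewrite [eps]splitr; apply: le_lt_trans (ltrD lt1 (H2 n u v uv disj l2)).
rewrite mulr_suml -big_split /=; apply: ler_sum => i _.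
have -> : c * f (v i) + g (v i) - (c * f (u i) + g (u i)) =
    c * (f (v i) - f (u i)) + (g (v i) - g (u i)) by ring.
rewrite (le_trans (cabsD _ _))// lerD2r cabsM mulrC ler_wpM2l ?cabs_ge0//.
by rewrite lerDl.
Qed.

Lemma abs_continuous_on_bounded f : abs_continuous_on a b f ->
  [/\ {within `[a, b], continuous (fun x => complex.Re (f x))},
      {within `[a, b], continuous (fun x => complex.Im (f x))} &
      exists2 M, 0 <= M & forall x, x \in `[a, b] -> cabs (f x) <= M].
Proof.
move=> /abs_continuous_on_Re_Im[/(abs_continuous_within ab) cRe
  /(abs_continuous_within ab) cIm]; split => //.
have [M1 M10 fM1] := continuous_segment_bounded ab cRe.
have [M2 M20 fM2] := continuous_segment_bounded ab cIm.
exists (M1 + M2); first by rewrite addr_ge0.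
by move=> x xab; rewrite (le_trans (cabs_le _))// lerD ?fM1 ?fM2.
Qed.

Lemma abs_continuous_on_in_Lp f (M : R) : abs_continuous_on a b f -> 0 <= M ->
  (forall x, x \in `[a, b] -> cabs (f x) <= M) ->
  in_Lp a b p f /\ (N p f <= (M * segment_norm a b p)%:E)%E.
Proof.
move=> /abs_continuous_on_bounded[cRe cIm _] M0 fM.
by apply: bounded_in_Lp => //; exact: subspace_continuous_measurable_fun.
Qed.

Lemma cis_deriv_on_abs_continuous f f' :
  (forall t, t \in `[a, b] -> cis_deriv f t (f' t)) -> abs_continuous_on a b f' ->
  abs_continuous_on a b f.
Proof.
move=> df /abs_continuous_on_bounded[_ _ [M M0 f'M]].
apply: abs_continuous_Re_Im.
  apply: (@is_deriv_on_abs_continuous _ _ _ ab _ (fun x => complex.Re (f' x)) M).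
    by move=> t /df[].
  by move=> t /f'M; exact: le_trans (Re_le_cabs _).
apply: (@is_deriv_on_abs_continuous _ _ _ ab _ (fun x => complex.Im (f' x)) M).
  by move=> t /df[].
by move=> t /f'M; exact: le_trans (Im_le_cabs _).
Qed.

Section Derivatives.
Variable k : nat.

(** By definition [cvg] is convergence to [lim], so derivability is already the relational
    statement. *)
Lemma sobolev_is_deriv f s t : W k.+1 f -> (s < k)%N -> t \in `[a, b] ->
  cis_deriv (D s f) t (D s.+1 f t).
Proof. by move=> [df _ _] sk tab; exact: (df s sk t tab). Qed.

(** Descending induction from s = k: the derivative of order s + 1 is absolutely continuous, hence
    bounded, so the one of order s is Lipschitz. *)
Lemma sobolev_abs_continuous f s : W k.+1 f -> (s <= k)%N ->
  abs_continuous_on a b (D s f).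
Proof.
move=> Wf sk; rewrite -(subKn sk); elim: (k - s)%N (leq_subr s k) => [_|j ih jk].
  by rewrite subn0; case: Wf.
have kj : (k - j.+1 < k)%N by rewrite ltn_subrL (leq_ltn_trans _ jk).
apply: (@cis_deriv_on_abs_continuous _ (D (k - j) f)); last by apply: ih; exact: ltnW.
by move=> t tab; have := sobolev_is_deriv Wf kj tab; rewrite -subSn.
Qed.

Lemma sobolev_is_deriv_ae f s : W k.+1 f -> (s <= k)%N ->
  {ae mu, forall t, t \in `[a, b] -> cis_deriv (D s f) t (D s.+1 f t)}.
Proof.
by move=> Wf sk; have [] := abs_continuous_on_cderive ab (sobolev_abs_continuous Wf sk).
Qed.

Lemma sobolev_in_Lp f s : W k.+1 f -> (s <= k.+1)%N -> in_Lp a b p (D s f).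
Proof.
move=> Wf; rewrite leq_eqVlt => /predU1P[->|]; first by case: Wf.
rewrite ltnS => sk; have acf := sobolev_abs_continuous Wf sk.
have [_ _ [M M0 fM]] := abs_continuous_on_bounded acf.
by have [] := abs_continuous_on_in_Lp acf M0 fM.
Qed.

Lemma sobolev_lin_deriv c f g s t : W k.+1 f -> W k.+1 g -> (s <= k)%N ->
  t \in `[a, b] -> D s (fun x => c * f x + g x) t = c * D s f t + D s g t.
Proof.
move=> Wf Wg; elim: s t => [//|s ih] t sk tab.
have ih' : {in `[a, b], (fun x => c * D s f x + D s g x) =1
    D s (fun x => c * f x + g x)}.
  by move=> x xab; rewrite ih// ltnW.
have := cis_deriv_on_lin c (sobolev_is_deriv Wf sk tab) (sobolev_is_deriv Wg sk tab).
by move=> /(cis_deriv_on_eq ih' tab) /(cis_deriv_onE ab tab)[_ <-].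
Qed.

(** At the top order the limits may fail to exist, and the default value of [lim] need not be
    linear; hence the exceptional null set. *)
Lemma sobolev_lin_deriv_ae c f g : W k.+1 f -> W k.+1 g ->
  {ae mu, forall t, t \in `[a, b] ->
    c * D k.+1 f t + D k.+1 g t = D k.+1 (fun x => c * f x + g x) t}.
Proof.
move=> Wf Wg; have eq : {in `[a, b], (fun x => c * D k f x + D k g x) =1
    D k (fun x => c * f x + g x)}.
  by move=> x xab; rewrite sobolev_lin_deriv.
apply: ae_apply2 (sobolev_is_deriv_ae Wf (leqnn k)) (sobolev_is_deriv_ae Wg (leqnn k)).
move=> t df dg tab; have := cis_deriv_on_lin c (df tab) (dg tab).
by move=> /(cis_deriv_on_eq eq tab) /(cis_deriv_onE ab tab)[_ <-].
Qed.

Lemma sobolev_lin c f g : W k.+1 f -> W k.+1 g -> W k.+1 (fun x => c * f x + g x).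
Proof.
move=> Wf Wg; split.
- move=> s sk t tab.
  have eq : {in `[a, b], (fun x => c * D s f x + D s g x) =1
      D s (fun x => c * f x + g x)}.
    by move=> x xab; rewrite sobolev_lin_deriv// ltnW.
  have := cis_deriv_on_lin c (sobolev_is_deriv Wf sk tab) (sobolev_is_deriv Wg sk tab).
  by move=> /(cis_deriv_on_eq eq tab) /(cis_deriv_onE ab tab)[].
- apply: (@abs_continuous_on_eq (fun x => c * D k f x + D k g x)).
    by move=> x xab; rewrite sobolev_lin_deriv.
  by apply: abs_continuous_on_lin; exact: sobolev_abs_continuous.
- apply: (in_Lp_ae p1 (sobolev_lin_deriv_ae c Wf Wg)).
  by apply: in_Lp_lin => //; exact: sobolev_in_Lp.
Qed.

Lemma sobolev_norm_fin f : W k.+1 f -> sobolev_norm a b k.+1 p f \is a fin_num.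
Proof.
move=> Wf; rewrite /sobolev_norm; apply/sum_fin_numP => s _ _.
by apply: Lp_norm_fin; apply: sobolev_in_Lp => //; rewrite -ltnS.
Qed.

Lemma sobolev_norm_ge0 f : (0 <= sobolev_norm a b k.+1 p f)%E.
Proof. by apply: sume_ge0 => s _; exact: Lp_norm_ge0. Qed.

Lemma Lp_norm_le_sobolev_norm f s : (s <= k.+1)%N ->
  (N p (D s f) <= sobolev_norm a b k.+1 p f)%E.
Proof.
move=> sk; rewrite /sobolev_norm (bigD1 (Ordinal (sk : (s < k.+2)%N)))//=.
by rewrite leeDl// sume_ge0// => i _; exact: Lp_norm_ge0.
Qed.

Let C1 := segment_norm a b (hoelder_conjugate p).

Lemma sobolev_variation f s x y : W k.+1 f -> (s <= k)%N ->
  x \in `[a, b] -> y \in `[a, b] ->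
  cabs (D s f x - D s f y) <= 2 * C1 * fine (N p (D s.+1 f)).
Proof.
move=> Wf sk xab yab; have acf := sobolev_abs_continuous Wf sk.
rewrite (le_trans (abs_continuous_on_variation ab acf xab yab))//.
rewrite -mulrA ler_wpM2l//.
have fp : in_Lp a b p (D s.+1 f) by apply: sobolev_in_Lp.
have [f1 N1] := in_Lp_in_L1 p1 fp.
rewrite -lee_fin fineK ?Lp_norm_fin// (le_trans N1)//.
by rewrite EFinM (fineK (Lp_norm_fin fp)).
Qed.

Lemma sobolev_point_bound : exists2 C : R, 0 <= C & forall f s, W k.+1 f ->
  (s <= k)%N -> cabs (D s f t0) <= C * fine (sobolev_norm a b k.+1 p f).
Proof.
have C10 : 0 <= C1 by exact: segment_norm_ge0.
exists (C1 / (b - a) + 2 * C1).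
  by rewrite addr_ge0 ?mulr_ge0// invr_ge0 subr_ge0 ltW.
move=> f s Wf sk; have acf := sobolev_abs_continuous Wf sk.
set n := fine (sobolev_norm a b k.+1 p f).
have nE : n%:E = sobolev_norm a b k.+1 p f by rewrite fineK// sobolev_norm_fin.
have Nn j : (j <= k.+1)%N -> fine (N p (D j f)) <= n.
  move=> jk; rewrite -lee_fin nE fineK ?Lp_norm_le_sobolev_norm//.
  by apply: Lp_norm_fin; exact: sobolev_in_Lp.
(* By [sobolev_variation], m is a lower bound of the modulus on all of [a, b]. So m (b - a) is at
   most the L_1 norm, which is at most C1 n, and solving for the value at t0 gives the constant. *)
pose m := cabs (D s f t0) - 2 * C1 * n.
have mle x : x \in `[a, b] -> m <= cabs (D s f x).
  move=> xab; rewrite lerBlDr.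
  have : cabs (D s f t0) <= cabs (D s f x) + cabs (D s f t0 - D s f x).
    by rewrite (le_trans _ (cabsD _ _))// addrC subrK.
  move=> /le_trans; apply; rewrite lerD2l.
  rewrite (le_trans (sobolev_variation Wf sk t0ab xab))// ler_wpM2l ?mulr_ge0//.
  by apply: Nn; rewrite ltnS.
have fp : in_Lp a b p (D s f) by apply: sobolev_in_Lp => //; rewrite ltnW.
have [f1 N1] := in_Lp_in_L1 p1 fp.
have : m * (b - a) <= C1 * n.
  rewrite -lee_fin; apply: (@le_trans _ _ (N 1 (D s f))).
    (* The comparison of integrals is for nonnegative integrands; for m < 0 the claim is trivial. *)
    have [m0|m0] := leP 0 m; last first.
      apply: le_trans (Lp_norm_ge0 _ _ _ _).
      by rewrite lee_fin mulr_le0_ge0 ?(ltW m0)// subr_ge0 ltW.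
    have [u [v fuv]] := in_Lp_rep (lexx _) f1; have [Lu Lv uv0 fE] := fuv.
    rewrite (Lp_norm_rep fuv) Lnorm1.
    have iuv := (Lfun1_integrable _ _).1 (cabs_Lfun (lexx _) Lu Lv).
    have -> : (m * (b - a))%:E = (\int[mu]_(x in `[a, b]) m%:E)%E.
      by rewrite integral_cst//= lebesgue_measure_itv /= lte_fin ab -EFinD EFinM.
    apply: (@le_trans _ _ (\int[mu]_(x in `[a, b]) `|(cabs (u x +i* v x)%C)%:E|)%E).
      apply: ae_ge0_le_integral => //.
      - by apply: measurable_funTS; exact: measurable_int (integrable_abse iuv).
      - apply: ae_apply fE => x fx xab.
        by rewrite abse_EFin lee_fin ger0_norm ?cabs_ge0// -fx// mle.
    apply: ge0_subset_integral => //.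
    exact: measurable_int (integrable_abse iuv).
  apply: (le_trans N1); rewrite EFinM; apply: lee_wpmul2l; first by rewrite lee_fin.
  by rewrite nE Lp_norm_le_sobolev_norm// ltnW.
have ba : 0 < b - a by rewrite subr_gt0.
rewrite -ler_pdivlMr// /m lerBlDr => /le_trans; apply.
by rewrite le_eqVlt; apply/orP; left; apply/eqP; ring.
Qed.

(** A derivative vanishing at t0 is bounded by 2 C1 times the norm of the next one, and
    [segment_norm] turns this supremum bound into an L_p bound. Each order costs one factor C, hence
    the power k + 1 - s. *)
Lemma sobolev_norm_zero_data : exists2 C : R, 0 <= C & forall f, W k.+1 f ->
  (forall s, (s <= k)%N -> D s f t0 = 0) ->
  (sobolev_norm a b k.+1 p f <= C%:E * N p (D k.+1 f))%E.
Proof.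
pose C := 2 * C1 * segment_norm a b p.
have C0 : 0 <= C by rewrite !mulr_ge0 ?segment_norm_ge0.
exists (\sum_(s < k.+2) C ^+ (k.+1 - s)); first by apply: sumr_ge0 => s _; rewrite exprn_ge0.
move=> f Wf f0.
have Nfin s : (s <= k.+1)%N -> N p (D s f) \is a fin_num.
  by move=> sk; apply: Lp_norm_fin; exact: sobolev_in_Lp.
have step s : (s <= k)%N -> fine (N p (D s f)) <= C * fine (N p (D s.+1 f)).
  move=> sk; have acf := sobolev_abs_continuous Wf sk.
  have M0 : 0 <= 2 * C1 * fine (N p (D s.+1 f)).
    by rewrite !mulr_ge0 ?segment_norm_ge0 ?fine_ge0 ?Lp_norm_ge0.
  have fM x : x \in `[a, b] -> cabs (D s f x) <= 2 * C1 * fine (N p (D s.+1 f)).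
    by move=> xab; have := sobolev_variation Wf sk xab t0ab; rewrite f0// subr0.
  have [_] := abs_continuous_on_in_Lp acf M0 fM.
  by rewrite -{1}(fineK (Nfin s (leqW sk))) lee_fin mulrAC.
have bnd s : (s <= k.+1)%N ->
    fine (N p (D s f)) <= C ^+ (k.+1 - s) * fine (N p (D k.+1 f)).
  move=> sk; rewrite -{1}(subKn sk).
  elim: (k.+1 - s)%N (leq_subr s k.+1) => [_|j ih jk].
    by rewrite subn0 expr0 mul1r.
  have kj : (k.+1 - j.+1 <= k)%N by rewrite leq_subLR addSn ltnS leq_addl.
  rewrite (le_trans (step _ kj))// exprS -mulrA ler_wpM2l//.
  by rewrite -subSn// subSS; apply: ih; exact: ltnW.
rewrite /sobolev_norm -(fineK (Nfin k.+1 _))// -EFinM mulr_suml -sumEFin.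
apply: lee_sum => s _; have sk : (s <= k.+1)%N by rewrite -ltnS.
by rewrite -(fineK (Nfin s sk)) lee_fin bnd.
Qed.

End Derivatives.
End ScalarSobolev.

(** * Sobolev functions with prescribed derivatives *)

Section PrescribedData.
Context {R : realType}.
Variables (a b t0 : R) (p : \bar R).
Hypotheses (ab : a < b) (t0ab : t0 \in `[a, b]) (p1 : (1 <= p)%E).
Implicit Types (f g : R -> R[i]) (c : nat -> R[i]) (k s : nat).
Local Notation mu := (@lebesgue_measure R).
Local Notation cis_deriv := (cis_deriv_on a b).
Local Notation D := (cderiven_on a b).
Local Notation W k := (in_sobolev a b k p).

(* The function whose derivatives at t0 are c 0, ..., c (k - 1) and whose k-th
   derivative is g. *)
Fixpoint sobolev_primitive k c g : R -> R[i] :=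
  if k is k'.+1 then
    cprimitive a t0 (c 0%N) (sobolev_primitive k' (fun i => c i.+1) g)
  else g.

Lemma sobolev_primitive_in_L1 k c g : in_Lp a b 1 g ->
  in_Lp a b 1 (sobolev_primitive k c g) /\
  abs_continuous_on a b (sobolev_primitive k.+1 c g).
Proof.
move=> g1; elim: k c => [|k ih] c.
  by split => //; exact: cprimitive_abs_continuous.
have [_ acT] := ih c; have [_ _ [M M0 TM]] := abs_continuous_on_bounded ab acT.
have [T1 _] := abs_continuous_on_in_Lp ab (lexx _) acT M0 TM.
split => //; apply: cprimitive_abs_continuous => //.
have [_ acT'] := ih (fun i => c i.+1).
have [_ _ [M' M0' TM']] := abs_continuous_on_bounded ab acT'.
by have [] := abs_continuous_on_in_Lp ab (lexx _) acT' M0' TM'.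
Qed.

(** The order s + (j + 1) leaves at least one integration after s derivatives. Each differentiation
    thus undoes a primitive of a continuous function and is valid at every point, endpoints
    included. *)
Lemma sobolev_primitive_deriv g s j c t : in_Lp a b 1 g -> t \in `[a, b] ->
  D s (sobolev_primitive (s + j.+1) c g) t =
  sobolev_primitive j.+1 (fun i => c (s + i)%N) g t.
Proof.
move=> g1; elim: s j t => [//|s ih] j t tab.
have eq : {in `[a, b], sobolev_primitive j.+2 (fun i => c (s + i)%N) g =1
    D s (sobolev_primitive (s.+1 + j.+1) c g)}.
  by move=> x xab; rewrite addSnnS ih.
have [_ acT] := sobolev_primitive_in_L1 j (fun i => c (s + i.+1)%N) g1.
have [cRe cIm _] := abs_continuous_on_bounded ab acT.
have := cprimitive_is_deriv ab t0 (c (s + 0)%N) cRe cIm tab.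
move=> /(cis_deriv_on_eq eq tab) /(cis_deriv_onE ab tab)[_].
rewrite -[D s.+1 _ t]/(cderive_on a b (D s _) t) => ->.
by congr (sobolev_primitive _ _ _ _); apply/funext => i; rewrite addnS.
Qed.

Lemma sobolev_primitive_deriv_ae g k c : in_Lp a b 1 g ->
  {ae mu, forall t, t \in `[a, b] ->
    g t = D k.+1 (sobolev_primitive k.+1 c g) t}.
Proof.
move=> g1; have eq : {in `[a, b], sobolev_primitive 1 (fun i => c (k + i)%N) g =1
    D k (sobolev_primitive k.+1 c g)}.
  by move=> x xab; rewrite -[k.+1]addn1 sobolev_primitive_deriv.
apply: ae_apply (cprimitive_is_deriv_ae (c (k + 0)%N) t0ab g1) => t dt tab.
by have := dt tab => /(cis_deriv_on_eq eq tab) /(cis_deriv_onE ab tab)[_ <-].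
Qed.

Lemma sobolev_primitive_initial g k c s : in_Lp a b 1 g -> (s <= k)%N ->
  D s (sobolev_primitive k.+1 c g) t0 = c s.
Proof.
move=> g1 sk; rewrite -(subnKC sk) -addnS sobolev_primitive_deriv//=.
by rewrite cprimitive_id addn0.
Qed.

Lemma sobolev_primitive_sobolev g k c : in_Lp a b p g ->
  W k.+1 (sobolev_primitive k.+1 c g).
Proof.
move=> gp; have [g1 _] := in_Lp_in_L1 p1 gp; split.
- move=> s sk t tab.
  have [j kE] : exists j, k = (s + j.+1)%N.
    by exists (k - s.+1)%N; rewrite -subSn// subSS subnKC// ltnW.
  have eq : {in `[a, b], sobolev_primitive j.+2 (fun i => c (s + i)%N) g =1
      D s (sobolev_primitive k.+1 c g)}.
    by move=> x xab; rewrite kE -addnS sobolev_primitive_deriv.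
  have [_ acT] := sobolev_primitive_in_L1 j (fun i => c (s + i.+1)%N) g1.
  have [cRe cIm _] := abs_continuous_on_bounded ab acT.
  have := cprimitive_is_deriv ab t0 (c (s + 0)%N) cRe cIm tab.
  by move=> /(cis_deriv_on_eq eq tab) /(cis_deriv_onE ab tab)[].
- apply: (@abs_continuous_on_eq _ _ _ (sobolev_primitive 1 (fun i => c (k + i)%N) g)).
    by move=> x xab; rewrite -[k.+1]addn1 sobolev_primitive_deriv.
  exact: (sobolev_primitive_in_L1 0 _ g1).2.
- exact: in_Lp_ae p1 (sobolev_primitive_deriv_ae k c g1) gp.
Qed.

End PrescribedData.

(** * The dual of complex Lp *)

Section ComplexDual.
Context {R : realType}.
Variables (a b : R).
Implicit Types (f g : R -> R[i]) (u v : R -> R) (p : \bar R).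
Local Notation mu := (@lebesgue_measure R).
Local Notation N := (Lp_norm a b).

Lemma in_Lp0 p : (1 <= p)%E -> in_Lp a b p (fun=> 0).
Proof.
move=> p1; apply: (@rep_in_Lp _ _ _ _ _ (cst 0) (cst 0) p1); split.
- exact: (Lfun_submod_closed mu p1).1.
- exact: (Lfun_submod_closed mu p1).1.
- by [].
- exact: aeW.
Qed.

Lemma Lp_norm0 p f : (1 <= p)%E -> {ae mu, forall x, x \in `[a, b] -> f x = 0} ->
  N p f = 0%E.
Proof.
move=> p1 f0; rewrite (Lp_norm_ae p f0) /Lp_norm -(@Lnorm0 _ _ _ mu p).
  congr Lnorm; apply/funext => x; rewrite patchE; case: ifPn => // _.
  by rewrite cabs0.
by rewrite gt_eqF// (lt_le_trans _ p1).
Qed.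

Lemma measurable_indic_in_Lp p (E : set R) : (1 <= p)%E -> measurable E ->
  in_Lp a b p (fun x => (\1_E x +i* 0)%C).
Proof.
move=> p1 mE.
have mRe : measurable_fun `[a, b] (fun x => complex.Re (\1_E x +i* 0 : R[i])%C).
  by apply: measurable_funTS; exact: measurable_indic.
have mIm : measurable_fun `[a, b] (fun x => complex.Im (\1_E x +i* 0 : R[i])%C).
  exact: measurable_cst.
have le1 x : x \in `[a, b] -> cabs (\1_E x +i* 0 : R[i])%C <= 1.
  move=> _; rewrite cabsE /= expr0n /= addr0 sqrtr_sqr indicE.
  by case: (_ \in _); rewrite ?normr1 ?normr0.
exact: (bounded_in_Lp p1 ler01 mRe mIm le1).1.
Qed.

(** The test functions are real, so the condition splits into u and v, each with integral 0 over
    every measurable set. *)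
Lemma cintegral_annihilator f : in_Lp a b 1 f ->
  (forall E, measurable E -> cintegral a b (fun x => f x * (\1_E x +i* 0)%C) = 0) ->
  {ae mu, forall x, x \in `[a, b] -> f x = 0}.
Proof.
move=> /(in_Lp_rep (lexx _))[u [v fuv]] f0; have [Lu Lv uv0 fE] := fuv.
move: (Lu) (Lv) => /Lfun1_integrable iu /Lfun1_integrable iv.
have rep E : measurable E -> Lp_rep a b 1 (fun x => f x * (\1_E x +i* 0)%C)
    (u \_ E) (v \_ E).
  move=> mE; have L w : w \in Lfun mu 1 -> w \_ E \in Lfun mu 1.
    move=> Lw; apply: (@le_Lfun _ _ _ _ (lexx _) _ Lw).
      apply: (measurable_restrictT w mE).1.
      by apply: measurable_funTS; exact: Lfun_measurable Lw.
    by move=> x; rewrite patchE; case: ifPn; rewrite ?normr0.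
  split; [exact: L|exact: L| |].
    by move=> x /uv0[u0 v0]; rewrite !patchE u0 v0; case: ifPn.
  apply: ae_apply fE => x fx xab; rewrite fx// !patchE indicE.
  by apply: complex_eq; rewrite ?cReM ?cImM /=; case: ifPn => _;
    rewrite ?mulr1 ?mulr0 ?subr0 ?add0r.
have zero w : mu.-integrable setT (EFin \o w) ->
    (forall E, measurable E -> \int[mu]_x (w \_ E) x = 0) ->
    {ae mu, forall x, w x = 0}.
  move=> iw w0.
  have := @integral_ae_eq _ _ _ mu setT measurableT (cst 0%E) (EFin \o w) iw.
  move=> /(_ (measurable_cst _)) H.
  apply: ae_apply (H _) => [x /(_ Logic.I)[]//|E _ mE].
  rewrite integral0 -(fineK (integrable_fin_num mE _)); last exact: integrableS iw.
  by congr EFin; rewrite -/(Rintegral _ _ _) Rintegral_mkcond w0.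
have u0 : {ae mu, forall x, u x = 0}.
  by apply: zero => // E mE; have := f0 E mE; rewrite (cintegral_rep (rep E mE)) => -[].
have v0 : {ae mu, forall x, v x = 0}.
  by apply: zero => // E mE; have := f0 E mE; rewrite (cintegral_rep (rep E mE)) => -[].
apply: (ae_apply2 _ (ae_apply2 (fun x => @conj _ _) u0 v0) fE) => x [ux vx] fx xab.
by rewrite fx// ux vx.
Qed.

(** On real functions, the real and imaginary parts of L are real functionals, with densities phi1
    and phi2. Complex linearity gives L(u + iv) = L u + i L v, so phi1 + i phi2 represents L, with
    no conjugation. *)
Lemma Lp_dual_representation (p : R) (L : (R -> R[i]) -> R[i]) (M : R) :
  1 <= p -> 0 <= M ->
  (forall c f g, in_Lp a b p%:E f -> in_Lp a b p%:E g ->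
    L (fun x => c * f x + g x) = c * L f + L g) ->
  (forall f, in_Lp a b p%:E f -> cabs (L f) <= M * fine (N p%:E f)) ->
  exists Phi : R -> R[i], in_Lp a b (hoelder_conjugate p%:E) Phi /\
    forall f, in_Lp a b p%:E f -> L f = cintegral a b (fun x => Phi x * f x).
Proof.
move=> p1 M0 Llin LM; have p1E : (1 <= p%:E)%E by rewrite lee_fin.
have p0 : 0 < p by rewrite (lt_le_trans _ p1).
pose I := `[a, b]%classic.
have mI : measurable I by exact: measurable_itv.
have muI : (mu I < +oo)%E.
  by rewrite lebesgue_measure_itv /=; case: ifPn => // _; rewrite -EFinB ltry.
pose C u : R -> R[i] := fun x => (u x +i* 0)%C.
have Crep u : Lp_supported mu I p u -> Lp_rep a b p%:E (C u) u (cst 0).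
  move=> [Lu u0]; split => //; first exact: (Lfun_submod_closed mu p1E).1.
    by move=> x /u0.
  exact: aeW.
have CL u : Lp_supported mu I p u -> in_Lp a b p%:E (C u).
  by move=> /Crep; exact: rep_in_Lp.
have lin (P : R[i] -> R) : (forall z w, P (z + w) = P z + P w) ->
    (forall (k : R) z, P ((k +i* 0)%C * z) = k * P z) ->
    forall k u v, Lp_supported mu I p u -> Lp_supported mu I p v ->
    P (L (C (fun x => k * u x + v x))) = k * P (L (C u)) + P (L (C v)).
  move=> PD PM k u v Su Sv; rewrite -PM -PD -Llin; [|exact: CL..].
  congr (P (L _)); apply/funext => x; rewrite /C.
  by apply: complex_eq; rewrite ?cReD ?cImD ?cReM ?cImM /=; ring.
have bnd (P : R[i] -> R) : (forall z, `|P z| <= cabs z) ->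
    forall u, Lp_supported mu I p u ->
    `|P (L (C u))| `^ p <= M `^ p * \int[mu]_x (`|u x| `^ p).
  move=> Pc u Su; have I0 : 0 <= \int[mu]_x (`|u x| `^ p).
    by apply: Rintegral_ge0 => x _; exact: powR_ge0.
  have -> : \int[mu]_x (`|u x| `^ p) = fine (N p%:E (C u)) `^ p.
    rewrite (Lp_norm_rep (Crep _ Su)).
    have -> : (fun x => (cabs (u x +i* cst 0 x)%C)%:E) = EFin \o (fun x => `|u x|).
      by apply/funext => x; rewrite cabsE /= expr0n /= addr0 sqrtr_sqr.
    have ip := Lp_supported_integrable p1 Su.
    rewrite unlock /=; under [X in fine (X `^ _)]eq_integral do rewrite normr_id.
    rewrite -(fineK (integrable_fin_num measurableT ip)) /=.
    by rewrite -powRrM mulVf ?gt_eqF// powRr1.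
  rewrite -powRM ?fine_ge0 ?Lp_norm_ge0// ge0_ler_powR ?nnegrE ?(ltW p0)//.
    by rewrite mulr_ge0// fine_ge0// Lp_norm_ge0.
  by rewrite (le_trans (Pc _))// LM//; exact: CL.
have ReZ (k : R) (z : R[i]) : complex.Re ((k +i* 0)%C * z) = k * complex.Re z.
  by rewrite cReM /= mul0r subr0.
have ImZ (k : R) (z : R[i]) : complex.Im ((k +i* 0)%C * z) = k * complex.Im z.
  by rewrite cImM /= mul0r addr0.
have [phi1 [Lphi1 phi10 E1]] := @Lp_functional_representation _ _ R mu I p mI muI p1
  (fun u => complex.Re (L (C u))) M
  (lin _ (@cReD R) ReZ) M0 (bnd _ (@Re_le_cabs R)).
have [phi2 [Lphi2 phi20 E2]] := @Lp_functional_representation _ _ R mu I p mI muI p1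
  (fun u => complex.Im (L (C u))) M
  (lin _ (@cImD R) ImZ) M0 (bnd _ (@Im_le_cabs R)).
pose Phi x := (phi1 x +i* phi2 x)%C.
have Prep : Lp_rep a b (hoelder_conjugate p%:E) Phi phi1 phi2.
  split => //; last exact: aeW.
  by move=> x xI; rewrite phi10// phi20.
exists Phi; split; first exact: rep_in_Lp (hoelder_conj_ge1 p1E) Prep.
move=> f fp; have [u [v fuv]] := in_Lp_rep p1E fp; have [Lu Lv uv0 fE] := fuv.
have Su : Lp_supported mu I p u by split => // x /uv0[].
have Sv : Lp_supported mu I p v by split => // x /uv0[].
(* The two arguments agree only almost everywhere; the bound [LM] turns L_p distance 0 into equality
   of the values of L. *)
have Lf : L f = 'i%C * L (C v) + L (C u).
  rewrite -Llin; [|exact: CL..].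
  have f'p : in_Lp a b p%:E (fun x => 'i%C * C v x + C u x).
    by apply: in_Lp_lin => //; exact: CL.
  have := LM _ (in_Lp_lin (-1) p1E f'p fp).
  rewrite [X in fine X](Lp_norm0 p1E) ?mulr0; last first.
    apply: ae_apply fE => x fx xab; rewrite fx// /C.
    by apply: complex_eq; rewrite ?cReD ?cImD ?cReM ?cImM /=; ring.
  rewrite Llin// mulN1r addrC => le0; apply/eqP; rewrite -subr_eq0; apply/eqP.
  by apply: cabs0_eq; apply/eqP; rewrite eq_le le0 cabs_ge0.
have e1 w : Lp_supported mu I p w ->
    L (C w) = ((\int[mu]_x (phi1 x * w x)) +i* (\int[mu]_x (phi2 x * w x)))%C.
  by move=> Sw; apply: complex_eq; rewrite /= ?E1 ?E2.
have prod w w' : w \in Lfun mu p%:E -> w' \in Lfun mu (hoelder_conjugate p%:E) ->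
    (fun x => w' x * w x) \in Lfun mu 1.
  move=> Lw Lw'; apply/Lfun1_integrable.
  apply: eq_integrable (Lfun_conjugate_integrable p1E Lw Lw') => //.
  by move=> x _; rewrite /= mulrC.
have rep : Lp_rep a b 1 (fun x => Phi x * f x)
    (fun x => -1 * (phi2 x * v x) + phi1 x * u x)
    (fun x => 1 * (phi2 x * u x) + phi1 x * v x).
  split.
  - by apply: Lfun_lin => //; exact: prod.
  - by apply: Lfun_lin => //; exact: prod.
  - by move=> x xI /=; have [-> ->] := uv0 x xI; rewrite !mulr0 !addr0.
  - apply: ae_apply fE => x fx xI; rewrite fx//.
    by apply: complex_eq; rewrite ?cReM ?cImM /=; ring.
rewrite Lf !e1// (cintegral_rep rep).
have iprod w w' : w \in Lfun mu p%:E -> w' \in Lfun mu (hoelder_conjugate p%:E) ->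
    mu.-integrable setT (EFin \o (fun x => w' x * w x)).
  by move=> Lw Lw'; apply/Lfun1_integrable; exact: prod.
have lin2 (k : R) w1 w2 : mu.-integrable setT (EFin \o w1) ->
    mu.-integrable setT (EFin \o w2) ->
    \int[mu]_x (k * w1 x + w2 x) = k * \int[mu]_x w1 x + \int[mu]_x w2 x.
  move=> i1 i2; rewrite RintegralD//; first by rewrite RintegralZl.
  by rewrite /comp; under eq_fun do rewrite EFinM; exact: integrableZl.
rewrite !lin2; [|exact: iprod..].
by apply: complex_eq; rewrite ?cReD ?cImD ?cReM ?cImM /=; ring.
Qed.

End ComplexDual.

(** * Operators on vector-valued Sobolev functions *)

Section CanonicalOperator.
Context {R : realType}.
Variables (a b t0 : R) (p : \bar R) (k m q : nat).
Hypotheses (ab : a < b) (t0ab : t0 \in `[a, b]) (p1 : (1 <= p)%E).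
Implicit Types (y z : R -> 'cV[R[i]]_m) (c : R[i]).
Implicit Types (alpha : 'I_k.+1 -> 'M[R[i]]_(q, m)) (Phi : R -> 'M[R[i]]_(q, m)).
Local Notation mu := (@lebesgue_measure R).
Local Notation D := (cderiven_on a b).
Local Notation W := (@in_sobolev_vec R m a b k.+1 p).
Local Notation W_norm := (@sobolev_norm_vec R m a b k.+1 p).
Local Notation N := (Lp_norm a b).
Local Notation p' := (hoelder_conjugate p).
Local Notation K y j := (fun t => y t j ord0).

Lemma mxnorm_cV (A : 'cV[R[i]]_q) : mxnorm A = \sum_i cabs (A i ord0).
Proof. by apply: eq_bigr => i _; rewrite big_ord1. Qed.

Lemma cabs_le_mxnorm (A : 'cV[R[i]]_q) i : cabs (A i ord0) <= mxnorm A.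
Proof.
rewrite mxnorm_cV (bigD1 i)//= lerDl; apply: sumr_ge0 => j _; exact: cabs_ge0.
Qed.

Lemma mx_lin q' m' c (A A' : 'M[R[i]]_(q', m')) i j :
  (c *: A + A') i j = c * A i j + A' i j.
Proof. by rewrite !mxE. Qed.

Lemma entry_lin c y z j : K (c *: y + z) j = fun t => c * y t j ord0 + z t j ord0.
Proof. by apply/funext => t; rewrite fctE !mxE. Qed.

Lemma sobolev_vec_lin c y z : W y -> W z -> W (c *: y + z).
Proof. by move=> Wy Wz j; rewrite entry_lin; exact: sobolev_lin. Qed.

Lemma sobolev_norm_vec_fin y : W y -> W_norm y \is a fin_num.
Proof. by move=> Wy; apply/sum_fin_numP => j _ _; exact: sobolev_norm_fin. Qed.

Lemma sobolev_norm_vec_ge0 y : (0 <= W_norm y)%E.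
Proof. by apply: sume_ge0 => j _; exact: sobolev_norm_ge0. Qed.

Lemma fine_sobolev_norm_vec y : W y ->
  fine (W_norm y) = \sum_j fine (sobolev_norm a b k.+1 p (K y j)).
Proof.
move=> Wy; rewrite -sum_fine// => j _; exact: sobolev_norm_fin.
Qed.

Lemma cintegral_sum I (s : seq I) (F : I -> R -> R[i]) :
  (forall i, in_Lp a b 1 (F i)) ->
  in_Lp a b 1 (fun t => \sum_(i <- s) F i t) /\
  cintegral a b (fun t => \sum_(i <- s) F i t) = \sum_(i <- s) cintegral a b (F i).
Proof.
move=> F1; elim: s => [|i s [ih1 ih2]].
  under eq_fun do rewrite big_nil; rewrite big_nil; split; first exact: in_Lp0.
  by rewrite /cintegral /= Rintegral_cst ?mul0r.
have -> : (fun t => \sum_(i <- i :: s) F i t) =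
    fun t => 1 * F i t + \sum_(i <- s) F i t.
  by apply/funext => t; rewrite big_cons mul1r.
by split; [exact: in_Lp_lin|rewrite cintegral_lin// mul1r big_cons ih2].
Qed.

Section FixedCoefficients.
Variables (alpha : 'I_k.+1 -> 'M[R[i]]_(q, m)) (Phi : R -> 'M[R[i]]_(q, m)).
Hypothesis PhiL : in_Lp_mx a b p' Phi.
Let B := canonical_operator a b t0 alpha Phi.

Lemma canonical_operator_integrable i j f : in_sobolev a b k.+1 p f ->
  in_Lp a b 1 (fun t => Phi t i j * D k.+1 f t).
Proof. by move=> [_ _ fp]; have [] := in_LpM p1 fp (PhiL i j). Qed.

(** Splitting the integral of the matrix product into scalar integrals requires each product to be
    integrable, which Hoelder provides for y in W. *)
Lemma canonical_operatorE y i : W y ->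
  B y i ord0 = \sum_j (\sum_s alpha s i j * D s (K y j) t0 +
                       cintegral a b (fun t => Phi t i j * D k.+1 (K y j) t)).
Proof.
move=> Wy; rewrite !mxE summxE big_split /= exchange_big /=; congr (_ + _).
  by apply: eq_bigr => s _; rewrite mxE; apply: eq_bigr => j _; rewrite mxE.
rewrite -(cintegral_sum (index_enum _) _).2; last first.
  by move=> j; exact: canonical_operator_integrable.
congr cintegral; apply/funext => t; rewrite mxE.
by apply: eq_bigr => j _; rewrite mxE.
Qed.

Lemma canonical_operator_linear : sobolev_linear a b k.+1 p B.
Proof.
move=> c y z Wy Wz; apply/matrixP => i j0; have {j0}-> : j0 = ord0 by exact: ord1.
rewrite [RHS]mx_lin.
apply: etrans (canonical_operatorE i (sobolev_vec_lin c Wy Wz)) _.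
apply: etrans (esym (congr2 (fun u v => c * u + v)
  (canonical_operatorE i Wy) (canonical_operatorE i Wz))) => /=.
rewrite mulr_sumr -big_split /=; apply: eq_bigr => j _.
rewrite entry_lin.
have -> : \sum_s alpha s i j * D s (fun t => c * y t j ord0 + z t j ord0) t0 =
    c * \sum_s alpha s i j * D s (K y j) t0 + \sum_s alpha s i j * D s (K z j) t0.
  rewrite mulr_sumr -big_split /=; apply: eq_bigr => s _.
  by rewrite (sobolev_lin_deriv ab c (Wy j) (Wz j))//; [ring|rewrite -ltnS].
have -> : cintegral a b (fun t => Phi t i j *
      D k.+1 (fun t => c * y t j ord0 + z t j ord0) t) =
    c * cintegral a b (fun t => Phi t i j * D k.+1 (K y j) t) +
    cintegral a b (fun t => Phi t i j * D k.+1 (K z j) t).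
  rewrite -cintegral_lin; [|exact: canonical_operator_integrable..].
  apply: cintegral_ae; apply: ae_apply (sobolev_lin_deriv_ae ab c (Wy j) (Wz j)).
  by move=> t e tab; rewrite -e//; ring.
by rewrite mulrDr addrACA.
Qed.

(** One constant C serves all k + 1 point evaluations, and the maximum dominates each coefficient
    norm: hence k.+1 * C. Hoelder and [cabs_cintegral] have constant 1, so the norm of Phi enters
    without a factor. *)
Lemma canonical_operator_bound C : 0 <= C ->
  (forall f s, in_sobolev a b k.+1 p f -> (s <= k)%N ->
    cabs (D s f t0) <= C * fine (sobolev_norm a b k.+1 p f)) ->
  forall y, W y -> mxnorm (B y) <=
    (k.+1%:R * C * \big[Num.max/0]_(s < k.+1) mxnorm (alpha s)
     + fine (Lp_norm_mx a b p' Phi)) * fine (W_norm y).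
Proof.
move=> C0 Cb y Wy; set A := \big[_/_]_(s < _) _.
have A0 : 0 <= A.
  by rewrite /A; elim/big_rec: _ => // s x _ x0; rewrite le_max x0 orbT.
have alphaA s : \sum_i \sum_j cabs (alpha s i j) <= A.
  by rewrite -/(mxnorm _) /A (bigD1 s)//= le_max lexx.
pose S j := fine (sobolev_norm a b k.+1 p (K y j)).
have S0 j : 0 <= S j by rewrite fine_ge0// sobolev_norm_ge0.
have SW j : S j <= fine (W_norm y).
  rewrite fine_sobolev_norm_vec// (bigD1 j)//= lerDl; apply: sumr_ge0 => j' _.
  exact: S0.
pose P i j := fine (N p' (fun t => Phi t i j)).
have P0 i j : 0 <= P i j by rewrite fine_ge0// Lp_norm_ge0.
have -> : fine (Lp_norm_mx a b p' Phi) = \sum_i \sum_j P i j.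
  rewrite /Lp_norm_mx -sum_fine; last first.
    by move=> i _; apply/sum_fin_numP => j _ _; exact: Lp_norm_fin.
  by apply: eq_bigr => i _; rewrite -sum_fine// => j _; exact: Lp_norm_fin.
have intb i j : cabs (cintegral a b (fun t => Phi t i j * D k.+1 (K y j) t)) <=
    P i j * S j.
  have [_ _ yp] := Wy j; have [L1 le1] := in_LpM p1 yp (PhiL i j).
  rewrite -lee_fin (le_trans (cabs_cintegral L1))// (le_trans le1)//.
  rewrite EFinM fineK ?Lp_norm_fin// lee_wpmul2l ?Lp_norm_ge0//.
  by rewrite fineK ?sobolev_norm_fin// Lp_norm_le_sobolev_norm.
have entry i : cabs (B y i ord0) <=
    (\sum_j (\sum_s cabs (alpha s i j) * C + P i j)) * fine (W_norm y).
  rewrite canonical_operatorE// mulr_suml (le_trans (cabs_sum _ _))//.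
  apply: ler_sum => j _; rewrite (le_trans (cabsD _ _))// mulrDl lerD//.
    rewrite mulr_suml (le_trans (cabs_sum _ _))//; apply: ler_sum => s _.
    rewrite cabsM -mulrA ler_wpM2l ?cabs_ge0// (le_trans (Cb _ _ (Wy j) _))//.
      by rewrite -ltnS.
    by rewrite ler_wpM2l// SW.
  by rewrite (le_trans (intb i j))// ler_wpM2l.
rewrite mxnorm_cV (le_trans (ler_sum _ (fun i _ => entry i)))// -mulr_suml.
rewrite ler_wpM2r ?fine_ge0 ?sobolev_norm_vec_ge0//.
under eq_bigr do rewrite big_split /=.
rewrite big_split /= lerD2r.
under eq_bigr do rewrite exchange_big /=.
rewrite exchange_big /= -mulrA mulr_natl -[X in _ *+ X](card_ord k.+1) -sumr_const.
apply: ler_sum => s _; under eq_bigr do rewrite -mulr_suml.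
by rewrite -mulr_suml mulrC ler_wpM2l// alphaA.
Qed.

End FixedCoefficients.


Lemma bounded_sobolev_continuous (B : _ -> 'cV[R[i]]_q) (M : R) :
  sobolev_linear a b k.+1 p B -> 0 <= M ->
  (forall y, W y -> mxnorm (B y) <= M * fine (W_norm y)) ->
  sobolev_continuous a b k.+1 p B.
Proof.
move=> Blin M0 BM y Wy eps eps0; have M1 : 0 < M + 1 by rewrite ltr_wpDl.
exists (eps / (M + 1)); first by rewrite divr_gt0.
move=> z Wz; have -> : z - y = (-1 : R[i]) *: y + z by rewrite scaleN1r addrC.
have Wzy := sobolev_vec_lin (-1) Wy Wz.
rewrite -{1}(fineK (sobolev_norm_vec_fin Wzy)) lte_fin => zy.
have -> : B z - B y = B ((-1 : R[i]) *: y + z) by rewrite Blin// scaleN1r addrC.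
rewrite (le_lt_trans (BM _ Wzy))//.
rewrite (@le_lt_trans _ _ ((M + 1) * fine (W_norm (-1 *: y + z))))//.
  by rewrite ler_wpM2r ?lerDl// fine_ge0// sobolev_norm_vec_ge0.
by rewrite mulrC -ltr_pdivlMr.
Qed.

Lemma sobolev_opnorm_le (B : _ -> 'cV[R[i]]_q) (M : R) : 0 <= M ->
  (forall y, W y -> mxnorm (B y) <= M * fine (W_norm y)) ->
  (sobolev_opnorm a b k.+1 p B <= M%:E)%E.
Proof.
move=> M0 BM; apply: ub_ereal_sup => _ [y [Wy y1] <-]; rewrite lee_fin.
rewrite (le_trans (BM y Wy))// -[leRHS]mulr1 ler_wpM2l//.
by rewrite -lee_fin fineK// sobolev_norm_vec_fin.
Qed.

End CanonicalOperator.

(** * Vector-valued Sobolev functions through their data *)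

Section SobolevData.
Context {R : realType}.
Variables (a b t0 : R) (p : \bar R) (k m : nat).
Hypotheses (ab : a < b) (t0ab : t0 \in `[a, b]) (p1 : (1 <= p)%E).
Implicit Types (y z : R -> 'cV[R[i]]_m) (d : 'I_m -> 'I_k.+1 -> R[i]).
Implicit Types (g : 'I_m -> R -> R[i]).
Local Notation mu := (@lebesgue_measure R).
Local Notation D := (cderiven_on a b).
Local Notation W := (@in_sobolev_vec R m a b k.+1 p).
Local Notation W_norm := (@sobolev_norm_vec R m a b k.+1 p).
Local Notation N := (Lp_norm a b).
Local Notation p' := (hoelder_conjugate p).
Local Notation K y j := (fun t => y t j ord0).

(* An element of the Sobolev space is determined on [a, b] by its derivatives
   at t0 and by its top derivative. *)
Definition sobolev_data y d g :=
  [/\ W y, forall j (s : 'I_k.+1), D s (K y j) t0 = d j s &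
      forall j, {ae mu, forall t, t \in `[a, b] -> D k.+1 (K y j) t = g j t}].

Definition sobolev_lift d g : R -> 'cV[R[i]]_m :=
  fun t => \col_j sobolev_primitive a t0 k.+1 (fun s => d j (inord s)) (g j) t.

Lemma sobolev_liftP d g : (forall j, in_Lp a b p (g j)) ->
  sobolev_data (sobolev_lift d g) d g.
Proof.
move=> gp; have E j : K (sobolev_lift d g) j =
    sobolev_primitive a t0 k.+1 (fun s => d j (inord s)) (g j).
  by apply/funext => t; rewrite mxE.
split=> [j|j s|j].
- by rewrite E; exact: sobolev_primitive_sobolev.
- have [g1 _] := in_Lp_in_L1 p1 (gp j).
  by rewrite E sobolev_primitive_initial ?inord_val// -ltnS.
- have [g1 _] := in_Lp_in_L1 p1 (gp j); rewrite E.
  apply: ae_apply (sobolev_primitive_deriv_ae ab t0ab k (fun s => d j (inord s)) g1).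
  by move=> t e tab; rewrite -e.
Qed.

Lemma sobolev_data_lin c y z d d' g g' :
  sobolev_data y d g -> sobolev_data z d' g' ->
  sobolev_data (c *: y + z) (fun j s => c * d j s + d' j s)
    (fun j t => c * g j t + g' j t).
Proof.
move=> [Wy yd yg] [Wz zd zg]; split=> [|j s|j]; first exact: sobolev_vec_lin.
  rewrite entry_lin (sobolev_lin_deriv ab c (Wy j) (Wz j))// ?yd ?zd//.
  by rewrite -ltnS.
rewrite entry_lin.
apply: (ae_apply2 _ (ae_apply2 (fun x => @conj _ _) (yg j) (zg j))
  (sobolev_lin_deriv_ae ab c (Wy j) (Wz j))).
by move=> t [yt zt] e tab; rewrite -e// yt// zt.
Qed.

Lemma sobolev_data_congr y d d' g g' : sobolev_data y d g ->
  (forall j s, d j s = d' j s) ->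
  (forall j t, t \in `[a, b] -> g j t = g' j t) -> sobolev_data y d' g'.
Proof.
move=> [Wy yd yg] dd gg; split=> // [j s|j]; first by rewrite yd.
by apply: ae_apply (yg j) => t yt tab; rewrite yt// gg.
Qed.

(** The zero function appears as -1 times a lift plus the same lift, which avoids computing its
    iterated derivatives. *)
Lemma sobolev_data0 : sobolev_data 0 (fun _ _ => 0) (fun _ _ => 0).
Proof.
have H : sobolev_data (sobolev_lift (fun _ _ => 0) (fun _ _ => 0))
    (fun _ _ => 0) (fun _ _ => 0) by apply: sobolev_liftP => j; exact: in_Lp0.
have := sobolev_data_lin (-1) H H; rewrite scaleN1r addNr => H0.
by apply: sobolev_data_congr H0 _ _ => *; rewrite mulr0 addr0.
Qed.

Lemma sobolev_data_sum I (r : seq I) (u : I -> R[i]) (Y : I -> R -> 'cV[R[i]]_m)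
    (d : I -> 'I_m -> 'I_k.+1 -> R[i]) (g : I -> 'I_m -> R -> R[i]) :
  (forall x, sobolev_data (Y x) (d x) (g x)) ->
  sobolev_data (\sum_(x <- r) u x *: Y x)
    (fun j s => \sum_(x <- r) u x * d x j s)
    (fun j t => \sum_(x <- r) u x * g x j t).
Proof.
move=> Yd; elim: r => [|x r ih].
  rewrite big_nil; apply: sobolev_data_congr sobolev_data0 _ _ => *.
    by rewrite big_nil.
  by rewrite big_nil.
rewrite big_cons; apply: sobolev_data_congr (sobolev_data_lin (u x) (Yd x) ih) _ _ => *.
  by rewrite big_cons.
by rewrite big_cons.
Qed.

Lemma sobolev_data_norm : exists2 C : R, 0 <= C & forall y g,
  (forall j, in_Lp a b p (g j)) -> sobolev_data y (fun _ _ => 0) g ->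
  fine (W_norm y) <= C * \sum_j fine (N p (g j)).
Proof.
have [C C0 Cb] := sobolev_norm_zero_data ab t0ab p1 k; exists C => // y g gp [Wy yd yg].
rewrite fine_sobolev_norm_vec// mulr_sumr; apply: ler_sum => j _.
rewrite -lee_fin EFinM fineK ?sobolev_norm_fin// fineK ?Lp_norm_fin//.
rewrite -(Lp_norm_ae p (yg j)); apply: Cb => // s sk.
by rewrite -(yd j (Ordinal (sk : (s < k.+1)%N))).
Qed.

(** Expresses the operator through the data alone, so that it can be evaluated on lifts without
    differentiating them. *)
Lemma canonical_operator_data q (alpha : 'I_k.+1 -> 'M[R[i]]_(q, m))
    (Phi : R -> 'M[R[i]]_(q, m)) y d g i :
  in_Lp_mx a b p' Phi -> sobolev_data y d g ->
  canonical_operator a b t0 alpha Phi y i ord0 =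
  \sum_j (\sum_s alpha s i j * d j s + cintegral a b (fun t => Phi t i j * g j t)).
Proof.
move=> PhiL [Wy yd yg]; apply: etrans (canonical_operatorE t0 p1 alpha PhiL i Wy) _.
apply: eq_bigr => j _; congr (_ + _).
  by apply: eq_bigr => s _; rewrite yd.
by apply: cintegral_ae; apply: ae_apply (yg j) => t yt tab; rewrite yt.
Qed.

Section BoundedOperators.
Variables (q : nat) (B : (R -> 'cV[R[i]]_m) -> 'cV[R[i]]_q) (M : R).
Hypotheses (Blin : sobolev_linear a b k.+1 p B) (M0 : 0 <= M).
Hypothesis BM : forall y, W y -> mxnorm (B y) <= M * fine (W_norm y).

(** As total functions y and z may differ off [a, b]. Their difference has zero data, hence Sobolev
    norm 0, and boundedness sends it to 0. *)
Lemma bounded_operator_data y z d g : sobolev_data y d g -> sobolev_data z d g ->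
  B y = B z.
Proof.
move=> yd zd; have [Wy _ _] := yd; have [Wz _ _] := zd.
have : sobolev_data ((-1 : R[i]) *: y + z) (fun _ _ => 0) (fun _ _ => 0).
  by apply: sobolev_data_congr (sobolev_data_lin (-1) yd zd) _ _ => *; ring.
move=> w0; have [Ww _ _] := w0; have [C C0 Cb] := sobolev_data_norm.
have norm0 : fine (W_norm ((-1 : R[i]) *: y + z)) <= 0.
  rewrite (le_trans (Cb _ _ _ w0))//; first by move=> j; exact: in_Lp0.
  rewrite big1 ?mulr0// => j _; rewrite Lp_norm0//; exact: aeW.
have Bw : mxnorm (B ((-1 : R[i]) *: y + z)) <= 0.
  by rewrite (le_trans (BM Ww))// mulr_ge0_le0.
apply/matrixP => i j; have {j}-> : j = ord0 by exact: ord1.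
have := le_trans (cabs_le_mxnorm _ i) Bw.
rewrite Blin// mx_lin mulN1r addrC => le0; apply/esym/eqP; rewrite -subr_eq0.
by apply/eqP/cabs0_eq/eqP; rewrite eq_le le0 cabs_ge0.
Qed.

Lemma bounded_operator_sum I (r : seq I) (u : I -> R[i]) (Y : I -> R -> 'cV[R[i]]_m) :
  (forall x, W (Y x)) ->
  W (\sum_(x <- r) u x *: Y x) /\
  B (\sum_(x <- r) u x *: Y x) = \sum_(x <- r) u x *: B (Y x).
Proof.
move=> WY; elim: r => [|x r [ih1 ih2]].
  rewrite !big_nil; have [W0 _ _] := sobolev_data0; split => //.
  by have := Blin (-1) W0 W0; rewrite !scaleN1r !addNr.
by rewrite !big_cons; split; [exact: sobolev_vec_lin|rewrite Blin// ih2].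
Qed.

End BoundedOperators.
End SobolevData.

(** * Existence and uniqueness of the canonical representation *)

Section Representation.
Context {R : realType}.
Variables (a b t0 : R) (p : \bar R) (k m q : nat).
Hypotheses (ab : a < b) (t0ab : t0 \in `[a, b]) (p1 : (1 <= p)%E).
Implicit Types (y : R -> 'cV[R[i]]_m) (f : R -> R[i]).
Implicit Types (alpha : 'I_k.+1 -> 'M[R[i]]_(q, m)) (Phi : R -> 'M[R[i]]_(q, m)).
Local Notation mu := (@lebesgue_measure R).
Local Notation D := (cderiven_on a b).
Local Notation W := (@in_sobolev_vec R m a b k.+1 p).
Local Notation W_norm := (@sobolev_norm_vec R m a b k.+1 p).
Local Notation N := (Lp_norm a b).
Local Notation p' := (hoelder_conjugate p).
Local Notation K y j := (fun t => y t j ord0).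
Local Notation data := (@sobolev_data R a b t0 p k m).

Definition sobolev_basis (j0 : 'I_m) (s0 : 'I_k.+1) : R -> 'cV[R[i]]_m :=
  sobolev_lift a t0 (fun j s => ((j == j0) && (s == s0))%:R) (fun _ _ => 0).

Definition sobolev_test (j0 : 'I_m) f : R -> 'cV[R[i]]_m :=
  sobolev_lift a t0 (fun _ (_ : 'I_k.+1) => 0)
    (fun j t => if j == j0 then f t else 0).

Lemma sobolev_basisP j0 s0 : data (sobolev_basis j0 s0)
  (fun j s => ((j == j0) && (s == s0))%:R) (fun _ _ => 0).
Proof. by apply: sobolev_liftP => // j; exact: in_Lp0. Qed.

Lemma sobolev_testP j0 f : in_Lp a b p f -> data (sobolev_test j0 f)
  (fun _ _ => 0) (fun j t => if j == j0 then f t else 0).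
Proof.
move=> fp; apply: sobolev_liftP => // j; case: (j == j0) => //; exact: in_Lp0.
Qed.

Lemma cintegral0 : cintegral a b (fun=> 0) = 0 :> R[i].
Proof. by rewrite /cintegral /= Rintegral_cst ?mul0r. Qed.

Lemma canonical_operator_basis alpha Phi i j s : in_Lp_mx a b p' Phi ->
  canonical_operator a b t0 alpha Phi (sobolev_basis j s) i ord0 = alpha s i j.
Proof.
move=> PhiL.
apply: etrans (canonical_operator_data p1 alpha i PhiL (sobolev_basisP j s)) _.
rewrite big_split /= [X in _ + X]big1 ?addr0 => [|j' _]; last first.
  by under eq_fun do rewrite mulr0; exact: cintegral0.
rewrite (bigD1 j)//= [X in _ + X]big1 ?addr0 => [|j' /negPf ->]; last first.
  by rewrite big1// => s' _; rewrite mulr0.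
rewrite (bigD1 s)//= !eqxx mulr1 big1 ?addr0// => s' /negPf ->.
by rewrite mulr0.
Qed.

Lemma canonical_operator_test alpha Phi i j f : in_Lp_mx a b p' Phi ->
  in_Lp a b p f -> canonical_operator a b t0 alpha Phi (sobolev_test j f) i ord0 =
  cintegral a b (fun t => Phi t i j * f t).
Proof.
move=> PhiL fp.
apply: etrans (canonical_operator_data p1 alpha i PhiL (sobolev_testP j fp)) _.
rewrite big_split /= [X in X + _]big1 ?add0r => [|j' _]; last first.
  by rewrite big1// => s' _; rewrite mulr0.
rewrite (bigD1 j)//= eqxx big1 ?addr0// => j' /negPf ->.
by under eq_fun do rewrite mulr0; exact: cintegral0.
Qed.

Lemma canonical_operator_inj alpha1 alpha2 Phi1 Phi2 :
  in_Lp_mx a b p' Phi1 -> in_Lp_mx a b p' Phi2 ->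
  (forall y, W y -> canonical_operator a b t0 alpha1 Phi1 y =
                    canonical_operator a b t0 alpha2 Phi2 y) ->
  (forall s, alpha1 s = alpha2 s) /\ Phi1 = Phi2 %[ae mu in `[a, b]%classic].
Proof.
move=> L1 L2 e; split=> [s|].
  apply/matrixP => i j; have [Wb _ _] := sobolev_basisP j s.
  rewrite -(canonical_operator_basis alpha1 i j s L1).
  by rewrite -(canonical_operator_basis alpha2 i j s L2) e.
have eij (x : 'I_q * 'I_m) : {ae mu, forall t, t \in `[a, b] ->
    Phi1 t x.1 x.2 = Phi2 t x.1 x.2}.
  case: x => i j /=; have q1 := hoelder_conj_ge1 p1.
  have LPhi : in_Lp a b p' (fun t => -1 * Phi2 t i j + Phi1 t i j).
    exact: in_Lp_lin.
  have [LPhi1 _] := in_Lp_in_L1 q1 LPhi.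
  (* Indicators suffice as top derivatives: the difference of the two entries is in L_1 and
     integrates to 0 over every measurable set. *)
  have Phi0 E : measurable E ->
      cintegral a b (fun t => (-1 * Phi2 t i j + Phi1 t i j) * (\1_E t +i* 0)%C) = 0.
    move=> mE; have IE : in_Lp a b p (fun t => (\1_E t +i* 0)%C).
      exact: measurable_indic_in_Lp.
    have -> : (fun t => (-1 * Phi2 t i j + Phi1 t i j) * (\1_E t +i* 0)%C) =
        (fun t => -1 * (Phi2 t i j * (\1_E t +i* 0)%C) + Phi1 t i j * (\1_E t +i* 0)%C).
      by apply/funext => t; rewrite mulrDl mulrA.
    have [P1 _] := in_LpM p1 IE (L1 i j); have [P2 _] := in_LpM p1 IE (L2 i j).
    rewrite cintegral_lin// mulN1r addrC.
    rewrite -(canonical_operator_test alpha1 i j L1 IE).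
    rewrite -(canonical_operator_test alpha2 i j L2 IE) e ?subrr//.
    by have [] := sobolev_testP j IE.
  apply: ae_apply (cintegral_annihilator LPhi1 Phi0) => t t0' /t0'.
  by rewrite mulN1r addrC => /eqP; rewrite subr_eq0 => /eqP.
(* There is one null set for each entry, hence finitely many. *)
have := @filter_forall _ _ _ _ (ae_filter_ringOfSetsType mu) eij.
apply: ae_apply => t h tab; apply/matrixP => i j; exact: (h (i, j)).
Qed.

Section BoundedOperator.
Variables (B : (R -> 'cV[R[i]]_m) -> 'cV[R[i]]_q) (M : R).
Hypotheses (Blin : sobolev_linear a b k.+1 p B) (M0 : 0 <= M).
Hypothesis BM : forall y, W y -> mxnorm (B y) <= M * fine (W_norm y).
Hypothesis pfin : p \is a fin_num.

(** Lifting f with zero initial data turns an entry of B into a functional on L_p. Its linearity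
    rests on B depending on the data alone, and its bound is M times the constant of
    [sobolev_data_norm]. *)
Lemma bounded_operator_top_derivative i j : exists phi : R -> R[i],
  in_Lp a b p' phi /\ forall f, in_Lp a b p f ->
    B (sobolev_test j f) i ord0 = cintegral a b (fun t => phi t * f t).
Proof.
have [C C0 Cb] := @sobolev_data_norm R a b t0 p k m ab t0ab p1.
have pE : p = (fine p)%:E by rewrite fineK.
rewrite pE; apply: (@Lp_dual_representation R a b (fine p)
    (fun f => B (sobolev_test j f) i ord0) (M * C)).
- by rewrite -lee_fin fineK.
- exact: mulr_ge0.
- rewrite -pE => c f g fp gp; have [Wf _ _] := sobolev_testP j fp.
  have [Wg _ _] := sobolev_testP j gp.
  rewrite -mx_lin -Blin//; congr (fun_of_matrix _ i ord0).
  apply: (bounded_operator_data ab t0ab p1 Blin M0 BM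
    (sobolev_testP j (in_Lp_lin c p1 fp gp))).
  apply: sobolev_data_congr
    (sobolev_data_lin ab t0ab p1 c (sobolev_testP j fp) (sobolev_testP j gp)) _ _.
    by move=> *; rewrite mulr0 addr0.
  by move=> j' t _; case: (j' == j); rewrite ?mulr0 ?addr0.
- rewrite -pE => f fp; have fP := sobolev_testP j fp; have [Wf _ _] := fP.
  rewrite (le_trans (cabs_le_mxnorm _ i))// (le_trans (BM Wf))// -mulrA ler_wpM2l//.
  rewrite (le_trans (Cb _ _ _ fP))//.
    by move=> j'; case: (j' == j) => //; exact: in_Lp0.
  rewrite ler_wpM2l// (bigD1 j)//= eqxx big1 ?addr0// => j' /negPf ->.
  by rewrite Lp_norm0//; exact: aeW.
Qed.

Lemma bounded_operator_representation : exists alpha Phi,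
  in_Lp_mx a b p' Phi /\
  forall y, W y -> B y = canonical_operator a b t0 alpha Phi y.
Proof.
have [phi phiP] := choice (fun x : 'I_q * 'I_m =>
  bounded_operator_top_derivative x.1 x.2).
pose Phi t : 'M[R[i]]_(q, m) := \matrix_(i, j) phi (i, j) t.
pose alpha s : 'M[R[i]]_(q, m) := \matrix_(i, j) B (sobolev_basis j s) i ord0.
have PhiE i j : (fun t => Phi t i j) = phi (i, j) by apply/funext => t; rewrite mxE.
have PhiL : in_Lp_mx a b p' Phi by move=> i j; rewrite PhiE; exact: (phiP (i, j)).1.
exists alpha, Phi; split => // y Wy.
pose d j (s : 'I_k.+1) := D s (K y j) t0; pose g j := D k.+1 (K y j).
have gp j : in_Lp a b p (g j) by case: (Wy j).
have yP : data y d g by split => // j; exact: aeW.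
(* y is exchanged for a finite combination of basis and test functions with the same data, on which
   B is computed by linearity. *)
pose Z1 := \sum_(x : 'I_m * 'I_k.+1) d x.1 x.2 *: sobolev_basis x.1 x.2.
pose Z2 := \sum_j (1 : R[i]) *: sobolev_test j (g j).
have ZP : data ((1 : R[i]) *: Z1 + Z2) d g.
  apply: sobolev_data_congr (sobolev_data_lin ab t0ab p1 1
    (sobolev_data_sum ab t0ab p1 _ _ (fun x => sobolev_basisP x.1 x.2))
    (sobolev_data_sum ab t0ab p1 _ _ (fun j => sobolev_testP j (gp j)))) _ _.
  - move=> j s; rewrite mul1r [X in _ + X]big1 ?addr0 => [|j' _]; last by rewrite mulr0.
    rewrite (bigD1 (j, s))//= !eqxx mulr1 big1 ?addr0// => -[j' s'].
    by rewrite xpair_eqE /= ![_ == j]eq_sym ![_ == s]eq_sym => /negPf ->; rewrite mulr0.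
  - move=> j t _; rewrite [X in 1 * X]big1 ?mulr0 ?add0r => [|x _]; last by rewrite mulr0.
    rewrite (bigD1 j)//= eqxx mul1r big1 ?addr0// => j'.
    by rewrite eq_sym => /negPf ->; rewrite mulr0.
rewrite (bounded_operator_data ab t0ab p1 Blin M0 BM yP ZP).
have Wb (x : 'I_m * 'I_k.+1) : W (sobolev_basis x.1 x.2).
  by have [] := sobolev_basisP x.1 x.2.
have Wt j : W (sobolev_test j (g j)) by have [] := sobolev_testP j (gp j).
have [W1 B1] := bounded_operator_sum ab t0ab p1 Blin (index_enum _)
  (fun x => d x.1 x.2) Wb.
have [W2 B2] := bounded_operator_sum ab t0ab p1 Blin (index_enum _) (fun=> 1) Wt.
rewrite Blin// B1 B2.
apply/matrixP => i j0; have {j0}-> : j0 = ord0 by exact: ord1.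
apply: etrans _ (esym (canonical_operator_data p1 alpha i PhiL yP)).
rewrite mx_lin mul1r !summxE big_split /= pair_bigA /=; congr (_ + _).
  by apply: eq_bigr => x _; rewrite !mxE mulrC.
apply: eq_bigr => j _; rewrite mxE mul1r (phiP (i, j)).2//.
by congr cintegral; apply/funext => t; rewrite mxE.
Qed.

End BoundedOperator.
End Representation.

Theorem theorem3p2 (R : realType) (a b t0 : R) (n m r : nat) (p : \bar R)
  (hab : a < b) (hm : (0 < m)%N) (hr : (0 < r)%N)
  (ht0 : t0 \in `[a, b]) (hp : (1 <= p)%E) :
  (exists2 gamma : R, 0 < gamma &
     forall (alpha : 'I_(n + r) -> 'M[R[i]]_(r * m, m))
            (Phi : R -> 'M[R[i]]_(r * m, m)),
       in_Lp_mx a b (hoelder_conjugate p) Phi ->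
       [/\ sobolev_linear a b (n + r) p (canonical_operator a b t0 alpha Phi),
           sobolev_continuous a b (n + r) p
             (canonical_operator a b t0 alpha Phi) &
           (sobolev_opnorm a b (n + r) p (canonical_operator a b t0 alpha Phi)
            <= (gamma * \big[Num.max/0]_(s < n + r) mxnorm (alpha s))%:E
               + Lp_norm_mx a b (hoelder_conjugate p) Phi)%E])
  /\
  (p <> +oo%E ->
   forall B : (R -> 'cV[R[i]]_m) -> 'cV[R[i]]_(r * m),
     sobolev_linear a b (n + r) p B ->
     sobolev_bounded a b (n + r) p B ->
     (exists (alpha : 'I_(n + r) -> 'M[R[i]]_(r * m, m))
             (Phi : R -> 'M[R[i]]_(r * m, m)),
        in_Lp_mx a b (hoelder_conjugate p) Phi /\
        forall y, in_sobolev_vec a b (n + r) p y ->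
          B y = canonical_operator a b t0 alpha Phi y) /\
     (forall (alpha1 alpha2 : 'I_(n + r) -> 'M[R[i]]_(r * m, m))
             (Phi1 Phi2 : R -> 'M[R[i]]_(r * m, m)),
        in_Lp_mx a b (hoelder_conjugate p) Phi1 ->
        in_Lp_mx a b (hoelder_conjugate p) Phi2 ->
        (forall y, in_sobolev_vec a b (n + r) p y ->
          B y = canonical_operator a b t0 alpha1 Phi1 y) ->
        (forall y, in_sobolev_vec a b (n + r) p y ->
          B y = canonical_operator a b t0 alpha2 Phi2 y) ->
        (forall s, alpha1 s = alpha2 s) /\
        Phi1 = Phi2 %[ae @lebesgue_measure R in `[a, b]%classic])).
Proof.
(* Since r > 0 the order is a successor, the case in which [in_sobolev] speaks of derivatives. *)
case nrE : (n + r)%N => [|k]; first by move: nrE hr; case: (r) => // ?; rewrite addnS.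
move: (r * m)%N => q; split.
  have [C C0 Cb] := sobolev_point_bound hab ht0 hp k.
  have k1C0 : 0 <= k.+1%:R * C by rewrite mulr_ge0.
  (* C may be 0; adding 1 makes gamma positive. *)
  exists (k.+1%:R * C + 1); first by rewrite ltr_wpDl.
  move=> alpha Phi PhiL.
  have Phi0 : 0 <= fine (Lp_norm_mx a b (hoelder_conjugate p) Phi).
    by rewrite fine_ge0// sume_ge0// => i _; rewrite sume_ge0// => j _; exact: Lp_norm_ge0.
  have PhiF : Lp_norm_mx a b (hoelder_conjugate p) Phi \is a fin_num.
    by apply/sum_fin_numP => i _ _; apply/sum_fin_numP => j _ _; exact: Lp_norm_fin.
  set A := \big[Num.max/0]_(s < _) _.
  have A0 : 0 <= A by rewrite /A; elim/big_rec: _ => // s x _ x0; rewrite le_max x0 orbT.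
  have bound := canonical_operator_bound hab hp alpha PhiL C0 Cb.
  have lin := canonical_operator_linear hab ht0 hp alpha PhiL.
  have K0 : 0 <= k.+1%:R * C * A + fine (Lp_norm_mx a b (hoelder_conjugate p) Phi).
    by rewrite addr_ge0// mulr_ge0.
  split => //; first exact: bounded_sobolev_continuous lin K0 bound.
  rewrite (le_trans (sobolev_opnorm_le hab hp K0 bound))//.
  by rewrite -{2}(fineK PhiF) -EFinD lee_fin lerD2r ler_wpM2r// lerDl.
move=> pfin B Blin [M BM].
have pfn : p \is a fin_num by move: (p) hp pfin => [].
(* The constant in [sobolev_bounded] carries no sign, so its maximum with 0 is used. *)
have BM' y : in_sobolev_vec a b k.+1 p y ->
    mxnorm (B y) <= Num.max M 0 * fine (sobolev_norm_vec a b k.+1 p y).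
  move=> Wy; have Wfin := sobolev_norm_vec_fin hab hp Wy.
  rewrite (@le_trans _ _ (M * fine (sobolev_norm_vec a b k.+1 p y)))//.
    by rewrite -lee_fin EFinM fineK// BM.
  by rewrite ler_wpM2r ?fine_ge0 ?sobolev_norm_vec_ge0// le_max lexx.
have M0 : 0 <= Num.max M 0 by rewrite le_max lexx orbT.
split; first exact: (bounded_operator_representation hab ht0 hp Blin M0 BM' pfn).
move=> alpha1 alpha2 Phi1 Phi2 L1 L2 e1 e2.
apply: (canonical_operator_inj hab ht0 hp L1 L2) => y Wy.
by rewrite -e1// -e2.
Qed.
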